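(* Let $c>0$, let $s\in\mathbb{C}$ with $\Re(s)>2$, and let $x\in\mathbb{R}$ with $|x|\le 2c$. Then $$s(s-1)\sum_{n=1}^\infty\frac{1}{n^{s+1}}\cos\frac{n\pi x}{c}+\left(\frac{\pi x}{c}\right)^2\sum_{n=1}^\infty\frac{1}{n^{s-1}}\cos\frac{n\pi x}{c}=\sum_{k=0}^\infty(-1)^k\frac{(s-2k)(s+2k-1)}{(2k)!}\left(\frac{\pi x}{c}\right)^{2k}\zeta(s+1-2k).$$
   Context: $\zeta$ is the Riemann zeta function, analytically continued to $\mathbb{C}\setminus\{1\}$. Expressions with removable singularities are interpreted by continuity in $s$; in particular, when $s=2j$ for an integer $j$, the product $(s-2j)\zeta(s+1-2j)$ is understood as $\lim_{w\to1}(w-1)\zeta(w)=1$. *)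

(* Defs.v *)
From Stdlib Require Import Reals Factorial.
From Coquelicot Require Import Coquelicot.

Local Open Scope C_scope.

Definition Cexp (z : C) : C :=
  ((exp (Re z) * cos (Im z))%R, (exp (Re z) * sin (Im z))%R).

(** [n ^ s] for a positive integer [n]; junk at [n = 0], where [ln 0 = 0]. *)
Definition nat_Cpow (n : nat) (s : C) : C := Cexp (s * RtoC (ln (INR n))).

Definition analytic_at (f : C -> C) (z0 : C) : Prop :=
  exists (a : nat -> C) (r : R), (0 < r)%R /\
    forall z : C, (Cmod (z - z0) < r)%R ->
      is_pseries (K := C_AbsRing) (V := C_NormedModule) a (z - z0) (f z).

(** These two conditions determine [zeta] uniquely on [C \ {1}] (identity
    theorem); the value [zeta 1] is left unconstrained. *)
Definition is_riemann_zeta (zeta : C -> C) : Prop :=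
  (forall s : C, (1 < Re s)%R ->
     is_series (K := C_AbsRing) (V := C_NormedModule)
       (fun n : nat => 1 / nat_Cpow (S n) s) (zeta s)) /\
  (forall s : C, s <> 1 -> analytic_at zeta s).

(** [(w - 1) * zeta w], extended by continuity at the simple pole [w = 1],
    where the residue of [zeta] is 1. *)
Definition sub1_mul_zeta (zeta : C -> C) (w : C) : C :=
  if Ceq_dec w 1 then 1 else (w - 1) * zeta w.

(** [(-1)^k (s - 2k) (s + 2k - 1) / (2k)! y^(2k) zeta (s + 1 - 2k)], where
    [s - 2k] is [w - 1] for [w = s + 1 - 2k] and is absorbed in
    [sub1_mul_zeta], so that [s = 2k] is covered. *)
Definition zeta_cos_term (zeta : C -> C) (s : C) (y : R) (k : nat) : C :=
  (-(1)) ^ k * ((s + RtoC (INR (2 * k)) - 1) / RtoC (INR (fact (2 * k))))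
  * RtoC (y ^ (2 * k))%R
  * sub1_mul_zeta zeta (s + 1 - RtoC (INR (2 * k))).

(** [cos_dirichlet_sum t y l]: the series over [n >= 1] of [cos (n y) / n ^ t]
    converges to [l]. *)
Definition cos_dirichlet_sum (t : C) (y : R) (l : C) : Prop :=
  is_series (K := C_AbsRing) (V := C_NormedModule)
    (fun n : nat => 1 / nat_Cpow (S n) t * RtoC (cos (INR (S n) * y))) l.

(* Main.v *)
Require Import Defs.
From Stdlib Require Import Reals ZArith Lra Lia Factorial.
From Stdlib Require Import Classical_Prop FunctionalExtensionality.
From Coquelicot Require Import Coquelicot.

(** Let [G t y = sum_n cos (n y) / n^t], continued to all [t] for [0 < y < 2 PI] by
    repeated summation by parts; then [G'' = - G (t - 2)] in [y], and the distribution
    relations [sum_j G t ((y + 2 PI j) / N) = N^(1-t) G t y] hold for all [t], as does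
    [G t PI = (2^(1-t) - 1) zeta t].

    For [Re t < 0] these relations alone force [G t y = c y^(t-1) + O(1)] at [0], and a
    maximum principle applied to duplication then gives Hurwitz's formula: [G t] is [c]
    times the periodization of [|y|^(t-1)].  The binomial series expands it as
    [c y^(t-1)] plus an even power series on [(0, 2 PI)].  Integrating twice in [y]
    raises [t] by 2; the duplication formula at [y = 0] fixes the new constant term to
    be [zeta t] and kills the linear term.  So for [Re t] not an integer
    [G t y = c_t y^(t-1) + sum_k (-1)^k zeta (t - 2k) y^(2k) / (2k)!], where
    [c_t = - c_(t-2) / ((t-1) (t-2))].  This recursion makes the singular terms cancel in
    [s (s-1) G (s+1) + y^2 G (s-1)].

    The constants [c_t] and the gamma function are never computed.  The remaining
    values of [s] and [y] are limits from the right in [s]: the functional equation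
    and Raabe's test dominate the series uniformly up to [y = 2 PI], and
    [(w-1) zeta w -> 1] covers [s = 2k]. *)

Local Open Scope R_scope.


Ltac lca := apply injective_projections; simpl; ring.

Lemma ex_series_Rscal (c : R) (a : nat -> R) : ex_series a -> ex_series (fun n => c * a n).
Proof. apply (ex_series_scal (K := R_AbsRing) (V := R_NormedModule)). Qed.

Lemma exp_monotone (x y : R) : x <= y -> exp x <= exp y.
Proof. intros [h|h]; [left; now apply exp_increasing|right; now rewrite h]. Qed.

Lemma Cmod_Rabs2 (z : C) : Cmod z <= Rabs (Re z) + Rabs (Im z).
Proof.
  destruct z as [a b]; simpl.
  replace ((a, b) : C) with ((RtoC a + RtoC b * Ci)%C) by lca.
  eapply Rle_trans; [apply Cmod_triangle|].
  rewrite Cmod_mult, !Cmod_R, Cmod_Ci. lra.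
Qed.

Lemma im_le_Cmod (z : C) : Rabs (Im z) <= Cmod z.
Proof.
  eapply Rle_trans; [apply Rmax_r|apply (Rmax_Cmod z)].
Qed.

Lemma Cmod_sub_le (a b : C) : Cmod a - Cmod b <= Cmod (a - b).
Proof.
  assert (H := Cmod_triangle (a - b)%C b).
  replace ((a - b + b)%C) with a in H by ring. lra.
Qed.

Lemma Cmod_minus_sym (a b : C) : Cmod (a - b) = Cmod (b - a).
Proof. rewrite <- Cmod_opp. f_equal. ring. Qed.

Lemma Cmod_eps_eq (a b : C) (M : R) :
  (forall eps, 0 < eps -> Cmod (a - b) <= M * eps) -> a = b.
Proof.
  intros H. apply Ceq_minus, Cmod_eq_0.
  apply Rle_antisym; [|apply Cmod_ge_0].
  apply le_epsilon; intros eps He.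
  assert (HM : 0 < Rabs M + 1) by (pose proof (Rabs_pos M); lra).
  specialize (H (eps / (Rabs M + 1)) (Rdiv_lt_0_compat _ _ He HM)).
  assert (M * (eps / (Rabs M + 1)) <= eps).
  { apply Rle_trans with ((Rabs M + 1) * (eps / (Rabs M + 1))).
    - apply Rmult_le_compat_r; [apply Rlt_le, Rdiv_lt_0_compat; lra|].
      pose proof (Rle_abs M); lra.
    - right; field; lra. }
  lra.
Qed.

Fixpoint psum (a : nat -> C) (n : nat) : C :=
  match n with O => RtoC 0 | S k => (psum a k + a k)%C end.

Definition sums (a : nat -> C) (l : C) : Prop :=
  forall eps : R, 0 < eps ->
    exists N : nat, forall n : nat, (N <= n)%nat -> Cmod (psum a n - l) < eps.

Lemma sum_n_psum (a : nat -> C) (n : nat) :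
  sum_n (G := C_AbelianMonoid) a n = psum a (S n).
Proof.
  induction n as [|n IH].
  - rewrite sum_O. simpl. ring.
  - rewrite sum_Sn, IH. reflexivity.
Qed.

Lemma sums_is_series (a : nat -> C) (l : C) :
  sums a l <-> is_series (K := C_AbsRing) (V := C_NormedModule) a l.
Proof.
  split; intros H.
  - intros P HP. apply locally_C in HP.
    destruct HP as [eps HP].
    destruct (H eps (cond_pos eps)) as [N HN].
    exists N. intros n Hn. apply HP.
    change (Cmod (sum_n (G := C_AbelianMonoid) a n - l) < eps).
    rewrite sum_n_psum. apply HN. lia.
  - intros eps He.
    assert (HP : locally (T := C_UniformSpace) l (fun z => Cmod (z - l) < eps)).
    { apply locally_C. exists (mkposreal eps He). intros y Hy. exact Hy. }
    destruct (H _ HP) as [N HN].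
    exists (S N). intros n Hn. destruct n as [|n]; [lia|].
    rewrite <- sum_n_psum. apply HN. lia.
Qed.

Lemma psum_ext (a b : nat -> C) (n : nat) :
  (forall k, (k < n)%nat -> a k = b k) -> psum a n = psum b n.
Proof.
  induction n as [|n IH]; intros H; simpl; [reflexivity|].
  rewrite IH, H; auto.
Qed.

Lemma psum_plus (a b : nat -> C) (n : nat) :
  psum (fun k => a k + b k)%C n = (psum a n + psum b n)%C.
Proof. induction n as [|n IH]; simpl; [ring|rewrite IH; ring]. Qed.

Lemma psum_scal (c : C) (a : nat -> C) (n : nat) :
  psum (fun k => c * a k)%C n = (c * psum a n)%C.
Proof. induction n as [|n IH]; simpl; [ring|rewrite IH; ring]. Qed.

Lemma psum_const (c : C) (n : nat) : psum (fun _ => c) n = (RtoC (INR n) * c)%C.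
Proof.
  induction n as [|n IH]; [simpl; ring|].
  rewrite S_INR, RtoC_plus. simpl psum. rewrite IH. ring.
Qed.

Lemma psum_S_l (a : nat -> C) (n : nat) :
  psum a (S n) = (a O + psum (fun k => a (S k)) n)%C.
Proof.
  induction n as [|n IH]; [simpl; ring|].
  change (psum a (S (S n))) with ((psum a (S n) + a (S n))%C). rewrite IH. simpl; ring.
Qed.

Lemma psum_app (a : nat -> C) (n m : nat) :
  psum a (n + m) = (psum a n + psum (fun k => a (n + k)%nat) m)%C.
Proof.
  induction m as [|m IH]; [rewrite Nat.add_0_r; simpl; ring|].
  rewrite Nat.add_succ_r. simpl. rewrite IH. ring.
Qed.

Fixpoint rsum (b : nat -> R) (n : nat) : R :=
  match n with O => 0 | S k => rsum b k + b k end.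

Lemma sum_n_rsum (b : nat -> R) (n : nat) : sum_n b n = rsum b (S n).
Proof.
  induction n as [|n IH].
  - rewrite sum_O. simpl. ring.
  - rewrite sum_Sn, IH. reflexivity.
Qed.

Lemma rsum_le_Series (b : nat -> R) (n : nat) :
  (forall k, 0 <= b k) -> ex_series b -> rsum b n <= Series b.
Proof.
  intros Hb He.
  assert (Hs : is_lim_seq (sum_n b) (Series b)) by (apply Series_correct, He).
  assert (Hinc : forall m, sum_n b m <= sum_n b (S m)).
  { intros m. rewrite sum_Sn. unfold plus; simpl. specialize (Hb (S m)). lra. }
  assert (H := is_lim_seq_incr_compare _ _ Hs Hinc n).
  rewrite sum_n_rsum in H. simpl in H. specialize (Hb n). lra.
Qed.

Lemma Cmod_psum_le (a : nat -> C) (b : nat -> R) (n : nat) :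
  (forall k, (k < n)%nat -> Cmod (a k) <= b k) -> Cmod (psum a n) <= rsum b n.
Proof.
  induction n as [|n IH]; intros H; simpl; [rewrite Cmod_0; lra|].
  eapply Rle_trans; [apply Cmod_triangle|].
  apply Rplus_le_compat; [apply IH; intros; apply H|apply H]; lia.
Qed.

Lemma sums_unique (a : nat -> C) (l l' : C) : sums a l -> sums a l' -> l = l'.
Proof.
  intros H H'. apply (Cmod_eps_eq _ _ 2). intros eps He.
  destruct (H eps He) as [N HN]. destruct (H' eps He) as [N' HN'].
  specialize (HN (N + N')%nat ltac:(lia)). specialize (HN' (N + N')%nat ltac:(lia)).
  replace (l - l')%C with (- (psum a (N + N') - l) + (psum a (N + N') - l'))%C by ring.
  eapply Rle_trans; [apply Cmod_triangle|]. rewrite Cmod_opp. lra.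
Qed.

Lemma sums_ext (a b : nat -> C) (l : C) : (forall n, a n = b n) -> sums a l -> sums b l.
Proof.
  intros E H eps He. destruct (H eps He) as [N HN]. exists N. intros n Hn.
  rewrite <- (psum_ext a b); auto.
Qed.

Lemma sums_plus (a b : nat -> C) (l m : C) :
  sums a l -> sums b m -> sums (fun n => a n + b n)%C (l + m)%C.
Proof.
  intros H H' eps He.
  destruct (H (eps / 2)) as [N HN]; [lra|]. destruct (H' (eps / 2)) as [N' HN']; [lra|].
  exists (N + N')%nat. intros n Hn. rewrite psum_plus.
  replace (psum a n + psum b n - (l + m))%C with ((psum a n - l) + (psum b n - m))%C by ring.
  eapply Rle_lt_trans; [apply Cmod_triangle|].
  specialize (HN n ltac:(lia)). specialize (HN' n ltac:(lia)). lra.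
Qed.

Lemma sums_scal (c : C) (a : nat -> C) (l : C) :
  sums a l -> sums (fun n => c * a n)%C (c * l)%C.
Proof.
  intros H eps He.
  assert (Hc : 0 < Cmod c + 1) by (pose proof (Cmod_ge_0 c); lra).
  destruct (H (eps / (Cmod c + 1))) as [N HN]; [apply Rdiv_lt_0_compat; lra|].
  exists N. intros n Hn. rewrite psum_scal.
  replace (c * psum a n - c * l)%C with (c * (psum a n - l))%C by ring.
  rewrite Cmod_mult. specialize (HN n Hn).
  apply Rle_lt_trans with ((Cmod c) * (eps / (Cmod c + 1))).
  - apply Rmult_le_compat_l; [apply Cmod_ge_0|lra].
  - apply Rlt_le_trans with ((Cmod c + 1) * (eps / (Cmod c + 1))); [|right; field; lra].
    apply Rmult_lt_compat_r; [apply Rdiv_lt_0_compat|]; lra.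
Qed.

Lemma sums_minus (a b : nat -> C) (l m : C) :
  sums a l -> sums b m -> sums (fun n => a n - b n)%C (l - m)%C.
Proof.
  intros H H'. replace (l - m)%C with (l + (- (1)) * m)%C by ring.
  apply sums_ext with (fun n => a n + (- (1)) * b n)%C; [intros; ring|].
  apply sums_plus, sums_scal; assumption.
Qed.

Lemma sums_cons (a : nat -> C) (l : C) :
  sums (fun n => a (S n)) l -> sums a (a O + l)%C.
Proof.
  intros H eps He. destruct (H eps He) as [N HN]. exists (S N).
  intros n Hn. destruct n as [|n]; [lia|]. rewrite psum_S_l.
  replace (a O + psum (fun k => a (S k)) n - (a O + l))%C
    with (psum (fun k => a (S k)) n - l)%C by ring.
  apply HN. lia.
Qed.

Lemma sums_tail (a : nat -> C) (l : C) :
  sums a l -> sums (fun n => a (S n)) (l - a O)%C.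
Proof.
  intros H eps He. destruct (H eps He) as [N HN]. exists N.
  intros n Hn. specialize (HN (S n) ltac:(lia)). rewrite psum_S_l in HN.
  replace (psum (fun k => a (S k)) n - (l - a O))%C
    with (a O + psum (fun k => a (S k)) n - l)%C by ring. exact HN.
Qed.

Lemma sums_drop (a : nat -> C) (l : C) (k : nat) :
  sums a l -> sums (fun n => a (k + n)%nat) (l - psum a k)%C.
Proof.
  intros H eps He. destruct (H eps He) as [N HN]. exists N.
  intros n Hn. specialize (HN (k + n)%nat ltac:(lia)). rewrite psum_app in HN.
  replace (psum (fun n => a (k + n)%nat) n - (l - psum a k))%C
    with (psum a k + psum (fun n => a (k + n)%nat) n - l)%C by ring. exact HN.
Qed.

Lemma sums_finite (a : nat -> C) (k : nat) :
  (forall n, (k <= n)%nat -> a n = RtoC 0) -> sums a (psum a k).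
Proof.
  intros H eps He. exists k. intros n Hn.
  replace n with (k + (n - k))%nat by lia. rewrite psum_app.
  rewrite (psum_ext (fun j => a (k + j)%nat) (fun _ => RtoC 0)) by (intros; apply H; lia).
  rewrite psum_const.
  replace (_ - _)%C with (RtoC 0) by ring. rewrite Cmod_0. exact He.
Qed.

Lemma sums_Cmod_le (a : nat -> C) (b : nat -> R) (l : C) :
  sums a l -> (forall n, Cmod (a n) <= b n) -> ex_series b -> Cmod l <= Series b.
Proof.
  intros H Hb He. apply le_epsilon. intros eps Heps.
  destruct (H eps Heps) as [N HN]. specialize (HN N (le_n _)).
  assert (H1 := Cmod_sub_le l (psum a N)). rewrite Cmod_minus_sym in H1.
  assert (H2 := Cmod_psum_le a b N (fun k _ => Hb k)).
  assert (H3 : rsum b N <= Series b).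
  { apply rsum_le_Series; [|exact He].
    intros k. eapply Rle_trans; [apply Cmod_ge_0|apply Hb]. }
  lra.
Qed.

Definition tsum (a : nat -> C) : C :=
  (Series (fun n => Re (a n)), Series (fun n => Im (a n))).

Definition asum (a : nat -> C) : Prop := ex_series (fun n => Cmod (a n)).

Lemma asum_tsum (a : nat -> C) : asum a -> sums a (tsum a).
Proof.
  intros H.
  assert (He : ex_series (K := C_AbsRing) (V := C_NormedModule) a).
  { apply (ex_series_le (K := C_AbsRing) (V := C_CompleteNormedModule) a (fun n => Cmod (a n))).
    - intros n. right. reflexivity.
    - exact H. }
  destruct He as [l Hl]. apply sums_is_series in Hl.
  replace (tsum a) with l; [exact Hl|].
  assert (Hre : is_series (fun n => Re (a n)) (Re l)).
  { cut (is_lim_seq (sum_n (fun n => Re (a n))) (Re l)); [exact (fun h => h)|].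
    apply is_lim_seq_spec. intros eps. destruct (Hl eps (cond_pos eps)) as [N HN].
    exists N. intros n Hn. specialize (HN (S n) ltac:(lia)).
    replace (sum_n _ n) with (Re (psum a (S n))).
    - eapply Rle_lt_trans; [|exact HN].
      replace (Re (psum a (S n)) - Re l) with (Re (psum a (S n) - l)) by (unfold Cminus; rewrite re_plus, re_opp; reflexivity).
      apply re_le_Cmod.
    - rewrite sum_n_rsum. generalize (S n). intros m.
      induction m as [|m IH]; [reflexivity|]. simpl psum. rewrite re_plus, IH. reflexivity. }
  assert (Him : is_series (fun n => Im (a n)) (Im l)).
  { cut (is_lim_seq (sum_n (fun n => Im (a n))) (Im l)); [exact (fun h => h)|].
    apply is_lim_seq_spec. intros eps. destruct (Hl eps (cond_pos eps)) as [N HN].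
    exists N. intros n Hn. specialize (HN (S n) ltac:(lia)).
    replace (sum_n _ n) with (Im (psum a (S n))).
    - eapply Rle_lt_trans; [|exact HN].
      replace (Im (psum a (S n)) - Im l) with (Im (psum a (S n) - l)) by (unfold Cminus; rewrite im_plus, im_opp; reflexivity).
      apply im_le_Cmod.
    - rewrite sum_n_rsum. generalize (S n). intros m.
      induction m as [|m IH]; [reflexivity|]. simpl psum. rewrite im_plus, IH. reflexivity. }
  unfold tsum. apply is_series_unique in Hre, Him. rewrite Hre, Him.
  destruct l; reflexivity.
Qed.

Lemma asum_le (a : nat -> C) (b : nat -> R) :
  (forall n, Cmod (a n) <= b n) -> ex_series b -> asum a.
Proof.
  intros H Hb. unfold asum. apply (ex_series_le (K := R_AbsRing) (V := R_CompleteNormedModule) _ b).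
  - intros n. change (Rabs (Cmod (a n)) <= b n). rewrite Rabs_pos_eq; [apply H|apply Cmod_ge_0].
  - exact Hb.
Qed.

Lemma asum_scal (c : C) (a : nat -> C) : asum a -> asum (fun n => c * a n)%C.
Proof.
  intros H. apply asum_le with (fun n => Cmod c * Cmod (a n)).
  - intros n. rewrite Cmod_mult. lra.
  - apply (ex_series_Rscal (Cmod c) _ H).
Qed.

Lemma asum_plus (a b : nat -> C) : asum a -> asum b -> asum (fun n => a n + b n)%C.
Proof.
  intros H H'. apply asum_le with (fun n => Cmod (a n) + Cmod (b n)).
  - intros n. apply Cmod_triangle.
  - apply (ex_series_plus (K := R_AbsRing) (V := R_NormedModule) _ _ H H').
Qed.

Lemma tsum_eq (a : nat -> C) (l : C) : asum a -> sums a l -> tsum a = l.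
Proof. intros Ha H. exact (sums_unique a _ _ (asum_tsum a Ha) H). Qed.

Lemma asum_cons (a : nat -> C) : asum (fun n => a (S n)) -> asum a.
Proof. intros H. apply (ex_series_incr_1 (fun n => Cmod (a n))). exact H. Qed.

Lemma sums_tail_bound (a : nat -> C) (b : nat -> R) (l : C) (n : nat) :
  sums a l -> (forall k, (n <= k)%nat -> Cmod (a k) <= b k) -> (forall k, 0 <= b k) ->
  ex_series b -> Cmod (l - psum a n) <= Series b - rsum b n.
Proof.
  intros H Hb Hp He.
  assert (H1 := sums_drop a l n H).
  assert (He' : ex_series (fun k => b (n + k)%nat)) by (apply (ex_series_incr_n b n), He).
  assert (H2 : Series (fun k => b (n + k)%nat) = Series b - rsum b n).
  { destruct n as [|n]; [simpl; rewrite Rminus_0_r; reflexivity|].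
    rewrite (Series_incr_n b (S n)) by (lia || exact He). simpl Nat.pred.
    rewrite <- (sum_n_Reals b n), sum_n_rsum. ring. }
  rewrite <- H2. eapply sums_Cmod_le; [exact H1| |exact He'].
  intros k. apply Hb. lia.
Qed.

Lemma rsum_cv (b : nat -> R) : ex_series b ->
  forall eps, 0 < eps -> exists N, forall n, (N <= n)%nat -> Rabs (Series b - rsum b n) < eps.
Proof.
  intros He eps Heps.
  assert (Hs : is_lim_seq (sum_n b) (Series b)) by (apply Series_correct, He).
  apply is_lim_seq_spec in Hs. destruct (Hs (mkposreal eps Heps)) as [N HN].
  exists (S N). intros n Hn. destruct n as [|n]; [lia|].
  rewrite <- sum_n_rsum, Rabs_minus_sym. apply HN. lia.
Qed.

(** Domination by a product makes the exchange of summations elementary. *)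
Lemma sums_swap (u : nat -> nat -> C) (A B : nat -> R) :
  (forall i j, Cmod (u i j) <= A i * B j) ->
  (forall i, 0 <= A i) -> (forall j, 0 <= B j) ->
  ex_series A -> ex_series B ->
  asum (fun i => tsum (u i)) /\ asum (fun j => tsum (fun i => u i j)) /\
  tsum (fun i => tsum (u i)) = tsum (fun j => tsum (fun i => u i j)).
Proof.
  intros Hu HA HB HeA HeB.
  assert (HSA : 0 <= Series A) by (apply (rsum_le_Series A 0 HA HeA)).
  assert (HSB : 0 <= Series B) by (apply (rsum_le_Series B 0 HB HeB)).
  assert (Hr : forall i, asum (u i)).
  { intros i. apply asum_le with (fun j => A i * B j); [apply Hu|].
    apply (ex_series_Rscal (A i) _ HeB). }
  assert (Hc : forall j, asum (fun i => u i j)).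
  { intros j. apply asum_le with (fun i => B j * A i).
    - intros i. rewrite Rmult_comm. apply Hu.
    - apply (ex_series_Rscal (B j) _ HeA). }
  assert (Hr1 : forall i, Cmod (tsum (u i)) <= A i * Series B).
  { intros i. rewrite <- Series_scal_l. eapply sums_Cmod_le; [apply asum_tsum, Hr|apply Hu|].
    apply (ex_series_Rscal (A i) _ HeB). }
  assert (Hc1 : forall j, Cmod (tsum (fun i => u i j)) <= B j * Series A).
  { intros j. rewrite <- Series_scal_l. eapply sums_Cmod_le; [apply asum_tsum, Hc| |].
    - intros i. simpl. rewrite Rmult_comm. apply Hu.
    - apply (ex_series_Rscal (B j) _ HeA). }
  assert (Har : asum (fun i => tsum (u i))).
  { apply asum_le with (fun i => Series B * A i).
    - intros i. rewrite Rmult_comm. apply Hr1.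
    - apply (ex_series_Rscal _ _ HeA). }
  assert (Hac : asum (fun j => tsum (fun i => u i j))).
  { apply asum_le with (fun j => Series A * B j).
    - intros j. rewrite Rmult_comm. apply Hc1.
    - apply (ex_series_Rscal _ _ HeB). }
  split; [exact Har|]. split; [exact Hac|].
  apply tsum_eq; [exact Har|].
  intros eps Heps.
  assert (HSA1 : 0 < Series A + 1) by lra.
  destruct (rsum_cv B HeB (eps / (4 * (Series A + 1)))) as [J HJ];
    [apply Rdiv_lt_0_compat; lra|].
  specialize (HJ J (le_n _)).
  assert (HJ0 : Series A * (Series B - rsum B J) <= eps / 4).
  { apply Rle_trans with ((Series A + 1) * (eps / (4 * (Series A + 1)))).
    - apply Rmult_le_compat; try lra; [|pose proof (Rle_abs (Series B - rsum B J)); lra].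
      pose proof (rsum_le_Series B J HB HeB); lra.
    - right; field; lra. }
  set (L := tsum (fun j => tsum (fun i => u i j))).
  assert (HLJ : Cmod (L - psum (fun j => tsum (fun i => u i j)) J) <= eps / 4).
  { eapply Rle_trans; [|exact HJ0].
    assert (Hb : forall n, rsum (fun j => Series A * B j) n = Series A * rsum B n).
    { intros n. induction n as [|n IH]; simpl; [ring|rewrite IH; ring]. }
    rewrite Rmult_minus_distr_l, <- (Series_scal_l (Series A) B), <- Hb.
    apply sums_tail_bound; [apply asum_tsum, Hac| | |].
    - intros j _. simpl. rewrite Rmult_comm. apply Hc1.
    - intros j. simpl. apply Rmult_le_pos; [exact HSA|apply HB].
    - apply (ex_series_Rscal _ _ HeB). }
  assert (HsJ : sums (fun i => psum (fun j => u i j) J) (psum (fun j => tsum (fun i => u i j)) J)).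
  { clear HJ HJ0 HLJ. induction J as [|J IH]; simpl.
    - apply (sums_finite (fun _ => RtoC 0) 0). reflexivity.
    - apply sums_plus; [exact IH|apply asum_tsum, Hc]. }
  destruct (HsJ (eps / 4)) as [N HN]; [lra|].
  exists N. intros n Hn. specialize (HN n Hn).
  assert (Hd : Cmod (psum (fun i => tsum (u i)) n - psum (fun i => psum (fun j => u i j) J) n)
               <= eps / 4).
  { replace (_ - _)%C with (psum (fun i => tsum (u i) - psum (u i) J)%C n).
    2:{ unfold Cminus. rewrite psum_plus. f_equal.
        transitivity (psum (fun i => (- (1)) * psum (u i) J)%C n).
        - apply psum_ext. intros; ring.
        - rewrite psum_scal. change (fun i => psum (fun j => u i j) J) with (fun i => psum (u i) J). ring. }
    apply Rle_trans with (rsum (fun i => (Series B - rsum B J) * A i) n).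
    - apply Cmod_psum_le. intros i _.
      assert (Hb : forall n, rsum (fun j => A i * B j) n = A i * rsum B n).
      { intros m. induction m as [|m IH]; simpl; [ring|rewrite IH; ring]. }
      rewrite Rmult_comm, Rmult_minus_distr_l, <- (Series_scal_l (A i) B), <- Hb.
      apply sums_tail_bound; [apply asum_tsum, Hr| | |].
      + intros j _. apply Hu.
      + intros j. apply Rmult_le_pos; auto.
      + apply (ex_series_Rscal _ _ HeB).
    - eapply Rle_trans; [|exact HJ0]. rewrite Rmult_comm, <- (Series_scal_l (Series B - rsum B J) A).
      assert (0 <= Series B - rsum B J) by (pose proof (rsum_le_Series B J HB HeB); lra).
      apply rsum_le_Series.
      + intros k. apply Rmult_le_pos; auto.
      + apply (ex_series_Rscal _ _ HeA). }
  replace (psum (fun i => tsum (u i)) n - L)%C with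
    ((psum (fun i => tsum (u i)) n - psum (fun i => psum (fun j => u i j) J) n)
     + ((psum (fun i => psum (fun j => u i j) J) n - psum (fun j => tsum (fun i => u i j)) J)
     + - (L - psum (fun j => tsum (fun i => u i j)) J)))%C by ring.
  eapply Rle_lt_trans; [apply Cmod_triangle|].
  eapply Rle_lt_trans; [apply Rplus_le_compat_l, Cmod_triangle|].
  rewrite Cmod_opp. lra.
Qed.


Lemma Cexp_plus (a b : C) : Cexp (a + b) = (Cexp a * Cexp b)%C.
Proof.
  unfold Cexp. rewrite re_plus, im_plus, exp_plus, cos_plus, sin_plus.
  apply injective_projections; simpl; ring.
Qed.

Lemma Cexp_0 : Cexp (RtoC 0) = RtoC 1.
Proof. unfold Cexp; simpl. rewrite exp_0, cos_0, sin_0. lca. Qed.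

Lemma Cmod_Cexp (z : C) : Cmod (Cexp z) = exp (Re z).
Proof.
  unfold Cmod, Cexp; simpl.
  replace (_ + _) with (exp (Re z) * exp (Re z) * (Rsqr (sin (Im z)) + Rsqr (cos (Im z))))
    by (unfold Rsqr; ring).
  rewrite sin2_cos2, Rmult_1_r. apply sqrt_square, Rlt_le, exp_pos.
Qed.

Lemma Cexp_neq_0 (z : C) : Cexp z <> RtoC 0.
Proof. apply Cmod_gt_0. rewrite Cmod_Cexp. apply exp_pos. Qed.

Lemma Cexp_RtoC (x : R) : Cexp (RtoC x) = RtoC (exp x).
Proof. unfold Cexp; simpl. rewrite cos_0, sin_0. lca. Qed.

Lemma Cexp_opp (z : C) : Cexp (- z) = (/ Cexp z)%C.
Proof.
  assert (H : (Cexp (- z) * Cexp z)%C = RtoC 1).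
  { rewrite <- Cexp_plus. replace (- z + z)%C with (RtoC 0) by ring. apply Cexp_0. }
  replace (Cexp (- z)) with (Cexp (- z) * Cexp z * / Cexp z)%C by (field; apply Cexp_neq_0).
  rewrite H. ring.
Qed.

Definition cpow (x : R) (t : C) : C := Cexp (t * RtoC (ln x)).

Lemma cpow_plus (x : R) (a b : C) : cpow x (a + b) = (cpow x a * cpow x b)%C.
Proof. unfold cpow. rewrite <- Cexp_plus. f_equal. ring. Qed.

Lemma cpow_neq_0 (x : R) (a : C) : cpow x a <> RtoC 0.
Proof. apply Cexp_neq_0. Qed.

Lemma cpow_mult (x y : R) (a : C) :
  0 < x -> 0 < y -> cpow (x * y) a = (cpow x a * cpow y a)%C.
Proof.
  intros Hx Hy. unfold cpow. rewrite <- Cexp_plus, ln_mult, RtoC_plus by assumption.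
  f_equal. ring.
Qed.

Lemma cpow_opp (x : R) (a : C) : cpow x (- a) = (/ cpow x a)%C.
Proof. unfold cpow. rewrite <- Cexp_opp. f_equal. ring. Qed.

Lemma cpow_0 (x : R) : cpow x (RtoC 0) = RtoC 1.
Proof. unfold cpow. rewrite Cmult_0_l. apply Cexp_0. Qed.

Lemma cpow_1 (x : R) : 0 < x -> cpow x (RtoC 1) = RtoC x.
Proof.
  intros Hx. unfold cpow. rewrite Cmult_1_l, Cexp_RtoC, exp_ln by exact Hx. reflexivity.
Qed.

Lemma cpow_INR (x : R) (n : nat) : 0 < x -> cpow x (RtoC (INR n)) = RtoC (x ^ n).
Proof.
  intros Hx. induction n as [|n IH]; [apply cpow_0|].
  rewrite S_INR, RtoC_plus, cpow_plus, IH, cpow_1 by exact Hx. simpl.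
  rewrite RtoC_mult. ring.
Qed.

Lemma cpow_base_1 (a : C) : cpow 1 a = RtoC 1.
Proof. unfold cpow. rewrite ln_1, Cmult_0_r. apply Cexp_0. Qed.

Lemma Cmod_cpow (x : R) (a : C) : Cmod (cpow x a) = Rpower x (Re a).
Proof.
  unfold cpow, Rpower. rewrite Cmod_Cexp. f_equal. rewrite re_scal_r. reflexivity.
Qed.

Lemma nat_Cpow_inv (n : nat) (s : C) : (1 / nat_Cpow n s)%C = cpow (INR n) (- s).
Proof.
  rewrite cpow_opp. unfold nat_Cpow, cpow. field. apply Cexp_neq_0.
Qed.

(** * Functions of a real variable *)

Definition derC (f : R -> C) (x : R) (l : C) : Prop :=
  is_derive (fun y => Re (f y)) x (Re l) /\ is_derive (fun y => Im (f y)) x (Im l).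

Lemma derC_ext_loc (f g : R -> C) (x : R) (l : C) :
  locally x (fun y => f y = g y) -> derC f x l -> derC g x l.
Proof.
  intros H [H1 H2]. split.
  - eapply is_derive_ext_loc; [|exact H1]. revert H. apply filter_imp. intros y E. simpl. now rewrite E.
  - eapply is_derive_ext_loc; [|exact H2]. revert H. apply filter_imp. intros y E. simpl. now rewrite E.
Qed.

Lemma derC_ext (f g : R -> C) (x : R) (l : C) :
  (forall y, f y = g y) -> derC f x l -> derC g x l.
Proof. intros H. apply derC_ext_loc. now apply filter_forall. Qed.

Lemma derC_const (c : C) (x : R) : derC (fun _ => c) x (RtoC 0).
Proof. split; simpl; apply (is_derive_const (K := R_AbsRing) (V := R_NormedModule)). Qed.

Lemma derC_plus (f g : R -> C) (x : R) (l m : C) :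
  derC f x l -> derC g x m -> derC (fun y => f y + g y)%C x (l + m)%C.
Proof.
  intros [H1 H2] [H3 H4]. split.
  - apply (is_derive_plus (K := R_AbsRing) (V := R_NormedModule) _ _ _ _ _ H1 H3).
  - apply (is_derive_plus (K := R_AbsRing) (V := R_NormedModule) _ _ _ _ _ H2 H4).
Qed.

Lemma is_derive_Rmult (f g : R -> R) (x l m : R) :
  is_derive f x l -> is_derive g x m -> is_derive (fun y => f y * g y) x (l * g x + f x * m).
Proof.
  intros H1 H2. apply (is_derive_mult (K := R_AbsRing) f g x l m H1 H2).
  intros; apply Rmult_comm.
Qed.

Lemma derC_mult (f g : R -> C) (x : R) (l m : C) :
  derC f x l -> derC g x m -> derC (fun y => f y * g y)%C x (l * g x + f x * m)%C.
Proof.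
  intros [H1 H2] [H3 H4]. split.
  - simpl. eapply is_derive_ext; [intros y; symmetry; apply re_mult|].
    replace (fst _ * fst _ - _ + _) with
     ((Re l * Re (g x) + Re (f x) * Re m) - (Im l * Im (g x) + Im (f x) * Im m))
      by (unfold Re, Im; ring).
    apply (is_derive_minus (K := R_AbsRing) (V := R_NormedModule)); apply is_derive_Rmult; assumption.
  - simpl. eapply is_derive_ext; [intros y; symmetry; apply im_mult|].
    replace (fst _ * snd _ + _ + _) with
     ((Re l * Im (g x) + Re (f x) * Im m) + (Im l * Re (g x) + Im (f x) * Re m))
      by (unfold Re, Im; ring).
    apply (is_derive_plus (K := R_AbsRing) (V := R_NormedModule)); apply is_derive_Rmult; assumption.
Qed.

Lemma derC_scal (c : C) (f : R -> C) (x : R) (l : C) :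
  derC f x l -> derC (fun y => c * f y)%C x (c * l)%C.
Proof.
  intros H. replace (c * l)%C with (RtoC 0 * f x + c * l)%C by ring.
  apply derC_mult; [apply derC_const|exact H].
Qed.

Lemma derC_minus (f g : R -> C) (x : R) (l m : C) :
  derC f x l -> derC g x m -> derC (fun y => f y - g y)%C x (l - m)%C.
Proof.
  intros H1 H2. replace (l - m)%C with (l + (- (1)) * m)%C by ring.
  apply derC_ext with (fun y => f y + (- (1)) * g y)%C; [intros; ring|].
  apply derC_plus, derC_scal; assumption.
Qed.

Lemma derC_RtoC (f : R -> R) (x l : R) : is_derive f x l -> derC (fun y => RtoC (f y)) x (RtoC l).
Proof.
  intros H. split; [exact H|].
  exact (is_derive_const (K := R_AbsRing) (V := R_NormedModule) 0 x).
Qed.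

Lemma derC_comp (f : R -> C) (g : R -> R) (x : R) (l : C) (m : R) :
  derC f (g x) l -> is_derive g x m -> derC (fun y => f (g y)) x (RtoC m * l)%C.
Proof.
  intros [H1 H2] H. split.
  - rewrite re_scal_l. apply (is_derive_comp (fun y => Re (f y)) g x _ _ H1 H).
  - rewrite im_scal_l. apply (is_derive_comp (fun y => Im (f y)) g x _ _ H2 H).
Qed.

Lemma derC_Cexp (z : C) (f : R -> R) (x l : R) :
  is_derive f x l ->
  derC (fun y => Cexp (z * RtoC (f y))) x (z * RtoC l * Cexp (z * RtoC (f x)))%C.
Proof.
  intros H. replace (z * RtoC l * Cexp (z * RtoC (f x)))%C
    with (RtoC l * (z * Cexp (z * RtoC (f x))))%C by ring.
  apply (derC_comp (fun y => Cexp (z * RtoC y)) f); [|exact H].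
  generalize (f x). clear. intros x. destruct z as [a b]. split.
  - apply is_derive_ext with (fun y => exp (a * y) * cos (b * y)).
    { intros y. unfold Cexp. simpl. f_equal; f_equal; ring. }
    unfold Cexp. simpl. replace (a * x - b * 0) with (a * x) by ring.
    replace (a * 0 + b * x) with (b * x) by ring.
    auto_derive; [trivial|]. ring.
  - apply is_derive_ext with (fun y => exp (a * y) * sin (b * y)).
    { intros y. unfold Cexp. simpl. f_equal; f_equal; ring. }
    unfold Cexp. simpl. replace (a * x - b * 0) with (a * x) by ring.
    replace (a * 0 + b * x) with (b * x) by ring.
    auto_derive; [trivial|]. ring.
Qed.

Lemma derC_cpow (t : C) (x : R) : 0 < x ->
  derC (fun y => cpow y t) x (t * cpow x (t - 1))%C.
Proof.
  intros Hx. unfold Cminus. rewrite cpow_plus, cpow_opp, cpow_1 by exact Hx.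
  rewrite <- RtoC_inv by lra.
  replace (t * (cpow x t * RtoC (/ x)))%C with (t * RtoC (/ x) * cpow x t)%C by ring.
  apply (derC_Cexp t ln). apply is_derive_ln, Hx.
Qed.

Lemma is_derive_Rinv (g : R -> R) (x m : R) :
  g x <> 0 -> is_derive g x m -> is_derive (fun y => / g y) x (- m / g x ^ 2).
Proof. intros H1 H2. apply is_derive_inv; assumption. Qed.

Lemma derC_inv (f : R -> C) (x : R) (l : C) :
  f x <> RtoC 0 -> derC f x l -> derC (fun y => / f y)%C x (- l / (f x * f x))%C.
Proof.
  intros Hx [H1 H2].
  set (n := fun y => Re (f y) * Re (f y) + Im (f y) * Im (f y)).
  assert (Hn : n x <> 0).
  { unfold n. intros E. apply Hx. apply injective_projections.
    - apply Rsqr_0_uniq. unfold Rsqr, Re, Im in *. pose proof (Rle_0_sqr (fst (f x))).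
      pose proof (Rle_0_sqr (snd (f x))). unfold Rsqr in *. lra.
    - apply Rsqr_0_uniq. unfold Rsqr, Re, Im in *. pose proof (Rle_0_sqr (fst (f x))).
      pose proof (Rle_0_sqr (snd (f x))). unfold Rsqr in *. lra. }
  assert (Hdn := is_derive_Rinv n x _ Hn
    (is_derive_plus (K := R_AbsRing) (V := R_NormedModule) _ _ _ _ _
      (is_derive_Rmult _ _ _ _ _ H1 H1) (is_derive_Rmult _ _ _ _ _ H2 H2))).
  assert (E : (fun y => / f y)%C = (fun y => (Re (f y) * / n y, (- Im (f y)) * / n y))).
  { apply functional_extensionality. intros y.
    unfold Cinv, n, Re, Im, Rdiv. apply injective_projections; simpl; rewrite !Rmult_1_r; reflexivity. }
  rewrite E.
  assert (E2 : (- l / (f x * f x))%C = (- l * ((/ f x) * (/ f x)))%C) by (field; exact Hx).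
  rewrite E2. apply (f_equal (fun g => g x)) in E. simpl in E. rewrite E. clear E E2.
  assert (Hy := is_derive_Rmult _ _ _ _ _ H1 Hdn).
  assert (Hz := is_derive_Rmult _ _ _ _ _
    (is_derive_opp (K := R_AbsRing) (V := R_NormedModule) _ _ _ H2) Hdn).
  simpl in Hn, Hy, Hz. unfold plus, opp in Hy, Hz; simpl in Hy, Hz.
  split.
  - simpl. match type of Hy with is_derive _ _ ?v =>
      match goal with |- is_derive _ _ ?w => replace w with v; [exact Hy|] end end.
    fold (n x). unfold n, Re, Im in *. field. exact Hn.
  - simpl. match type of Hz with is_derive _ _ ?v =>
      match goal with |- is_derive _ _ ?w => replace w with v; [exact Hz|] end end.
    fold (n x). unfold n, Re, Im in *. field. exact Hn.
Qed.

Lemma derC_pow (f : R -> C) (x : R) (l : C) (n : nat) :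
  derC f x l -> derC (fun y => f y ^ n)%C x (RtoC (INR n) * f x ^ (pred n) * l)%C.
Proof.
  intros H. induction n as [|n IH].
  - simpl. replace (RtoC 0 * 1 * l)%C with (RtoC 0) by ring. apply derC_const.
  - apply derC_ext with (fun y => f y * f y ^ n)%C; [reflexivity|].
    replace (RtoC (INR (S n)) * f x ^ pred (S n) * l)%C
      with (l * f x ^ n + f x * (RtoC (INR n) * f x ^ (pred n) * l))%C.
    + apply derC_mult; assumption.
    + rewrite S_INR, RtoC_plus. destruct n as [|n]; [simpl; ring|]. simpl pred. rewrite Cpow_S. ring.
Qed.

Lemma derC_zero_const (f : R -> C) (a b : R) :
  a < b -> (forall x, a <= x <= b -> derC f x (RtoC 0)) -> f a = f b.
Proof.
  intros Hab H. apply injective_projections.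
  - apply (eq_is_derive (V := R_NormedModule) (fun x => fst (f x)) a b); [|exact Hab].
    intros x Hx. apply (H x Hx).
  - apply (eq_is_derive (V := R_NormedModule) (fun x => snd (f x)) a b); [|exact Hab].
    intros x Hx. apply (H x Hx).
Qed.

Lemma derC_zero_const_open (f : R -> C) (a b x y : R) :
  (forall x, a < x < b -> derC f x (RtoC 0)) -> a < x < b -> a < y < b -> f x = f y.
Proof.
  intros H Hx Hy. destruct (Rtotal_order x y) as [h|[h|h]].
  - apply (derC_zero_const f x y h). intros z Hz. apply H. lra.
  - now rewrite h.
  - symmetry. apply (derC_zero_const f y x h). intros z Hz. apply H. lra.
Qed.

Lemma derC_unique (f : R -> C) (x : R) (l m : C) : derC f x l -> derC f x m -> l = m.
Proof.
  intros [H1 H2] [H3 H4]. apply injective_projections.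
  - apply is_derive_unique in H1, H3. unfold Re in *. congruence.
  - apply is_derive_unique in H2, H4. unfold Im in *. congruence.
Qed.

Lemma derC_continuous (f : R -> C) (x : R) (l : C) : derC f x l ->
  forall eps, 0 < eps -> exists d, 0 < d /\ forall y, Rabs (y - x) < d -> Cmod (f y - f x) < eps.
Proof.
  intros [H1 H2] eps He.
  assert (C1 : continuous (fun y => Re (f y)) x)
    by (apply (ex_derive_continuous (K := R_AbsRing) (V := R_NormedModule)); eexists; apply H1).
  assert (C2 : continuous (fun y => Im (f y)) x)
    by (apply (ex_derive_continuous (K := R_AbsRing) (V := R_NormedModule)); eexists; apply H2).
  apply continuity_pt_filterlim in C1. apply continuity_pt_filterlim in C2.
  assert (He2 : eps / 2 > 0) by lra.
  destruct (C1 (eps / 2) He2) as [d1 [Hd1 C1']]. destruct (C2 (eps / 2) He2) as [d2 [Hd2 C2']].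
  exists (Rmin d1 d2). split; [apply Rmin_pos; assumption|].
  intros y Hy. destruct (Req_dec x y) as [->|Hne].
  { replace (f y - f y)%C with (RtoC 0) by ring. rewrite Cmod_0. exact He. }
  assert (HD1 : Rabs (Re (f y) - Re (f x)) < eps / 2).
  { apply (C1' y). split; [split; [exact I|exact Hne]|].
    simpl. unfold R_dist. eapply Rlt_le_trans; [exact Hy|apply Rmin_l]. }
  assert (HD2 : Rabs (Im (f y) - Im (f x)) < eps / 2).
  { apply (C2' y). split; [split; [exact I|exact Hne]|].
    simpl. unfold R_dist. eapply Rlt_le_trans; [exact Hy|apply Rmin_r]. }
  eapply Rle_lt_trans; [apply Cmod_Rabs2|].
  unfold Cminus. rewrite re_plus, im_plus, re_opp, im_opp. unfold Rminus in *. lra.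
Qed.

(** * Power series and the identity theorem *)

Definition rad (a : nat -> C) (rho : R) : Prop :=
  exists M, forall n, Cmod (a n) * rho ^ n <= M.

Lemma rad_bound_pos (a : nat -> C) (rho M : R) : (forall n, Cmod (a n) * rho ^ n <= M) -> 0 <= M.
Proof. intros H. eapply Rle_trans; [|apply (H O)]. simpl. pose proof (Cmod_ge_0 (a O)). lra. Qed.

Lemma ex_series_geom_scal (M q : R) : 0 <= q < 1 -> ex_series (fun n => M * q ^ n).
Proof.
  intros Hq. apply (ex_series_Rscal M (fun n => q ^ n)).
  apply ex_series_geom. rewrite Rabs_pos_eq; lra.
Qed.

Lemma Series_geom_scal (M q : R) : 0 <= q < 1 -> Series (fun n => M * q ^ n) = M * / (1 - q).
Proof.
  intros Hq. rewrite Series_scal_l, Series_geom; [reflexivity|]. rewrite Rabs_pos_eq; lra.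
Qed.

Lemma rad_term (a : nat -> C) (rho M : R) (h : C) (n : nat) :
  0 < rho -> Cmod (a n) * rho ^ n <= M -> Cmod (a n * h ^ n) <= M * (Cmod h / rho) ^ n.
Proof.
  intros Hr H. rewrite Cmod_mult, Cmod_pow.
  replace (Cmod (a n) * Cmod h ^ n) with (Cmod (a n) * rho ^ n * (Cmod h / rho) ^ n).
  - apply Rmult_le_compat_r; [|exact H]. apply pow_le, Rdiv_le_0_compat; [apply Cmod_ge_0|exact Hr].
  - unfold Rdiv. rewrite Rpow_mult_distr, pow_inv. field. apply pow_nonzero; lra.
Qed.

Lemma quot_lt_1 (x rho : R) : 0 <= x -> x < rho -> 0 <= x / rho < 1.
Proof.
  intros H1 H2. split; [apply Rdiv_le_0_compat; lra|].
  apply (Rmult_lt_reg_r rho); [lra|]. unfold Rdiv. rewrite Rmult_assoc, Rinv_l; lra.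
Qed.

Lemma rad_asum (a : nat -> C) (rho : R) (h : C) :
  rad a rho -> Cmod h < rho -> asum (fun n => a n * h ^ n)%C.
Proof.
  intros [M HM] Hh. pose proof (Cmod_ge_0 h).
  apply asum_le with (fun n => M * (Cmod h / rho) ^ n).
  - intros n. apply rad_term; [lra|apply HM].
  - apply ex_series_geom_scal, quot_lt_1; assumption.
Qed.

Lemma bounded_of_cv0 (u : nat -> R) : is_lim_seq u 0 -> exists M, forall n, u n <= M.
Proof.
  intros H. apply is_lim_seq_spec in H. destruct (H (mkposreal 1 Rlt_0_1)) as [N HN].
  simpl in HN.
  assert (Hf : exists M, forall n, (n < N)%nat -> u n <= M).
  { clear. induction N as [|N [M IH]]; [exists 0; intros; lia|].
    exists (Rmax M (u N)). intros n Hn. destruct (Nat.eq_dec n N) as [->|].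
    - apply Rmax_r.
    - eapply Rle_trans; [apply IH; lia|apply Rmax_l]. }
  destruct Hf as [M HM]. exists (Rmax M 1). intros n.
  destruct (Compare_dec.le_lt_dec N n) as [h|h].
  - specialize (HN n h). rewrite Rminus_0_r in HN.
    eapply Rle_trans; [|apply Rmax_r]. pose proof (Rle_abs (u n)). lra.
  - eapply Rle_trans; [apply HM, h|apply Rmax_l].
Qed.

Lemma sums_rad (a : nat -> C) (rho : R) (l : C) :
  0 <= rho -> sums (fun n => a n * RtoC rho ^ n)%C l -> rad a rho.
Proof.
  intros Hr H.
  assert (Hl : is_lim_seq (fun n => Cmod (a n) * rho ^ n) 0).
  { apply is_lim_seq_spec. intros eps. destruct (H (eps / 2)) as [N HN].
    { pose proof (cond_pos eps); lra. }
    exists N. intros n Hn. rewrite Rminus_0_r, Rabs_pos_eq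
      by (apply Rmult_le_pos; [apply Cmod_ge_0|now apply pow_le]).
    assert (H1 := HN n ltac:(lia)). assert (H2 := HN (S n) ltac:(lia)). simpl in H2.
    replace (Cmod (a n) * rho ^ n) with (Cmod (a n * RtoC rho ^ n)).
    2:{ rewrite Cmod_mult, Cmod_pow, Cmod_R, Rabs_pos_eq by exact Hr. reflexivity. }
    set (p := psum _ _) in *.
    replace (a n * RtoC rho ^ n)%C with ((p + a n * RtoC rho ^ n - l) + - (p - l))%C by ring.
    eapply Rle_lt_trans; [apply Cmod_triangle|]. rewrite Cmod_opp. lra. }
  apply bounded_of_cv0, Hl.
Qed.

Lemma CV_radius_gt (b : nat -> R) (rho M x : R) :
  (forall n, Rabs (b n) * rho ^ n <= M) -> 0 <= rho -> Rabs x < rho -> Rbar_lt (Rabs x) (CV_radius b).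
Proof.
  intros HM Hr Hx. apply Rbar_lt_le_trans with rho; [exact Hx|].
  apply (CV_radius_bounded b). exists M. intros n.
  rewrite Rabs_mult, (Rabs_pos_eq (rho ^ n)); [apply HM|now apply pow_le].
Qed.

Lemma RtoC_pow_C (x : R) (n : nat) : (RtoC x ^ n)%C = RtoC (x ^ n).
Proof. symmetry. apply RtoC_pow. Qed.

Lemma derC_pseries (a : nat -> C) (rho x : R) :
  rad a rho -> Rabs x < rho ->
  derC (fun y => tsum (fun n => a n * RtoC y ^ n)%C) x
       (tsum (fun n => RtoC (INR (S n)) * a (S n) * RtoC x ^ n)%C).
Proof.
  intros [M HM] Hx.
  assert (Hr : 0 <= rho) by (pose proof (Rabs_pos x); lra).
  assert (H1 : Rbar_lt (Rabs x) (CV_radius (fun n => Re (a n)))).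
  { apply CV_radius_gt with rho M; [|exact Hr|exact Hx]. intros n. eapply Rle_trans; [|apply HM].
    apply Rmult_le_compat_r; [now apply pow_le|apply re_le_Cmod]. }
  assert (H2 : Rbar_lt (Rabs x) (CV_radius (fun n => Im (a n)))).
  { apply CV_radius_gt with rho M; [|exact Hr|exact Hx]. intros n. eapply Rle_trans; [|apply HM].
    apply Rmult_le_compat_r; [now apply pow_le|apply im_le_Cmod]. }
  apply is_derive_PSeries in H1. apply is_derive_PSeries in H2. split.
  - change (is_derive (fun y => Series (fun n => Re (a n * RtoC y ^ n)%C)) x
      (Series (fun n => Re (RtoC (INR (S n)) * a (S n) * RtoC x ^ n)%C))).
    match goal with |- is_derive _ _ ?w => replace w with (PSeries (PS_derive (fun n => Re (a n))) x) end.
    + eapply is_derive_ext; [|exact H1]. intros y. apply Series_ext. intros n.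
      rewrite RtoC_pow_C, re_scal_r. reflexivity.
    + apply Series_ext. intros n. unfold PS_derive. rewrite RtoC_pow_C, re_scal_r, re_scal_l. reflexivity.
  - change (is_derive (fun y => Series (fun n => Im (a n * RtoC y ^ n)%C)) x
      (Series (fun n => Im (RtoC (INR (S n)) * a (S n) * RtoC x ^ n)%C))).
    match goal with |- is_derive _ _ ?w => replace w with (PSeries (PS_derive (fun n => Im (a n))) x) end.
    + eapply is_derive_ext; [|exact H2]. intros y. apply Series_ext. intros n.
      rewrite RtoC_pow_C, im_scal_r. reflexivity.
    + apply Series_ext. intros n. unfold PS_derive. rewrite RtoC_pow_C, im_scal_r, im_scal_l. reflexivity.
Qed.

Lemma tsum_pow_0 (a : nat -> C) : tsum (fun n => a n * RtoC 0 ^ n)%C = a O.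
Proof.
  apply tsum_eq.
  - apply asum_cons. apply asum_le with (fun n => 0 * 0 ^ n).
    + intros n. rewrite Cpow_S, Cmult_0_l, Cmult_0_r, Cmod_0. lra.
    + apply ex_series_geom_scal; lra.
  - assert (H := sums_finite (fun n => a n * RtoC 0 ^ n)%C 1).
    simpl psum in H. replace (0 + a O * 1)%C with (a O) in H by ring.
    apply H. intros n Hn. destruct n; [lia|]. rewrite Cpow_S. ring.
Qed.

Lemma rad_exp (z : C) (rho : R) : 0 <= rho -> rad (fun n => z ^ n / RtoC (INR (fact n)))%C rho.
Proof.
  intros Hr.
  assert (H := is_exp_Reals (Cmod z * rho)).
  assert (H0 : is_lim_seq (fun n => (Cmod z * rho) ^ n * / INR (fact n)) 0).
  { apply ex_series_lim_0. exists (exp (Cmod z * rho)).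
    eapply is_series_ext; [|exact H]. intros n. simpl. rewrite pow_n_pow. reflexivity. }
  destruct (bounded_of_cv0 _ H0) as [M HM]. exists M. intros n.
  eapply Rle_trans; [|apply (HM n)]. right.
  assert (Hf := INR_fact_neq_0 n).
  rewrite Cmod_div, Cmod_pow, Cmod_R, (Rabs_pos_eq (INR _)) by (apply pos_INR || (intros E; apply RtoC_inj in E; auto)).
  rewrite Rpow_mult_distr. field. exact Hf.
Qed.

Lemma sums_Cexp (z : C) : sums (fun n => z ^ n / RtoC (INR (fact n)))%C (Cexp z).
Proof.
  set (a := fun n => (z ^ n / RtoC (INR (fact n)))%C).
  set (phi := fun y => tsum (fun n => a n * RtoC y ^ n)%C).
  assert (Hd : forall x, derC phi x (z * phi x)%C).
  { intros x. assert (Hr : rad a (Rabs x + 1)) by (apply rad_exp; pose proof (Rabs_pos x); lra).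
    assert (Hx : Rabs x < Rabs x + 1) by lra.
    replace (z * phi x)%C with (tsum (fun n => RtoC (INR (S n)) * a (S n) * RtoC x ^ n)%C).
    - apply derC_pseries with (Rabs x + 1); assumption.
    - assert (Has : asum (fun n => a n * RtoC x ^ n)%C)
        by (apply rad_asum with (Rabs x + 1); [exact Hr|rewrite Cmod_R; exact Hx]).
      assert (E : forall n, (z * (a n * RtoC x ^ n) = RtoC (INR (S n)) * a (S n) * RtoC x ^ n)%C).
      { intros n. unfold a. rewrite fact_simpl, mult_INR, RtoC_mult, Cpow_S. field.
        split; intros E; apply RtoC_inj in E; [revert E; apply INR_fact_neq_0|].
        revert E; apply not_0_INR; lia. }
      apply tsum_eq.
      + eapply asum_le; [|apply (asum_scal z _ Has)]. intros n. rewrite <- E. apply Rle_refl.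
      + eapply sums_ext; [exact E|]. apply sums_scal, asum_tsum, Has. }
  assert (Hg : forall x, derC (fun y => phi y * Cexp (- z * RtoC y))%C x (RtoC 0)).
  { intros x. replace (RtoC 0) with
      (z * phi x * Cexp (- z * RtoC x) + phi x * (- z * RtoC 1 * Cexp (- z * RtoC x)))%C by ring.
    apply derC_mult; [apply Hd|]. apply (derC_Cexp (- z) (fun y => y)).
    apply (is_derive_id (K := R_AbsRing)). }
  assert (H01 : (phi 0 * Cexp (- z * RtoC 0) = phi 1 * Cexp (- z * RtoC 1))%C).
  { apply (derC_zero_const (fun y => phi y * Cexp (- z * RtoC y))%C 0 1); [lra|]. intros; apply Hg. }
  rewrite Cmult_0_r, Cexp_0 in H01. unfold phi at 1 in H01. rewrite tsum_pow_0 in H01.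
  replace (a O * RtoC 1)%C with (RtoC 1) in H01 by (unfold a; simpl; field).
  rewrite Cmult_1_r, Cexp_opp in H01.
  assert (E : phi 1 = Cexp z).
  { replace (phi 1) with (phi 1 * / Cexp z * Cexp z)%C by (field; apply Cexp_neq_0).
    rewrite <- H01. ring. }
  rewrite <- E. unfold phi.
  apply sums_ext with (fun n => a n * RtoC 1 ^ n)%C; [intros n; rewrite Cpow_1_l; apply Cmult_1_r|].
  apply asum_tsum, rad_asum with 2; [apply rad_exp; lra|]. rewrite Cmod_1. lra.
Qed.

Lemma pseries_coef_0 (a : nat -> C) (rho : R) :
  0 < rho -> rad a rho ->
  (forall eps, 0 < eps -> exists v, v <> RtoC 0 /\ Cmod v < eps /\ sums (fun n => a n * v ^ n)%C (RtoC 0)) ->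
  forall n, a n = RtoC 0.
Proof.
  intros Hr [M HM] H n. induction n as [n IH] using Wf_nat.lt_wf_ind.
  assert (HM0 := rad_bound_pos _ _ _ HM).
  assert (Hrn : 0 < rho ^ S n) by (apply pow_lt, Hr).
  apply (Cmod_eps_eq _ _ (M / rho ^ S n * 2)). intros eps He.
  destruct (H (Rmin eps (rho / 2))) as [v [Hv0 [Hv Hs]]]; [apply Rmin_pos; lra|].
  assert (Hv1 : Cmod v < eps) by (eapply Rlt_le_trans; [exact Hv|apply Rmin_l]).
  assert (Hv2 : Cmod v < rho / 2) by (eapply Rlt_le_trans; [exact Hv|apply Rmin_r]).
  apply (sums_drop _ _ n) in Hs.
  assert (E0 : psum (fun k => a k * v ^ k)%C n = RtoC 0).
  { rewrite (psum_ext _ (fun _ => RtoC 0)), psum_const; [ring|].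
    intros k Hk. rewrite IH by exact Hk. ring. }
  rewrite E0 in Hs. apply (sums_scal (/ v ^ n)%C) in Hs.
  apply sums_tail in Hs.
  assert (Hvn := Cpow_nz v n Hv0).
  assert (Hb : Cmod (/ v ^ n * (RtoC 0 - RtoC 0) - / v ^ n * (a (n + 0)%nat * v ^ (n + 0))) <=
     Series (fun k => M / rho ^ S n * Cmod v * (Cmod v / rho) ^ k)).
  { pose proof (Cmod_ge_0 v).
    eapply sums_Cmod_le; [exact Hs| |apply ex_series_geom_scal, quot_lt_1; lra].
    intros k. cbv beta.
    replace (/ v ^ n * (a (n + S k)%nat * v ^ (n + S k)))%C with (v * (a (n + S k)%nat * v ^ k))%C
      by (rewrite Cpow_add_r, Cpow_S; field; exact Hvn).
    rewrite !Cmod_mult, Cmod_pow.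
    replace (M / rho ^ S n * Cmod v * (Cmod v / rho) ^ k)
      with (Cmod v * ((M / rho ^ (n + S k)) * Cmod v ^ k)).
    - apply Rmult_le_compat_l; [lra|]. apply Rmult_le_compat_r; [apply pow_le; lra|].
      apply Rle_div_r; [apply Rlt_gt, pow_lt, Hr|apply HM].
    - unfold Rdiv. rewrite Rpow_mult_distr, pow_inv. replace (n + S k)%nat with (S n + k)%nat by lia.
      rewrite pow_add. field. split; apply pow_nonzero; lra. }
  rewrite Nat.add_0_r in Hb.
  replace (/ v ^ n * (RtoC 0 - RtoC 0) - / v ^ n * (a n * v ^ n))%C with (- a n)%C in Hb by (field; exact Hvn).
  rewrite Cmod_opp in Hb. unfold Cminus. rewrite Copp_0, Cplus_0_r.
  eapply Rle_trans; [exact Hb|]. pose proof (Cmod_ge_0 v).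
  rewrite Series_geom_scal by (apply quot_lt_1; lra).
  assert (0 <= M / rho ^ S n) by (apply Rdiv_le_0_compat; lra).
  replace (M / rho ^ S n * 2 * eps) with (M / rho ^ S n * (eps * 2)) by ring.
  rewrite Rmult_assoc. apply Rmult_le_compat_l; [assumption|].
  apply Rmult_le_compat; try lra.
  - apply Rlt_le, Rinv_0_lt_compat. pose proof (quot_lt_1 (Cmod v) rho). lra.
  - apply (Rle_trans _ (/ (1 / 2))); [|lra]. apply Rinv_le_contravar; [lra|].
    assert (Cmod v / rho <= 1 / 2); [|lra]. apply Rle_div_l; lra.
Qed.

Definition cana (f : C -> C) (z0 : C) : Prop :=
  exists (a : nat -> C) (rho : R), 0 < rho /\ rad a rho /\
    forall h, Cmod h < rho -> sums (fun n => a n * h ^ n)%C (f (z0 + h)%C).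

Lemma pow_n_Cpow (z : C) (n : nat) : pow_n (K := C_Ring) z n = (z ^ n)%C.
Proof. induction n as [|n IH]; [reflexivity|]. simpl pow_n. rewrite IH. reflexivity. Qed.

Lemma analytic_cana (f : C -> C) (z0 : C) : analytic_at f z0 -> cana f z0.
Proof.
  intros [a [r [Hr H]]].
  assert (Hs : forall h, Cmod h < r -> sums (fun n => a n * h ^ n)%C (f (z0 + h)%C)).
  { intros h Hh. apply sums_is_series.
    assert (E : (z0 + h - z0)%C = h) by ring.
    specialize (H (z0 + h)%C). rewrite E in H. specialize (H Hh).
    eapply is_series_ext; [|exact H]. intros n. simpl.
    rewrite pow_n_Cpow. apply Cmult_comm. }
  exists a, (r / 2). split; [lra|]. split.
  - apply sums_rad with (f (z0 + RtoC (r / 2))%C); [lra|]. apply Hs.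
    rewrite Cmod_R, Rabs_pos_eq; lra.
  - intros h Hh. apply Hs. lra.
Qed.

Lemma rad_le (a : nat -> C) (r r' : R) : 0 <= r' <= r -> rad a r -> rad a r'.
Proof.
  intros Hr [M HM]. exists M. intros n. eapply Rle_trans; [|apply HM].
  apply Rmult_le_compat_l; [apply Cmod_ge_0|]. apply pow_incr, Hr.
Qed.

Lemma cana_minus (f g : C -> C) (z0 : C) :
  cana f z0 -> cana g z0 -> cana (fun z => f z - g z)%C z0.
Proof.
  intros [a [r [Hr [[Ma Ha] Hf]]]] [b [r' [Hr' [[Mb Hb] Hg]]]].
  assert (Hm : 0 < Rmin r r') by (apply Rmin_pos; assumption).
  destruct (rad_le a r (Rmin r r')) as [Ma' Ha']; [split; [lra|apply Rmin_l]|exists Ma; exact Ha|].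
  destruct (rad_le b r' (Rmin r r')) as [Mb' Hb']; [split; [lra|apply Rmin_r]|exists Mb; exact Hb|].
  exists (fun n => a n - b n)%C, (Rmin r r'). split; [exact Hm|]. split.
  - exists (Ma' + Mb'). intros n.
    eapply Rle_trans; [apply Rmult_le_compat_r; [apply pow_le; lra|apply Cmod_triangle]|].
    rewrite Cmod_opp, Rmult_plus_distr_r. apply Rplus_le_compat; auto.
  - intros h Hh. apply sums_ext with (fun n => a n * h ^ n - b n * h ^ n)%C; [intros; ring|].
    apply sums_minus; [apply Hf|apply Hg]; eapply Rlt_le_trans; try exact Hh; [apply Rmin_l|apply Rmin_r].
Qed.

Lemma cana_mult (f g : C -> C) (z0 : C) :
  cana f z0 -> cana g z0 -> cana (fun z => f z * g z)%C z0.
Proof.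
  intros [a [r [Hr [Ra Hf]]]] [b [r' [Hr' [Rb Hg]]]].
  set (rho := Rmin r r').
  assert (Hrho : 0 < rho) by (apply Rmin_pos; assumption).
  apply (rad_le a r rho) in Ra; [|split; [lra|apply Rmin_l]].
  apply (rad_le b r' rho) in Rb; [|split; [lra|apply Rmin_r]].
  set (q := rho / 2). assert (Hq : 0 < q < rho) by (unfold q; lra).
  set (u := fun n k => if (n <=? k)%nat then (a n * b (k - n)%nat)%C else RtoC 0).
  set (A := fun n => Cmod (a n) * q ^ n).
  assert (HA0 : forall n, 0 <= A n).
  { intros n. apply Rmult_le_pos; [apply Cmod_ge_0|apply pow_le; lra]. }
  assert (HA : ex_series A).
  { destruct Ra as [M HM].
    apply (ex_series_le (K := R_AbsRing) (V := R_CompleteNormedModule) A (fun n => M * (q / rho) ^ n)).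
    - intros n. change (Rabs (A n) <= M * (q / rho) ^ n).
      rewrite Rabs_pos_eq by apply HA0. unfold A.
      replace (Cmod (a n) * q ^ n) with (Cmod (a n * RtoC q ^ n)).
      + assert (Hx := rad_term a rho M (RtoC q) n Hrho (HM n)).
        rewrite Cmod_R, Rabs_pos_eq in Hx by lra. exact Hx.
      + rewrite Cmod_mult, Cmod_pow, Cmod_R, Rabs_pos_eq by lra. reflexivity.
    - apply ex_series_geom_scal, quot_lt_1; lra. }
  destruct (rad_le b rho q) as [Mb HMb]; [lra|exact Rb|].
  assert (HMb0 : 0 <= Mb).
  { eapply Rle_trans; [|apply (HMb O)]. apply Rmult_le_pos; [apply Cmod_ge_0|simpl; lra]. }
  assert (Hu : forall n k, Cmod (u n k) * q ^ k <= A n * Mb).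
  { intros n k. unfold u. destruct (Nat.leb_spec n k) as [h|h].
    - rewrite Cmod_mult. replace (q ^ k) with (q ^ n * q ^ (k - n)) by (rewrite <- pow_add; f_equal; lia).
      replace (Cmod (a n) * Cmod (b (k - n)%nat) * (q ^ n * q ^ (k - n)))
        with (A n * (Cmod (b (k - n)%nat) * q ^ (k - n))) by (unfold A; ring).
      apply Rmult_le_compat_l; [apply HA0|apply HMb].
    - rewrite Cmod_0, Rmult_0_l. apply Rmult_le_pos; auto. }
  assert (Huc : forall k, asum (fun n => u n k)).
  { intros k. apply asum_le with (fun n => Mb / q ^ k * A n).
    - intros n. assert (H := Hu n k). assert (0 < q ^ k) by (apply pow_lt; lra).
      replace (Mb / q ^ k * A n) with (A n * Mb / q ^ k) by (field; lra).
      apply Rle_div_r; [lra|exact H].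
    - apply (ex_series_Rscal _ _ HA). }
  exists (fun k => tsum (fun n => u n k)), q. split; [lra|]. split.
  - exists (Mb * Series A). intros k.
    assert (Hqk : 0 < q ^ k) by (apply pow_lt; lra).
    apply (Rle_div_r _ _ (q ^ k) Hqk).
    replace (Mb * Series A / q ^ k) with (Series (fun n => Mb / q ^ k * A n))
      by (rewrite Series_scal_l; field; lra).
    eapply sums_Cmod_le; [apply asum_tsum, Huc| |
      apply (ex_series_Rscal _ _ HA)].
    intros n. assert (H := Hu n k). cbv beta.
    replace (Mb / q ^ k * A n) with (A n * Mb / q ^ k) by (field; lra).
    apply Rle_div_r; [lra|exact H].
  - intros h Hh.
    assert (Hh0 := Cmod_ge_0 h).
    destruct (sums_swap (fun n k => u n k * h ^ k)%C A (fun k => Mb * (Cmod h / q) ^ k))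
      as [S1 [S2 S3]].
    + intros n k.
      replace (A n * (Mb * (Cmod h / q) ^ k)) with (A n * Mb * (Cmod h / q) ^ k) by ring.
      apply (rad_term (u n)); [lra|apply Hu].
    + exact HA0.
    + intros k. apply Rmult_le_pos; [exact HMb0|]. apply pow_le, Rdiv_le_0_compat; lra.
    + exact HA.
    + apply ex_series_geom_scal, quot_lt_1; lra.
    + assert (E1 : forall n, tsum (fun k => u n k * h ^ k)%C = (a n * h ^ n * g (z0 + h))%C).
      { intros n. apply tsum_eq.
        - apply asum_le with (fun k => A n * Mb * (Cmod h / q) ^ k).
          + intros k. apply (rad_term (u n)); [lra|apply Hu].
          + apply ex_series_geom_scal, quot_lt_1; lra.
        - assert (Hgs : sums (fun k => a n * h ^ n * (b k * h ^ k))%C (a n * h ^ n * g (z0 + h))%C).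
          { apply sums_scal, Hg. eapply Rlt_le_trans; [exact Hh|]. unfold q, rho in *.
            pose proof (Rmin_r r r'); lra. }
          replace (a n * h ^ n * g (z0 + h))%C with
            (psum (fun k => u n k * h ^ k)%C n + a n * h ^ n * g (z0 + h))%C.
          + intros eps He. destruct (Hgs eps He) as [N HN]. exists (n + N)%nat. intros m Hm.
            replace m with (n + (m - n))%nat by lia. rewrite psum_app.
            rewrite (psum_ext (fun k => u n (n + k)%nat * h ^ (n + k))%C
              (fun k => a n * h ^ n * (b k * h ^ k))%C).
            * replace (_ - _)%C with (psum (fun k => a n * h ^ n * (b k * h ^ k))%C (m - n) - a n * h ^ n * g (z0 + h))%C by ring.
              apply HN. lia.
            * intros k _. unfold u. destruct (Nat.leb_spec n (n + k)) as [h'|h']; [|lia].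
              replace (n + k - n)%nat with k by lia. rewrite Cpow_add_r. ring.
          + rewrite (psum_ext _ (fun _ => RtoC 0)), psum_const; [ring|].
            intros k Hk. unfold u. destruct (Nat.leb_spec n k) as [h'|h']; [lia|ring]. }
      assert (E2 : forall k, tsum (fun n => u n k * h ^ k)%C = (tsum (fun n => u n k) * h ^ k)%C).
      { intros k.
        assert (Ha := asum_scal (h ^ k) _ (Huc k)).
        apply tsum_eq.
        - eapply asum_le; [|exact Ha]. intros n. cbv beta. rewrite (Cmult_comm (h ^ k)). apply Rle_refl.
        - rewrite Cmult_comm. eapply sums_ext; [|apply sums_scal, asum_tsum, Huc].
          intros n. cbv beta. ring. }
      assert (Hfs : sums (fun n => a n * h ^ n * g (z0 + h))%C (f (z0 + h) * g (z0 + h))%C).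
      { rewrite Cmult_comm. eapply sums_ext; [|apply sums_scal, Hf].
        - intros n. cbv beta. ring.
        - eapply Rlt_le_trans; [exact Hh|]. unfold q, rho in *. pose proof (Rmin_l r r'); lra. }
      replace (f (z0 + h) * g (z0 + h))%C with (tsum (fun k => tsum (fun n => u n k * h ^ k)%C)).
      * apply sums_ext with (fun k => tsum (fun n => u n k * h ^ k)%C); [intros k; apply E2|].
        apply asum_tsum, S2.
      * rewrite <- S3. apply tsum_eq; [exact S1|].
        eapply sums_ext; [|exact Hfs]. intros n. cbv beta. rewrite E1. reflexivity.
Qed.

Lemma cana_cont (f : C -> C) (z0 : C) : cana f z0 ->
  forall eps, 0 < eps -> exists d, 0 < d /\ forall z, Cmod (z - z0) < d -> Cmod (f z - f z0) < eps.
Proof.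
  intros [a [r [Hr [[M HM] Hf]]]] eps He.
  assert (HM0 := rad_bound_pos _ _ _ HM).
  assert (E0 : f z0 = a O).
  { assert (H0 : Cmod (RtoC 0) < r) by (rewrite Cmod_0; exact Hr).
    apply Hf in H0. rewrite Cplus_0_r in H0.
    rewrite <- (tsum_pow_0 a). apply (sums_unique _ _ _ H0). apply asum_tsum.
    apply rad_asum with r; [exists M; exact HM|rewrite Cmod_0; exact Hr]. }
  exists (Rmin (r / 2) (eps * r / (2 * (M + 1)))). split.
  { apply Rmin_pos; [lra|]. apply Rdiv_lt_0_compat; [apply Rmult_lt_0_compat; lra|lra]. }
  intros z Hz. set (h := (z - z0)%C) in *.
  assert (Hh1 : Cmod h < r / 2) by (eapply Rlt_le_trans; [exact Hz|apply Rmin_l]).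
  assert (Hh2 : Cmod h < eps * r / (2 * (M + 1))) by (eapply Rlt_le_trans; [exact Hz|apply Rmin_r]).
  assert (Hh0 := Cmod_ge_0 h).
  assert (Hs := Hf h ltac:(lra)). replace (z0 + h)%C with z in Hs by (unfold h; ring).
  apply sums_tail in Hs.
  replace (f z - a O * h ^ 0)%C with (f z - f z0)%C in Hs by (rewrite E0; simpl; ring).
  apply Rle_lt_trans with (Series (fun n => M * (Cmod h / r) * (Cmod h / r) ^ n)).
  - eapply sums_Cmod_le; [exact Hs| |apply ex_series_geom_scal, quot_lt_1; lra].
    intros n. cbv beta. eapply Rle_trans; [apply rad_term; [exact Hr|apply HM]|]. right. simpl. ring.
  - rewrite Series_geom_scal by (apply quot_lt_1; lra).
    assert (Hq : Cmod h / r <= 1 / 2) by (apply Rle_div_l; lra).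
    assert (Hq0 : 0 <= Cmod h / r) by (apply Rdiv_le_0_compat; lra).
    apply Rle_lt_trans with (M * (Cmod h / r) * 2).
    + apply Rmult_le_compat_l; [apply Rmult_le_pos; lra|].
      apply (Rle_trans _ (/ (1 / 2))); [|lra]. apply Rinv_le_contravar; lra.
    + apply Rle_lt_trans with ((M + 1) * (Cmod h / r) * 2).
      { apply Rmult_le_compat_r; [lra|]. apply Rmult_le_compat_r; lra. }
      apply (Rmult_lt_reg_r (r / (2 * (M + 1)))); [apply Rdiv_lt_0_compat; lra|].
      replace ((M + 1) * (Cmod h / r) * 2 * (r / (2 * (M + 1)))) with (Cmod h) by (field; lra).
      replace (eps * (r / (2 * (M + 1)))) with (eps * r / (2 * (M + 1))) by (field; lra). exact Hh2.
Qed.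

Lemma identity_segment (d : C -> C) (p q : C) (delta : R) :
  (forall tau, 0 <= tau <= 1 -> cana d (p + RtoC tau * (q - p))%C) ->
  0 < delta ->
  (forall tau, 0 <= tau < delta -> d (p + RtoC tau * (q - p))%C = RtoC 0) ->
  d q = RtoC 0.
Proof.
  intros Hana Hd H0.
  destruct (Ceq_dec q p) as [->|Hqp].
  { specialize (H0 0 ltac:(lra)). rewrite <- H0. f_equal. ring. }
  assert (Hqp' : (q - p)%C <> RtoC 0) by (apply Cminus_eq_contra, Hqp).
  assert (Hmod : 0 < Cmod (q - p)) by (apply Cmod_gt_0, Hqp').
  set (g := fun tau : R => (p + RtoC tau * (q - p))%C) in *.
  set (S := fun tau => 0 <= tau <= 1 /\ forall t', 0 <= t' <= tau -> d (g t') = RtoC 0).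
  set (d0 := Rmin 1 (delta / 2)).
  assert (Hd0 : 0 < d0) by (apply Rmin_pos; lra).
  assert (Sd0 : S d0).
  { split; [split; [lra|apply Rmin_l]|]. intros t' Ht'. apply H0.
    pose proof (Rmin_r 1 (delta / 2)). unfold d0 in *. lra. }
  destruct (completeness S) as [m [Hub Hlub]].
  { exists 1. intros x [Hx _]. lra. }
  { exists d0. exact Sd0. }
  assert (Hm0 : d0 <= m) by (apply Hub, Sd0).
  assert (Hm1 : m <= 1) by (apply Hlub; intros x [Hx _]; lra).
  assert (Hbelow : forall t', 0 <= t' < m -> d (g t') = RtoC 0).
  { intros t' Ht'.
    assert (Hex : ~ (forall x, S x -> x <= t')).
    { intros Hn. specialize (Hlub t' Hn). lra. }
    destruct (classic (d (g t') = RtoC 0)) as [h|h]; [exact h|].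
    exfalso. apply Hex. intros x [Hx1 Hx2]. destruct (Rle_or_lt x t') as [h'|h']; [exact h'|].
    exfalso. apply h, Hx2. lra. }
  destruct (Hana m ltac:(lra)) as [a [rho [Hrho [Ra Ha]]]].
  fold (g m) in Ha.
  assert (Hgm : forall t', (g m + RtoC (t' - m) * (q - p))%C = g t').
  { intros t'. unfold g. rewrite RtoC_minus. ring. }
  assert (Ha0 : forall n, a n = RtoC 0).
  { apply pseries_coef_0 with rho; [exact Hrho|exact Ra|].
    intros eps He.
    set (e := Rmin (m / 2) (Rmin (eps / (2 * Cmod (q - p))) (rho / (2 * Cmod (q - p))))).
    assert (He0 : 0 < e).
    { unfold e. repeat apply Rmin_pos; [lra| |]; apply Rdiv_lt_0_compat; lra. }
    assert (He1 : e <= m / 2) by apply Rmin_l.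
    assert (He2 : e <= eps / (2 * Cmod (q - p))).
    { eapply Rle_trans; [apply Rmin_r|apply Rmin_l]. }
    assert (He3 : e <= rho / (2 * Cmod (q - p))).
    { eapply Rle_trans; [apply Rmin_r|apply Rmin_r]. }
    assert (Hcm : Cmod (RtoC (- e) * (q - p)) = e * Cmod (q - p)).
    { rewrite Cmod_mult, Cmod_R, Rabs_Ropp, Rabs_pos_eq; lra. }
    exists (RtoC (- e) * (q - p))%C. split; [|split].
    - apply Cmult_neq_0; [|exact Hqp']. intros E. apply RtoC_inj in E. lra.
    - rewrite Hcm. apply Rle_lt_trans with (eps / (2 * Cmod (q - p)) * Cmod (q - p)).
      + apply Rmult_le_compat_r; lra.
      + replace (eps / (2 * Cmod (q - p)) * Cmod (q - p)) with (eps / 2) by (field; lra). lra.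
    - rewrite <- (Hbelow (m - e)) by lra.
      replace (g (m - e)) with (g m + RtoC (- e) * (q - p))%C
        by (rewrite <- (Hgm (m - e)); do 3 f_equal; ring).
      apply Ha. rewrite Hcm. apply Rle_lt_trans with (rho / (2 * Cmod (q - p)) * Cmod (q - p)).
      + apply Rmult_le_compat_r; lra.
      + replace (rho / (2 * Cmod (q - p)) * Cmod (q - p)) with (rho / 2) by (field; lra). lra. }
  assert (Hnear : forall t', Rabs (t' - m) * Cmod (q - p) < rho -> d (g t') = RtoC 0).
  { intros t' Ht'. rewrite <- Hgm.
    assert (Hs := Ha (RtoC (t' - m) * (q - p))%C).
    rewrite Cmod_mult, Cmod_R in Hs. specialize (Hs Ht').
    apply (sums_unique _ _ _ Hs).
    eapply sums_ext; [|apply (sums_finite (fun _ => RtoC 0) 0); reflexivity].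
    intros n. cbv beta. rewrite Ha0. ring. }
  assert (Hm : m = 1).
  { destruct (Rle_lt_or_eq_dec m 1 Hm1) as [h|h]; [|exact h]. exfalso.
    set (e := Rmin (1 - m) (rho / (2 * Cmod (q - p)))).
    assert (He0 : 0 < e) by (apply Rmin_pos; [lra|apply Rdiv_lt_0_compat; lra]).
    assert (HS : S (m + e)).
    { split; [pose proof (Rmin_l (1 - m) (rho / (2 * Cmod (q - p)))); unfold e in *; lra|].
      intros t' Ht'. destruct (Rlt_or_le t' m) as [h'|h']; [apply Hbelow; lra|].
      apply Hnear. rewrite Rabs_pos_eq by lra.
      apply Rle_lt_trans with (rho / (2 * Cmod (q - p)) * Cmod (q - p)).
      - apply Rmult_le_compat_r; [lra|]. pose proof (Rmin_r (1 - m) (rho / (2 * Cmod (q - p)))).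
        unfold e in *; lra.
      - replace (rho / (2 * Cmod (q - p)) * Cmod (q - p)) with (rho / 2) by (field; lra). lra. }
    apply Hub in HS. lra. }
  replace q with (g 1) by (unfold g; ring).
  apply Hnear. rewrite Hm, Rminus_diag, Rabs_R0. lra.
Qed.


(** * The periodic zeta function *)

Lemma MVT_C (f f' : R -> C) (a b M : R) :
  a <= b -> (forall x, a <= x <= b -> derC f x (f' x)) ->
  (forall x, a <= x <= b -> Cmod (f' x) <= M) -> Cmod (f b - f a) <= 2 * M * (b - a).
Proof.
  intros Hab Hd HM.
  assert (Hp : forall P : C -> R, (forall z, Rabs (P z) <= Cmod z) ->
    (forall x, a <= x <= b -> is_derive (fun y => P (f y)) x (P (f' x))) ->
    Rabs (P (f b) - P (f a)) <= M * (b - a)).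
  { intros P HP HdP.
    destruct (MVT_gen (fun y => P (f y)) a b (fun x => P (f' x))) as [c [Hc Hc']].
    - rewrite Rmin_left, Rmax_right by exact Hab. intros x Hx. apply HdP. lra.
    - rewrite Rmin_left, Rmax_right by exact Hab. intros x Hx.
      apply continuity_pt_filterlim.
      apply (ex_derive_continuous (K := R_AbsRing) (V := R_NormedModule)). eexists. apply HdP, Hx.
    - rewrite Rmin_left, Rmax_right in Hc by exact Hab.
      rewrite Hc', Rabs_mult, (Rabs_pos_eq (b - a)) by lra.
      apply Rmult_le_compat_r; [lra|]. eapply Rle_trans; [apply HP|apply HM, Hc]. }
  assert (H1 := Hp Re re_le_Cmod (fun x Hx => proj1 (Hd x Hx))).
  assert (H2 := Hp Im im_le_Cmod (fun x Hx => proj2 (Hd x Hx))).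
  eapply Rle_trans; [apply Cmod_Rabs2|].
  unfold Cminus. rewrite re_plus, im_plus, re_opp, im_opp. unfold Rminus in *. lra.
Qed.

Lemma derC_quadratic (f : R -> C) (x : R) (l : C) (K : R) :
  (forall h, Cmod (f (x + h) - f x - RtoC h * l) <= K * h ^ 2) -> derC f x l.
Proof.
  intros H.
  assert (HK : 0 <= K).
  { specialize (H 1). pose proof (Cmod_ge_0 (f (x + 1) - f x - RtoC 1 * l)). lra. }
  assert (Hp : forall P : C -> R, (forall z, Rabs (P z) <= Cmod z) ->
    (forall a b c h, P (a - b - RtoC h * c)%C = P a - P b - h * P c) ->
    is_derive (fun y => P (f y)) x (P l)).
  { intros P HP HL. apply is_derive_Reals. intros eps He.
    assert (Hd : 0 < eps / (K + 1)) by (apply Rdiv_lt_0_compat; lra).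
    exists (mkposreal _ Hd). intros h Hh Hlt. simpl in Hlt.
    specialize (H h). specialize (HP (f (x + h)%R - f x - RtoC h * l)%C). rewrite HL in HP.
    replace ((P (f (x + h)) - P (f x)) / h - P l)
      with ((P (f (x + h)) - P (f x) - h * P l) / h) by (field; exact Hh).
    unfold Rdiv. rewrite Rabs_mult, Rabs_inv.
    assert (Hah : 0 < Rabs h) by (apply Rabs_pos_lt, Hh).
    apply Rle_lt_trans with (K * Rabs h).
    - apply (Rle_div_l _ _ (Rabs h)); [exact Hah|].
      replace (K * Rabs h * Rabs h) with (K * h ^ 2); [lra|].
      rewrite <- (pow2_abs h). ring.
    - apply Rle_lt_trans with (K * (eps / (K + 1))).
      + apply Rmult_le_compat_l; lra.
      + replace eps with ((K + 1) * (eps / (K + 1))) at 2 by (field; lra).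
        apply Rmult_lt_compat_r; lra. }
  split; apply Hp; try apply re_le_Cmod; try apply im_le_Cmod; intros; unfold Cminus.
  - rewrite !re_plus, !re_opp, re_scal_l. ring.
  - rewrite !im_plus, !im_opp, im_scal_l. ring.
Qed.

Lemma Rpower_le_base_neg (x y a : R) : 0 < x -> x <= y -> a <= 0 -> Rpower y a <= Rpower x a.
Proof.
  intros Hx Hxy Ha. unfold Rpower.
  assert (ln x <= ln y) by (apply ln_le; assumption).
  apply exp_monotone. nra.
Qed.

Lemma Rpower_le_exponent (x a b : R) : 1 <= x -> a <= b -> Rpower x a <= Rpower x b.
Proof.
  intros Hx Hab. unfold Rpower.
  assert (0 <= ln x) by (rewrite <- ln_1; apply ln_le; lra).
  apply exp_monotone. nra.
Qed.

(** The coefficient of [h^j] in the expansion of [x^(-(t + h))]. *)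
Definition beta (t : C) (j : nat) (x : R) : C :=
  (cpow x (- t) * RtoC ((- ln x) ^ j / INR (fact j)))%C.

Lemma beta_0 (t : C) (x : R) : beta t 0 x = cpow x (- t).
Proof. unfold beta. simpl. replace (1 / 1) with 1 by field. ring. Qed.

Lemma pow_fact_le_exp (x : R) (j : nat) : 0 <= x -> x ^ j / INR (fact j) <= exp x.
Proof.
  intros Hx. eapply Rle_trans; [|apply (exp_ge_taylor x j Hx)].
  destruct j as [|j]; [right; reflexivity|].
  rewrite tech5. assert (0 <= sum_f_R0 (fun k => x ^ k / INR (fact k)) j); [|lra].
  apply cond_pos_sum. intros k. apply Rdiv_le_0_compat; [now apply pow_le|apply INR_fact_lt_0].
Qed.

Lemma Cmod_beta_le (t : C) (j : nat) (x : R) : 1 <= x -> Cmod (beta t j x) <= Rpower x (1 - Re t).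
Proof.
  intros Hx. unfold beta. rewrite Cmod_mult, Cmod_cpow, Cmod_R, re_opp.
  assert (Hl : 0 <= ln x) by (rewrite <- ln_1; apply ln_le; lra).
  unfold Rminus. rewrite Rpower_plus, Rpower_1 by lra. rewrite Rmult_comm.
  apply Rmult_le_compat_r; [apply Rlt_le, exp_pos|].
  unfold Rdiv. rewrite Rabs_mult, <- RPow_abs, Rabs_Ropp, (Rabs_pos_eq _ Hl), Rabs_pos_eq
    by (apply Rlt_le, Rinv_0_lt_compat, INR_fact_lt_0).
  eapply Rle_trans; [apply (pow_fact_le_exp _ j Hl)|]. rewrite exp_ln; lra.
Qed.

Lemma derC_beta (t : C) (j : nat) (x : R) : 0 < x ->
  derC (beta t j) x (- (t * beta (t + 1) j x
    + match j with O => RtoC 0 | S i => beta (t + 1) i x end))%C.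
Proof.
  intros Hx. unfold beta.
  assert (Hj : is_derive (fun y => (- ln y) ^ j / INR (fact j)) x
    (- / x * match j with O => 0 | S i => (- ln x) ^ i / INR (fact i) end)).
  { destruct j as [|i].
    - apply is_derive_ext with (fun _ => 1 / INR (fact 0)); [reflexivity|].
      rewrite Rmult_0_r. apply (is_derive_const (K := R_AbsRing) (V := R_NormedModule)).
    - pose proof (INR_fact_neq_0 i) as Hi. assert (HS : INR (S i) <> 0) by (apply not_0_INR; lia).
      assert (HF : INR (fact (S i)) = INR (S i) * INR (fact i)) by (rewrite fact_simpl; apply mult_INR).
      rewrite HF. clear HF. revert HS. generalize (INR (fact i)) Hi. intros F HF0 HS.
      evar_last.
      { apply is_derive_ext with (fun y => / (INR (S i) * F) * (- ln y) ^ S i); [intros; apply Rmult_comm|].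
        apply is_derive_scal.
        apply (is_derive_pow (fun y => - ln y)). apply (is_derive_opp (K := R_AbsRing) (V := R_NormedModule)).
        apply is_derive_ln, Hx. }
      change (/ (INR (S i) * F) * (INR (S i) * (- / x) * (- ln x) ^ i) = - / x * ((- ln x) ^ i / F)).
      field. repeat split; lra || assumption. }
  assert (H := derC_mult _ _ _ _ _ (derC_cpow (- t) x Hx) (derC_RtoC _ _ _ Hj)).
  match type of H with derC _ _ ?v =>
    match goal with |- derC _ _ ?w => replace w with v; [exact H|] end end.
  unfold Cminus. rewrite <- Copp_plus_distr.
  replace (cpow x (- t)) with (cpow x (- (t + 1)) * RtoC x)%C.
  2:{ rewrite <- (cpow_1 x Hx). rewrite <- cpow_plus. f_equal. ring. }
  rewrite RtoC_mult, RtoC_opp, RtoC_inv by lra.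
  assert (RtoC x <> RtoC 0) by (intros E; apply RtoC_inj in E; lra).
  destruct j as [|i]; field; assumption.
Qed.

Fixpoint delta (N : nat) (f : R -> C) (x : R) : C :=
  match N with O => f x | S n => (delta n f (x + 1) - delta n f x)%C end.

Lemma delta_lin (N : nat) (c : C) (f g : R -> C) (x : R) :
  delta N (fun y => - (c * f y + g y))%C x = (- (c * delta N f x + delta N g x))%C.
Proof.
  revert x. induction N as [|N IH]; intros x; simpl; [reflexivity|rewrite !IH; ring].
Qed.

Lemma delta_0 (N : nat) (x : R) : delta N (fun _ => RtoC 0) x = RtoC 0.
Proof. revert x. induction N as [|N IH]; intros x; simpl; [reflexivity|rewrite !IH; ring]. Qed.

Lemma derC_delta (N : nat) (f f' : R -> C) :
  (forall x, 0 < x -> derC f x (f' x)) -> forall x, 0 < x -> derC (delta N f) x (delta N f' x).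
Proof.
  intros H. induction N as [|N IH]; intros x Hx; [apply H, Hx|].
  change (derC (fun y => delta N f (y + 1)%R - delta N f y)%C x (delta N f' (x + 1)%R - delta N f' x)%C).
  apply (derC_minus (fun y => delta N f (y + 1)) (delta N f)); [|apply IH, Hx].
  replace (delta N f' (x + 1)) with (RtoC 1 * delta N f' (x + 1)%R)%C by ring.
  apply (derC_comp (delta N f) (fun y => y + 1)); [apply IH; lra|].
  auto_derive; trivial.
Qed.

Fixpoint delta_const (N : nat) (tau : R) : R :=
  match N with O => 1 | S n => 2 * (tau + 1) * delta_const n (tau + 1) end.

Lemma delta_const_pos (N : nat) (tau : R) : 0 <= tau -> 0 < delta_const N tau.
Proof.
  revert tau. induction N as [|N IH]; intros tau H; simpl; [lra|].
  apply Rmult_lt_0_compat; [lra|]. apply IH; lra.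
Qed.

Lemma Cmod_delta_beta (N : nat) : forall (tau : R) (t : C) (j : nat) (x : R),
  Cmod t <= tau -> 1 <= x -> 1 <= Re t + INR N ->
  Cmod (delta N (beta t j) x) <= delta_const N tau * Rpower x (1 - (Re t + INR N)).
Proof.
  induction N as [|N IH]; intros tau t j x Ht Hx Hv.
  - simpl delta. simpl delta_const. rewrite Rmult_1_l, Rplus_0_r. apply Cmod_beta_le, Hx.
  - assert (Ht0 := Cmod_ge_0 t). rewrite S_INR in *.
    assert (Ht1 : Cmod (t + 1) <= tau + 1).
    { eapply Rle_trans; [apply Cmod_triangle|]. rewrite Cmod_1. lra. }
    assert (Hre : Re (t + 1) = Re t + 1) by (rewrite re_plus, re_RtoC; ring).
    set (B := delta_const N (tau + 1) * Rpower x (1 - (Re t + (INR N + 1)))).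
    assert (HB : forall i y, x <= y -> Cmod (delta N (beta (t + 1) i) y) <= B).
    { intros i y Hy. eapply Rle_trans; [apply (IH (tau + 1)); [exact Ht1|lra|lra]|].
      unfold B. apply Rmult_le_compat_l; [apply Rlt_le, delta_const_pos; lra|].
      rewrite Hre. replace (Re t + 1 + INR N) with (Re t + (INR N + 1)) by ring.
      apply Rpower_le_base_neg; lra. }
    assert (HB0 : 0 <= B) by (eapply Rle_trans; [apply Cmod_ge_0|apply (HB O x); lra]).
    replace (delta_const (S N) tau * Rpower x (1 - (Re t + (INR N + 1))))
      with (2 * ((tau + 1) * B) * (x + 1 - x)) by (unfold B; simpl; ring).
    simpl delta.
    eapply (MVT_C (delta N (beta t j))); [lra| |].
    + intros y Hy. apply derC_delta; [|lra]. intros z Hz. apply (derC_beta t j z Hz).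
    + intros y Hy. cbv beta. rewrite delta_lin, Cmod_opp.
      eapply Rle_trans; [apply Cmod_triangle|]. rewrite Cmod_mult, Rmult_plus_distr_r, Rmult_1_l.
      apply Rplus_le_compat.
      * apply Rmult_le_compat; [apply Cmod_ge_0|apply Cmod_ge_0|exact Ht|apply HB; lra].
      * destruct j as [|i]; [rewrite delta_0, Cmod_0; exact HB0|apply HB; lra].
Qed.

Definition sh (a : nat -> C) (n : nat) : C := match n with O => RtoC 0 | S m => a m end.
Definition nab (a : nat -> C) (n : nat) : C := (a n - sh a n)%C.
Fixpoint niter (N : nat) (a : nat -> C) : nat -> C :=
  match N with O => a | S n => nab (niter n a) end.

Definition dir (t : C) (j n : nat) : C :=
  match n with O => RtoC 0 | S _ => beta t j (INR n) end.

Lemma niter_delta (t : C) (j N n : nat) : (1 <= n)%nat ->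
  niter N (dir t j) (N + n) = delta N (beta t j) (INR n).
Proof.
  revert n. induction N as [|N IH]; intros n Hn.
  - simpl. destruct n; [lia|reflexivity].
  - simpl. unfold nab. simpl. rewrite IH by exact Hn.
    replace (S (N + n)) with (N + S n)%nat by lia. rewrite IH by lia. rewrite S_INR. reflexivity.
Qed.

Lemma niter_le (a : nat -> C) (B : R) (N n : nat) :
  0 <= B -> (forall m, (m <= n)%nat -> Cmod (a m) <= B) -> Cmod (niter N a n) <= 2 ^ N * B.
Proof.
  intros HB0. revert n. induction N as [|N IH]; intros n HB; simpl.
  - rewrite Rmult_1_l. apply HB; lia.
  - unfold nab. eapply Rle_trans; [apply Cmod_triangle|]. rewrite Cmod_opp.
    assert (H1 := IH n HB).
    assert (H2 : Cmod (sh (niter N a) n) <= 2 ^ N * B).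
    { destruct n as [|n]; simpl.
      - rewrite Cmod_0. apply Rmult_le_pos; [apply pow_le; lra|exact HB0].
      - apply IH. intros m Hm. apply HB; lia. }
    lra.
Qed.

Lemma niter_bound (t : C) (N : nat) : 5 <= Re t + INR N ->
  exists K, 0 <= K /\ forall j n, Cmod (niter N (dir t j) n) <= K * / (INR n + 1) ^ 4.
Proof.
  intros Hv.
  set (B := rsum (fun m => Rpower (INR m) (1 - Re t)) (S N)).
  assert (Hpos : forall m, 0 <= Rpower (INR m) (1 - Re t)) by (intros; apply Rlt_le, exp_pos).
  assert (HB : forall m, (m <= N)%nat -> Rpower (INR m) (1 - Re t) <= B).
  { unfold B. generalize N. intros M m Hm. induction M as [|M IH].
    - assert (m = 0)%nat by lia. subst. simpl. lra.
    - simpl. destruct (Nat.eq_dec m (S M)) as [->|h].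
      + assert (Hr : forall k, 0 <= rsum (fun m => Rpower (INR m) (1 - Re t)) k).
        { intros k. induction k as [|k IHk]; simpl; [lra|]. specialize (Hpos k). lra. }
        specialize (Hr (S M)). simpl in Hr |- *. lra.
      + specialize (IH ltac:(lia)). simpl in IH. specialize (Hpos (S M)). simpl in Hpos. lra. }
  assert (HB0 : 0 <= B) by (eapply Rle_trans; [apply (Hpos O)|apply HB; lia]).
  set (K0 := delta_const N (Cmod t)).
  assert (HK0 : 0 < K0) by (apply delta_const_pos, Cmod_ge_0).
  assert (HN := pos_INR N).
  assert (HN4 : 0 <= (INR N + 2) ^ 4) by (apply pow_le; lra).
  assert (H2N : 0 <= 2 ^ N) by (apply pow_le; lra).
  exists ((K0 + 2 ^ N * B) * (INR N + 2) ^ 4). split.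
  { apply Rmult_le_pos; [|exact HN4]. assert (0 <= 2 ^ N * B) by (apply Rmult_le_pos; assumption). lra. }
  intros j n. assert (Hn := pos_INR n).
  assert (Hn4 : 0 < (INR n + 1) ^ 4) by (apply pow_lt; lra).
  assert (H2B : 0 <= 2 ^ N * B) by (apply Rmult_le_pos; assumption).
  apply Rle_div_r; [exact Hn4|].
  destruct (Compare_dec.le_lt_dec n N) as [h|h].
  - assert (H1 : Cmod (niter N (dir t j) n) <= 2 ^ N * B).
    { apply niter_le; [exact HB0|]. intros m Hm. destruct m as [|m]; [simpl; rewrite Cmod_0; exact HB0|].
      eapply Rle_trans; [apply Cmod_beta_le|apply HB; lia]. rewrite S_INR. pose proof (pos_INR m); lra. }
    apply Rle_trans with (2 ^ N * B * (INR N + 2) ^ 4).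
    + apply Rmult_le_compat; [apply Cmod_ge_0|lra|exact H1|].
      apply pow_incr. apply le_INR in h. lra.
    + apply Rmult_le_compat_r; lra.
  - set (m := (n - N)%nat). assert (Hm : (1 <= m)%nat) by (unfold m; lia).
    assert (En : n = (N + m)%nat) by (unfold m; lia).
    assert (Hm1 : 1 <= INR m) by (apply (le_INR 1 m) in Hm; simpl in Hm; lra).
    rewrite En at 1. rewrite niter_delta by exact Hm.
    assert (H1 : Cmod (delta N (beta t j) (INR m)) <= K0 * / INR m ^ 4).
    { eapply Rle_trans; [apply (Cmod_delta_beta N (Cmod t)); lra|].
      apply Rmult_le_compat_l; [lra|].
      eapply Rle_trans; [apply (Rpower_le_exponent _ _ (- (INR 4))); [exact Hm1|simpl; lra]|].
      rewrite Rpower_Ropp, Rpower_pow by lra. right; reflexivity. }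
    apply Rle_trans with (K0 * / INR m ^ 4 * (INR n + 1) ^ 4).
    { apply Rmult_le_compat_r; lra. }
    apply Rle_trans with (K0 * (INR N + 2) ^ 4); [|apply Rmult_le_compat_r; lra].
    rewrite Rmult_assoc. apply Rmult_le_compat_l; [lra|].
    assert (Hm4 : 0 < INR m ^ 4) by (apply pow_lt; lra).
    rewrite Rmult_comm. apply Rle_div_l; [exact Hm4|]. rewrite <- Rpow_mult_distr.
    apply pow_incr. split; [lra|]. rewrite En, plus_INR. nra.
Qed.

Lemma ex_series_inv_sq : ex_series (fun n => / (INR n + 1) ^ 2).
Proof.
  assert (Hs : is_lim_seq (sum_n (fun n => / (INR n + 1) * / (INR n + 2))) 1).
  { apply is_lim_seq_ext with (fun n => 1 - / (INR n + 2)).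
    - intros n. rewrite sum_n_rsum. induction n as [|n IH].
      + simpl. field.
      + change (rsum ?f (S (S n))) with (rsum f (S n) + f (S n)). rewrite <- IH, S_INR.
        pose proof (pos_INR n). field. lra.
    - replace 1 with (1 - 0) at 1 by ring.
      apply is_lim_seq_minus'; [apply is_lim_seq_const|].
      apply (is_lim_seq_inv (fun n => INR n + 2) p_infty); [|discriminate].
      eapply is_lim_seq_plus; [apply is_lim_seq_INR|apply is_lim_seq_const|]. reflexivity. }
  apply (ex_series_le (K := R_AbsRing) (V := R_CompleteNormedModule) _
    (fun n => 2 * (/ (INR n + 1) * / (INR n + 2)))).
  - intros n. pose proof (pos_INR n).
    change (Rabs (/ (INR n + 1) ^ 2) <= 2 * (/ (INR n + 1) * / (INR n + 2))).
    rewrite Rabs_pos_eq by (apply Rlt_le, Rinv_0_lt_compat, pow_lt; lra).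
    replace (2 * (/ (INR n + 1) * / (INR n + 2))) with (/ ((INR n + 1) * ((INR n + 2) / 2))) by (field; lra).
    apply Rinv_le_contravar; [apply Rmult_lt_0_compat; lra|]. simpl. rewrite Rmult_1_r.
    apply Rmult_le_compat_l; lra.
  - apply (ex_series_Rscal 2).
    exists 1. exact Hs.
Qed.

Lemma ex_series_inv_pow4 (K : R) : ex_series (fun n => K * / (INR n + 1) ^ 4).
Proof.
  apply (ex_series_Rscal K).
  apply (ex_series_le (K := R_AbsRing) (V := R_CompleteNormedModule) _ (fun n => / (INR n + 1) ^ 2));
    [|apply ex_series_inv_sq].
  intros n. pose proof (pos_INR n). change (Rabs (/ (INR n + 1) ^ 4) <= / (INR n + 1) ^ 2).
  rewrite Rabs_pos_eq by (apply Rlt_le, Rinv_0_lt_compat, pow_lt; lra).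
  apply Rinv_le_contravar; [apply pow_lt; lra|]. apply Rle_pow; [lra|lia].
Qed.

Definition eiy (y : R) : C := Cexp (Ci * RtoC y).

Lemma Cmod_eiy (y : R) : Cmod (eiy y) = 1.
Proof. unfold eiy. rewrite Cmod_Cexp. simpl. rewrite <- exp_0. f_equal. ring. Qed.

Lemma eiy_pow (y : R) (n : nat) : (eiy y ^ n)%C = eiy (INR n * y).
Proof.
  induction n as [|n IH].
  - simpl. unfold eiy. rewrite Rmult_0_l, Cmult_0_r, Cexp_0. reflexivity.
  - rewrite Cpow_S, IH, S_INR. unfold eiy. rewrite <- Cexp_plus. f_equal.
    rewrite Rmult_plus_distr_r, RtoC_plus, Rmult_1_l. ring.
Qed.

Lemma eiy_cos_sin (y : R) : eiy y = (cos y, sin y).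
Proof.
  unfold eiy, Cexp. simpl. replace (0 * y - 1 * 0) with 0 by ring.
  replace (0 * 0 + 1 * y) with y by ring. rewrite exp_0, !Rmult_1_l. reflexivity.
Qed.

Lemma eiy_neq_1 (y : R) : 0 < y < 2 * PI -> (1 - eiy y)%C <> RtoC 0.
Proof.
  intros Hy E. apply Ceq_minus in E. rewrite eiy_cos_sin in E.
  apply (f_equal Re) in E. simpl in E.
  assert (H := cos_2a_sin (y / 2)). replace (2 * (y / 2)) with y in H by field.
  assert (Hs : 0 < sin (y / 2)) by (apply sin_gt_0; lra).
  nra.
Qed.

Definition ts (c : nat -> C) (z : C) : C := tsum (fun n => c n * z ^ n)%C.

Lemma asum_unit (c : nat -> C) (z : C) : Cmod z = 1 -> asum c -> asum (fun n => c n * z ^ n)%C.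
Proof.
  intros Hz H. apply asum_le with (fun n => Cmod (c n)); [|exact H].
  intros n. rewrite Cmod_mult, Cmod_pow, Hz, pow1. lra.
Qed.

Lemma ts_sums (c : nat -> C) (z : C) : Cmod z = 1 -> asum c -> sums (fun n => c n * z ^ n)%C (ts c z).
Proof. intros Hz H. apply asum_tsum, asum_unit; assumption. Qed.

Lemma ts_eq (c : nat -> C) (z l : C) :
  Cmod z = 1 -> asum c -> sums (fun n => c n * z ^ n)%C l -> ts c z = l.
Proof. intros Hz H Hs. apply tsum_eq; [apply asum_unit; assumption|exact Hs]. Qed.

Lemma asum_sh (c : nat -> C) : asum c -> asum (sh c).
Proof. intros H. apply asum_cons. exact H. Qed.

Lemma ts_sh (c : nat -> C) (z : C) : Cmod z = 1 -> asum c -> ts (sh c) z = (z * ts c z)%C.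
Proof.
  intros Hz H. apply ts_eq; [exact Hz|now apply asum_sh|].
  replace (z * ts c z)%C with (sh c O * z ^ 0 + z * ts c z)%C by (simpl; ring).
  apply (sums_cons (fun n => sh c n * z ^ n)%C).
  apply sums_ext with (fun n => z * (c n * z ^ n))%C.
  - intros n. simpl sh. rewrite Cpow_S. ring.
  - apply sums_scal, ts_sums; assumption.
Qed.

Lemma asum_nab (c : nat -> C) : asum c -> asum (nab c).
Proof.
  intros H. eapply asum_le; [|apply (asum_plus _ _ H (asum_scal (- (1)) _ (asum_sh c H)))].
  intros n. unfold nab. right. f_equal. ring.
Qed.

Lemma ts_nab (c : nat -> C) (z : C) : Cmod z = 1 -> asum c -> ts (nab c) z = ((1 - z) * ts c z)%C.
Proof.
  intros Hz H. apply ts_eq; [exact Hz|now apply asum_nab|].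
  replace ((1 - z) * ts c z)%C with (ts c z - ts (sh c) z)%C by (rewrite ts_sh by assumption; ring).
  apply sums_ext with (fun n => c n * z ^ n - sh c n * z ^ n)%C.
  - intros n. unfold nab. ring.
  - apply sums_minus; apply ts_sums; try assumption. now apply asum_sh.
Qed.

Definition nmul (a : nat -> C) (n : nat) : C := (RtoC (INR n) * a n)%C.

Lemma niter_nmul (a : nat -> C) (N n : nat) :
  niter (S N) (nmul a) n =
  (RtoC (INR n) * niter (S N) a n + RtoC (INR (S N)) * sh (niter N a) n)%C.
Proof.
  revert n. induction N as [|N IH]; intros n.
  - simpl. unfold nab, nmul. destruct n as [|n]; simpl sh; [simpl; ring|].
    rewrite S_INR, RtoC_plus. ring.
  - change (niter (S (S N)) (nmul a) n)
      with (niter (S N) (nmul a) n - sh (niter (S N) (nmul a)) n)%C.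
    change (niter (S (S N)) a n) with (niter (S N) a n - sh (niter (S N) a) n)%C.
    destruct n as [|n].
    + simpl sh. rewrite IH. simpl. ring.
    + change (sh (niter (S N) (nmul a)) (S n)) with (niter (S N) (nmul a) n).
      change (sh (niter (S N) a) (S n)) with (niter (S N) a n).
      rewrite !IH. change (sh (niter N a) (S n)) with (niter N a n).
      change (niter (S N) a n) with (niter N a n - sh (niter N a) n)%C.
      rewrite (S_INR (S N)), (S_INR n), !RtoC_plus. ring.
Qed.

Lemma niter_ext (a b : nat -> C) (N : nat) : (forall n, a n = b n) -> forall n, niter N a n = niter N b n.
Proof.
  intros H. induction N as [|N IH]; intros n; simpl; [apply H|].
  unfold nab. rewrite IH. destruct n; simpl; [reflexivity|now rewrite IH].
Qed.

Lemma nmul_dir (t : C) (n : nat) : nmul (dir t 0) n = dir (t - 1) 0 n.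
Proof.
  unfold nmul. destruct n as [|n]; [simpl; ring|].
  unfold dir. rewrite !beta_0.
  assert (Hp : 0 < INR (S n)) by (apply lt_0_INR; lia).
  rewrite <- (cpow_1 _ Hp) at 1. rewrite <- cpow_plus. f_equal. ring.
Qed.

Lemma derC_eiy_pow (n : nat) (y : R) :
  derC (fun x => eiy x ^ n)%C y (Ci * (RtoC (INR n) * eiy y ^ n))%C.
Proof.
  apply derC_ext with (fun x => Cexp (Ci * RtoC (INR n * x))).
  { intros x. rewrite eiy_pow. reflexivity. }
  rewrite eiy_pow. replace (Ci * (RtoC (INR n) * eiy (INR n * y)))%C
    with (Ci * RtoC (INR n) * Cexp (Ci * RtoC (INR n * y)))%C by (unfold eiy; ring).
  apply (derC_Cexp Ci (fun x => INR n * x)). auto_derive; [trivial|ring].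
Qed.

Lemma derC_eiy (y : R) : derC eiy y (Ci * eiy y)%C.
Proof.
  apply derC_ext with (fun x => eiy x ^ 1)%C; [intros x; apply Cpow_1_r|].
  replace (Ci * eiy y)%C with (Ci * (RtoC (INR 1) * eiy y ^ 1))%C by (simpl; ring).
  apply derC_eiy_pow.
Qed.

Lemma eiy_quadratic (x h : R) : Cmod (eiy (x + h) - eiy x - RtoC h * (Ci * eiy x)) <= 4 * h ^ 2.
Proof.
  set (f := fun u => (eiy (x + u) - RtoC u * (Ci * eiy x))%C).
  set (f' := fun u => (Ci * (eiy (x + u) - eiy x))%C).
  assert (Hd : forall u, derC (fun v => eiy (x + v)) u (Ci * eiy (x + u))%C).
  { intros u. replace (Ci * eiy (x + u))%C with (RtoC 1 * (Ci * eiy (x + u)))%C by ring.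
    apply (derC_comp eiy (fun v => x + v)); [apply derC_eiy|]. auto_derive; trivial. }
  assert (Hf : forall u, derC f u (f' u)).
  { intros u. unfold f, f'.
    replace (Ci * (eiy (x + u) - eiy x))%C with (Ci * eiy (x + u) - Ci * eiy x)%C by ring.
    apply derC_minus; [apply Hd|].
    apply derC_ext with (fun v => Ci * eiy x * RtoC v)%C; [intros; ring|].
    assert (Hs := derC_scal (Ci * eiy x) _ u _
      (derC_RtoC (fun v => v) u 1 (is_derive_id (K := R_AbsRing) u))).
    rewrite Cmult_1_r in Hs. exact Hs. }
  assert (Hlip : forall u, Cmod (eiy (x + u) - eiy x) <= 2 * Rabs u).
  { intros u. destruct (Rle_or_lt 0 u) as [h0|h0].
    - rewrite Rabs_pos_eq by exact h0.
      assert (H := MVT_C (fun v => eiy (x + v)) (fun v => Ci * eiy (x + v))%C 0 u 1 h0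
        (fun v _ => Hd v)). cbv beta in H. rewrite Rplus_0_r in H. rewrite Rminus_0_r, Rmult_1_r in H.
      apply H. intros v _. rewrite Cmod_mult, Cmod_Ci, Cmod_eiy. lra.
    - rewrite Rabs_left, Cmod_minus_sym by exact h0.
      assert (H := MVT_C (fun v => eiy (x + v)) (fun v => Ci * eiy (x + v))%C u 0 1 (Rlt_le _ _ h0)
        (fun v _ => Hd v)). cbv beta in H. rewrite Rplus_0_r in H. replace (2 * 1 * (0 - u)) with (2 * - u) in H by ring.
      apply H. intros v _. rewrite Cmod_mult, Cmod_Ci, Cmod_eiy. lra. }
  replace (eiy (x + h) - eiy x - RtoC h * (Ci * eiy x))%C with (f h - f 0)%C
    by (unfold f; rewrite Rplus_0_r; ring).
  rewrite <- (pow2_abs h).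
  assert (HM : forall v, Rabs v <= Rabs h -> Cmod (f' v) <= 2 * Rabs h).
  { intros v Hv. unfold f'. rewrite Cmod_mult, Cmod_Ci, Rmult_1_l.
    eapply Rle_trans; [apply Hlip|lra]. }
  destruct (Rle_or_lt 0 h) as [h0|h0].
  - eapply Rle_trans; [apply (MVT_C f f' 0 h (2 * Rabs h) h0 (fun v _ => Hf v))|].
    + intros v Hv. apply HM. rewrite !Rabs_pos_eq; lra.
    + rewrite Rabs_pos_eq by exact h0. right; ring.
  - rewrite Cmod_minus_sym.
    eapply Rle_trans; [apply (MVT_C f f' h 0 (2 * Rabs h) (Rlt_le _ _ h0) (fun v _ => Hf v))|].
    + intros v Hv. apply HM. destruct (Req_dec v 0) as [->|hv].
      * rewrite Rabs_R0. apply Rabs_pos.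
      * rewrite !Rabs_left; lra.
    + rewrite Rabs_left by exact h0. right; ring.
Qed.

Lemma asum_bound4 (c : nat -> C) (K : R) :
  (forall n, Cmod (c n) <= K * / (INR n + 1) ^ 4) -> asum c /\ asum (nmul c).
Proof.
  intros H. split.
  - eapply asum_le; [apply H|apply ex_series_inv_pow4].
  - apply asum_le with (fun n => K * / (INR n + 1) ^ 2);
      [|apply (ex_series_Rscal K), ex_series_inv_sq].
    intros n. unfold nmul. pose proof (pos_INR n).
    rewrite Cmod_mult, Cmod_R, Rabs_pos_eq by lra.
    apply Rle_trans with ((INR n + 1) ^ 2 * Cmod (c n)).
    + apply Rmult_le_compat_r; [apply Cmod_ge_0|nra].
    + replace (K * / (INR n + 1) ^ 2) with ((INR n + 1) ^ 2 * (K * / (INR n + 1) ^ 4)) by (field; lra).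
      apply Rmult_le_compat_l; [nra|apply H].
Qed.

Lemma derC_ts (c : nat -> C) (K y : R) :
  (forall n, Cmod (c n) <= K * / (INR n + 1) ^ 4) ->
  derC (fun x => ts c (eiy x)) y (Ci * ts (nmul c) (eiy y))%C.
Proof.
  intros H. destruct (asum_bound4 c K H) as [Hc Hnc].
  assert (HK : ex_series (fun n => 4 * K * / (INR n + 1) ^ 2))
    by (apply (ex_series_Rscal (4 * K)), ex_series_inv_sq).
  apply derC_quadratic with (Series (fun n => 4 * K * / (INR n + 1) ^ 2)).
  intros h.
  rewrite (Rmult_comm _ (h ^ 2)), <- Series_scal_l.
  assert (HK' : ex_series (fun n => h ^ 2 * (4 * K * / (INR n + 1) ^ 2)))
    by (apply (ex_series_Rscal (h ^ 2)), HK).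
  eapply sums_Cmod_le; [|intros n|exact HK'].
  - apply sums_minus; [apply sums_minus|].
    + apply ts_sums; [apply Cmod_eiy|exact Hc].
    + apply ts_sums; [apply Cmod_eiy|exact Hc].
    + apply sums_scal, sums_scal, ts_sums; [apply Cmod_eiy|exact Hnc].
  - cbv beta. unfold nmul. rewrite !eiy_pow.
    replace (c n * eiy (INR n * (y + h)) - c n * eiy (INR n * y)
             - RtoC h * (Ci * (RtoC (INR n) * c n * eiy (INR n * y))))%C
      with (c n * (eiy (INR n * y + INR n * h) - eiy (INR n * y)
             - RtoC (INR n * h) * (Ci * eiy (INR n * y))))%C.
    2:{ rewrite RtoC_mult, Rmult_plus_distr_l. ring. }
    rewrite Cmod_mult.
    pose proof (pos_INR n).
    assert (HK0 : 0 <= K * / (INR n + 1) ^ 4) by (eapply Rle_trans; [apply Cmod_ge_0|apply H]).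
    apply Rle_trans with (K * / (INR n + 1) ^ 4 * (4 * (INR n * h) ^ 2)).
    + apply Rmult_le_compat; [apply Cmod_ge_0|apply Cmod_ge_0|apply H|apply eiy_quadratic].
    + apply Rle_trans with (K * / (INR n + 1) ^ 4 * (4 * ((INR n + 1) * h) ^ 2)).
      * apply Rmult_le_compat_l; [exact HK0|]. rewrite !Rpow_mult_distr.
        pose proof (pow2_ge_0 h). nra.
      * right. field. lra.
Qed.

Definition EN (N : nat) (t : C) (y : R) : C :=
  (ts (niter N (dir t 0)) (eiy y) / (1 - eiy y) ^ N)%C.

(** The periodic zeta function [sum_n e^(i n y) / n^t], continued to all [t]
    by repeated summation by parts. *)
Definition Nof (t : C) : nat := Z.to_nat (up (5 - Re t)).
Definition E (t : C) (y : R) : C := EN (Nof t) t y.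

Lemma Nof_spec (t : C) : 5 <= Re t + INR (Nof t).
Proof.
  unfold Nof. destruct (archimed (5 - Re t)) as [H _].
  destruct (Z.le_gt_cases 0 (up (5 - Re t))) as [h|h].
  - rewrite INR_IZR_INZ, Z2Nat.id by exact h. lra.
  - replace (Z.to_nat (up (5 - Re t))) with O by lia. simpl.
    assert (IZR (up (5 - Re t)) <= 0) by (apply IZR_le; lia). lra.
Qed.

Lemma asum_niter (t : C) (N : nat) : 5 <= Re t + INR N -> asum (niter N (dir t 0)).
Proof.
  intros H. destruct (niter_bound t N H) as [K [_ HK]].
  apply (asum_bound4 _ K (HK O)).
Qed.

Lemma EN_S (N : nat) (t : C) (y : R) : 0 < y < 2 * PI -> asum (niter N (dir t 0)) ->
  EN (S N) t y = EN N t y.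
Proof.
  intros Hy H. unfold EN. simpl niter.
  rewrite ts_nab by (apply Cmod_eiy || exact H). rewrite Cpow_S.
  assert (Hz := eiy_neq_1 y Hy). field. split; [now apply Cpow_nz|exact Hz].
Qed.

Lemma EN_add (N k : nat) (t : C) (y : R) : 0 < y < 2 * PI -> asum (niter N (dir t 0)) ->
  EN (k + N) t y = EN N t y /\ asum (niter (k + N) (dir t 0)).
Proof.
  intros Hy H. induction k as [|k [IH1 IH2]]; [split; [reflexivity|exact H]|].
  change (S k + N)%nat with (S (k + N)). split; [rewrite EN_S by assumption; exact IH1|]. apply asum_nab, IH2.
Qed.

Lemma E_EN (N : nat) (t : C) (y : R) : 0 < y < 2 * PI -> asum (niter N (dir t 0)) ->
  E t y = EN N t y.
Proof.
  intros Hy H. unfold E.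
  rewrite <- (proj1 (EN_add (Nof t) N t y Hy (asum_niter t _ (Nof_spec t)))).
  rewrite <- (proj1 (EN_add N (Nof t) t y Hy H)). f_equal. lia.
Qed.

Lemma locally_open_Ioo (a b x : R) (P : R -> Prop) :
  a < x < b -> (forall y, a < y < b -> P y) -> locally x P.
Proof.
  intros Hx H.
  assert (He : 0 < Rmin (x - a) (b - x)) by (apply Rmin_pos; lra).
  exists (mkposreal _ He). intros y Hy.
  change (Rabs (y - x) < Rmin (x - a) (b - x)) in Hy.
  pose proof (Rmin_l (x - a) (b - x)). pose proof (Rmin_r (x - a) (b - x)).
  apply Rabs_def2 in Hy. apply H. lra.
Qed.

Lemma derC_E (t : C) (y : R) : 0 < y < 2 * PI -> derC (E t) y (Ci * E (t - 1) y)%C.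
Proof.
  intros Hy. set (N := Nof (t - 1)).
  assert (Hv : 5 <= Re (t - 1) + INR N) by apply Nof_spec.
  assert (Hre : Re (t - 1) = Re t - 1) by (unfold Cminus; rewrite re_plus, re_opp, re_RtoC; ring).
  assert (Hv1 : 5 <= Re t + INR N) by lra.
  assert (Hv2 : 5 <= Re t + INR (S N)) by (rewrite S_INR; lra).
  destruct (niter_bound t (S N) Hv2) as [K [_ HK]]. specialize (HK O).
  set (c := niter (S N) (dir t 0)) in *.
  destruct (asum_bound4 c K HK) as [Hc Hnc].
  assert (Hz := eiy_neq_1 y Hy).
  assert (HzS : ((1 - eiy y) ^ S N)%C <> RtoC 0) by now apply Cpow_nz.
  assert (HzN : ((1 - eiy y) ^ N)%C <> RtoC 0) by now apply Cpow_nz.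
  assert (Hd : derC (fun x => ts c (eiy x) * / (1 - eiy x) ^ S N)%C y
    (Ci * ts (nmul c) (eiy y) * / (1 - eiy y) ^ S N
     + ts c (eiy y) * (- (RtoC (INR (S N)) * (1 - eiy y) ^ pred (S N) * (RtoC 0 - Ci * eiy y))
          / ((1 - eiy y) ^ S N * (1 - eiy y) ^ S N)))%C).
  { apply derC_mult; [apply derC_ts with K; exact HK|].
    apply derC_inv; [exact HzS|]. apply (derC_pow (fun x => 1 - eiy x)%C).
    apply derC_minus; [apply derC_const|apply derC_eiy]. }
  replace (Ci * E (t - 1) y)%C with
    (Ci * ts (nmul c) (eiy y) * / (1 - eiy y) ^ S N
     + ts c (eiy y) * (- (RtoC (INR (S N)) * (1 - eiy y) ^ pred (S N) * (RtoC 0 - Ci * eiy y))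
          / ((1 - eiy y) ^ S N * (1 - eiy y) ^ S N)))%C.
  - eapply derC_ext_loc; [|exact Hd].
    apply locally_open_Ioo with 0 (2 * PI); [exact Hy|]. intros x Hx.
    rewrite (E_EN (S N) t x Hx Hc). reflexivity.
  - rewrite (E_EN (S N) (t - 1) y Hy).
    2:{ apply asum_niter. rewrite S_INR. lra. }
    unfold EN.
    assert (E1 : ts (niter (S N) (dir (t - 1) 0)) (eiy y) =
       (ts (nmul c) (eiy y) + RtoC (INR (S N)) * (eiy y * ts (niter N (dir t 0)) (eiy y)))%C).
    { rewrite <- ts_sh by (apply Cmod_eiy || apply asum_niter, Hv1).
      apply ts_eq; [apply Cmod_eiy|apply asum_niter; rewrite S_INR; lra|].
      apply sums_ext with (fun n => nmul c n * eiy y ^ n + RtoC (INR (S N)) * (sh (niter N (dir t 0)) n * eiy y ^ n))%C.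
      - intros n. rewrite <- (niter_ext _ _ (S N) (nmul_dir t) n), niter_nmul. unfold nmul, c. ring.
      - apply sums_plus; [|apply sums_scal]; apply ts_sums; try apply Cmod_eiy; [exact Hnc|].
        apply asum_sh, asum_niter, Hv1. }
    rewrite E1. unfold c at 2. simpl niter. rewrite ts_nab by (apply Cmod_eiy || apply asum_niter, Hv1).
    simpl pred. rewrite !Cpow_S. field. split; assumption.
Qed.

(** Expanding [n^(-t)] around [t0] inside the iterated differences gives a power
    series in [t - t0] because the difference bound is uniform in the order [j]. *)
Lemma niter_dir_sums (t0 h : C) (N n : nat) :
  sums (fun j => niter N (dir t0 j) n * h ^ j)%C (niter N (dir (t0 + h) 0) n).
Proof.
  revert n. induction N as [|N IH]; intros n.
  - simpl. destruct n as [|n].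
    + simpl. eapply sums_ext; [|apply (sums_finite (fun _ => RtoC 0) 0); reflexivity].
      intros j. simpl. ring.
    + unfold dir. rewrite beta_0. set (x := INR (S n)).
      assert (Es : (cpow x (- (t0 + h)) = cpow x (- t0) * Cexp (h * RtoC (- ln x)))%C).
      { unfold cpow. rewrite <- Cexp_plus. f_equal. rewrite RtoC_opp. ring. }
      rewrite Es. eapply sums_ext; [|apply sums_scal, sums_Cexp].
      intros j. cbv beta. unfold beta. rewrite Cpow_mult_l, RtoC_pow_C, RtoC_div by apply INR_fact_neq_0.
      unfold Cdiv. ring.
  - simpl. unfold nab.
    apply sums_ext with (fun j => niter N (dir t0 j) n * h ^ j - sh (niter N (dir t0 j)) n * h ^ j)%C;
      [intros; ring|].
    apply sums_minus; [apply IH|]. destruct n as [|n]; simpl sh; [|apply IH].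
    eapply sums_ext; [|apply (sums_finite (fun _ => RtoC 0) 0); reflexivity].
    intros j. simpl. ring.
Qed.

Lemma cana_E (y : R) (t0 : C) : 0 < y < 2 * PI -> cana (fun t => E t y) t0.
Proof.
  intros Hy. set (N := S (Nof t0)).
  assert (Hv : 6 <= Re t0 + INR N) by (unfold N; rewrite S_INR; pose proof (Nof_spec t0); lra).
  destruct (niter_bound t0 N) as [K [HK0 HK]]; [lra|].
  assert (Hz := Cmod_eiy y).
  set (q := (/ (1 - eiy y) ^ N)%C).
  exists (fun j => q * ts (niter N (dir t0 j)) (eiy y))%C, 1.
  split; [lra|].
  assert (HeK := ex_series_inv_pow4 K).
  assert (Has : forall j, asum (niter N (dir t0 j))) by (intros j; apply (asum_bound4 _ K (HK j))).
  split.
  - exists (Cmod q * Series (fun n => K * / (INR n + 1) ^ 4)). intros j.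
    rewrite pow1, Rmult_1_r, Cmod_mult. apply Rmult_le_compat_l; [apply Cmod_ge_0|].
    eapply sums_Cmod_le; [apply ts_sums; [exact Hz|apply Has]| |exact HeK].
    intros n. cbv beta. rewrite Cmod_mult, Cmod_pow, Hz, pow1, Rmult_1_r. apply HK.
  - intros h Hh.
    assert (Hre : Re t0 - 1 <= Re (t0 + h)).
    { rewrite re_plus. pose proof (re_le_Cmod h). pose proof (Rle_abs (- Re h)). rewrite Rabs_Ropp in *. lra. }
    rewrite (E_EN N (t0 + h) y Hy) by (apply asum_niter; lra).
    unfold EN.
    destruct (sums_swap (fun n j => niter N (dir t0 j) n * h ^ j * eiy y ^ n)%C
      (fun n => K * / (INR n + 1) ^ 4) (fun j => Cmod h ^ j)) as [S1 [S2 S3]].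
    + intros n j. rewrite !Cmod_mult, !Cmod_pow, Hz, pow1, Rmult_1_r.
      apply Rmult_le_compat_r; [apply pow_le, Cmod_ge_0|apply HK].
    + intros n. apply Rmult_le_pos; [exact HK0|]. apply Rlt_le, Rinv_0_lt_compat, pow_lt.
      pose proof (pos_INR n); lra.
    + intros j. apply pow_le, Cmod_ge_0.
    + exact HeK.
    + apply ex_series_geom. rewrite Rabs_pos_eq; [exact Hh|apply Cmod_ge_0].
    + assert (E1 : forall n, tsum (fun j => niter N (dir t0 j) n * h ^ j * eiy y ^ n)%C
                    = (niter N (dir (t0 + h) 0) n * eiy y ^ n)%C).
      { intros n. apply tsum_eq.
        - apply asum_le with (fun j => K * / (INR n + 1) ^ 4 * Cmod h ^ j).
          + intros j. rewrite !Cmod_mult, !Cmod_pow, Hz, pow1, Rmult_1_r.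
            apply Rmult_le_compat_r; [apply pow_le, Cmod_ge_0|apply HK].
          + apply ex_series_geom_scal. split; [apply Cmod_ge_0|exact Hh].
        - rewrite Cmult_comm. eapply sums_ext; [|apply sums_scal, niter_dir_sums].
          intros j. cbv beta. ring. }
      assert (E2 : forall j, tsum (fun n => niter N (dir t0 j) n * h ^ j * eiy y ^ n)%C
                    = (h ^ j * ts (niter N (dir t0 j)) (eiy y))%C).
      { intros j.
        assert (Ha := asum_scal (h ^ j) _ (asum_unit _ (eiy y) Hz (Has j))).
        apply tsum_eq.
        - eapply asum_le; [|exact Ha]. intros n. right. f_equal. ring.
        - eapply sums_ext; [|apply sums_scal, ts_sums; [exact Hz|apply Has]].
          intros n. cbv beta. ring. }
      assert (E3 : ts (niter N (dir (t0 + h) 0)) (eiy y) =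
        tsum (fun j => tsum (fun n => niter N (dir t0 j) n * h ^ j * eiy y ^ n)%C)).
      { rewrite <- S3. unfold ts, tsum at 1 2. f_equal; apply Series_ext; intros n; rewrite E1; reflexivity. }
      unfold Cdiv. fold q. rewrite E3, Cmult_comm.
      eapply sums_ext; [|apply sums_scal, asum_tsum, S2].
      intros j. cbv beta. rewrite E2. ring.
Qed.


Lemma RtoC_m1 : RtoC (- 1) = (- (1))%C.
Proof. lca. Qed.

Lemma Rpower_step (x a : R) : 0 < x -> 0 < a ->
  a * Rpower (x + 1) (- 1 - a) <= Rpower x (- a) - Rpower (x + 1) (- a) <= a * Rpower x (- 1 - a).
Proof.
  intros Hx Ha.
  assert (Hd : forall y, 0 < y -> is_derive (fun z => Rpower z (- a)) y (- a * Rpower y (- 1 - a))).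
  { intros y Hy. unfold Rpower. auto_derive; [exact Hy|].
    replace ((- 1 - a) * ln y) with (- a * ln y + - ln y) by ring.
    rewrite exp_plus, exp_Ropp, exp_ln by exact Hy. field. lra. }
  destruct (MVT_gen (fun z => Rpower z (- a)) x (x + 1) (fun y => - a * Rpower y (- 1 - a))) as [c [Hc E]].
  - rewrite Rmin_left, Rmax_right by lra. intros y Hy. apply Hd. lra.
  - rewrite Rmin_left, Rmax_right by lra. intros y Hy. apply continuity_pt_filterlim.
    apply (ex_derive_continuous (K := R_AbsRing) (V := R_NormedModule) (fun z => Rpower z (- a)) y). exists (- a * Rpower y (- 1 - a)). apply (Hd y). lra.
  - rewrite Rmin_left, Rmax_right in Hc by lra.
    assert (H1 : Rpower (x + 1) (- 1 - a) <= Rpower c (- 1 - a)) by (apply Rpower_le_base_neg; lra).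
    assert (H2 : Rpower c (- 1 - a) <= Rpower x (- 1 - a)) by (apply Rpower_le_base_neg; lra).
    nra.
Qed.

Lemma rsum_Rpower (a : R) (n : nat) : 0 < a ->
  1 - Rpower (INR n + 1) (- a) <= a * rsum (fun k => Rpower (INR (S k)) (- 1 - a)) n <= 1 + a.
Proof.
  intros Ha. split.
  - induction n as [|n IH].
    + simpl. rewrite Rplus_0_l. unfold Rpower. rewrite ln_1, !Rmult_0_r, exp_0. lra.
    + change (rsum ?f (S n)) with (rsum f n + f n). rewrite Rmult_plus_distr_l.
      pose proof (Rpower_step (INR n + 1) a ltac:(pose proof (pos_INR n); lra) Ha).
      cbv beta. rewrite !S_INR. lra.
  - destruct n as [|n]; [simpl; lra|].
    assert (H : a * rsum (fun k => Rpower (INR (S k)) (- 1 - a)) (S n) <= 1 + a - Rpower (INR (S n)) (- a)).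
    { induction n as [|n IH].
      - assert (H1 : forall b, Rpower 1 b = 1) by (intros b; unfold Rpower; rewrite ln_1, Rmult_0_r; apply exp_0).
        simpl. rewrite !H1. lra.
      - change (rsum ?f (S (S n))) with (rsum f (S n) + f (S n)). rewrite Rmult_plus_distr_l.
        pose proof (Rpower_step (INR n + 1) a ltac:(pose proof (pos_INR n); lra) Ha).
        cbv beta. rewrite !S_INR in *. lra. }
    pose proof (exp_pos (- a * ln (INR (S n)))). unfold Rpower at 2 in H. lra.
Qed.

Lemma ex_series_Rpower (s : R) : 1 < s -> ex_series (fun n => Rpower (INR (S n)) (- s)).
Proof.
  intros Hs.
  assert (Hf : ex_finite_lim_seq (sum_n (fun n => Rpower (INR (S n)) (- s)))).
  { apply ex_finite_lim_seq_incr with (s / (s - 1)).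
    - intros n. rewrite sum_Sn. pose proof (exp_pos (- s * ln (INR (S (S n))))).
      change (sum_n (fun n => Rpower (INR (S n)) (- s)) n <=
        sum_n (fun n => Rpower (INR (S n)) (- s)) n + exp (- s * ln (INR (S (S n))))). lra.
    - intros n. rewrite sum_n_rsum.
      destruct (rsum_Rpower (s - 1) (S n)) as [_ H]; [lra|].
      replace (- 1 - (s - 1)) with (- s) in H by ring.
      apply Rle_div_r; lra. }
  destruct Hf as [l Hl]. exists l. exact Hl.
Qed.

Lemma Cmod_dir (t : C) (n : nat) : Cmod (dir t 0 (S n)) = Rpower (INR (S n)) (- Re t).
Proof. unfold dir. rewrite beta_0, Cmod_cpow, re_opp. reflexivity. Qed.

Lemma asum_dir (t : C) : 1 < Re t -> asum (dir t 0).
Proof.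
  intros Ht. apply asum_cons. eapply asum_le; [|apply (ex_series_Rpower (Re t) Ht)].
  intros n. rewrite Cmod_dir. apply Rle_refl.
Qed.

Definition G (t : C) (y : R) : C := ((E t y + E t (2 * PI - y)) / 2)%C.

Lemma cos_2PI_mult (n : nat) (y : R) : cos (INR n * (2 * PI - y)) = cos (INR n * y).
Proof.
  replace (INR n * (2 * PI - y)) with (- (INR n * y) + 2 * INR n * PI) by ring.
  rewrite cos_period. apply cos_neg.
Qed.

Lemma sin_2PI_mult (n : nat) (y : R) : sin (INR n * (2 * PI - y)) = - sin (INR n * y).
Proof.
  replace (INR n * (2 * PI - y)) with (- (INR n * y) + 2 * INR n * PI) by ring.
  rewrite sin_period. apply sin_neg.
Qed.

Lemma E_sums (t : C) (y : R) : 1 < Re t -> 0 < y < 2 * PI ->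
  sums (fun n => dir t 0 n * eiy y ^ n)%C (E t y).
Proof.
  intros Ht Hy. assert (H := asum_dir t Ht).
  rewrite (E_EN 0 t y Hy H). unfold EN.
  replace (_ / _)%C with (ts (dir t 0) (eiy y)) by (simpl; field).
  apply ts_sums; [apply Cmod_eiy|exact H].
Qed.

Lemma G_sums (t : C) (y : R) : 1 < Re t -> 0 < y < 2 * PI ->
  sums (fun n => dir t 0 n * RtoC (cos (INR n * y)))%C (G t y).
Proof.
  intros Ht Hy.
  assert (H1 := E_sums t y Ht Hy). assert (H2 := E_sums t (2 * PI - y) Ht ltac:(lra)).
  unfold G. replace ((E t y + E t (2 * PI - y)) / 2)%C
    with (RtoC (/ 2) * (E t y + E t (2 * PI - y)%R))%C by (rewrite RtoC_inv by lra; field).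
  eapply sums_ext; [|apply sums_scal, sums_plus; [exact H1|exact H2]].
  intros n. cbv beta. rewrite !eiy_pow, !eiy_cos_sin, cos_2PI_mult, sin_2PI_mult.
  rewrite <- Cmult_plus_distr_l, Cmult_assoc, (Cmult_comm (RtoC (/ 2))), <- Cmult_assoc. f_equal.
  apply injective_projections; simpl; field.
Qed.

Lemma G_sym (t : C) (y : R) : G t (2 * PI - y) = G t y.
Proof.
  unfold G. replace (2 * PI - (2 * PI - y)) with y by ring. f_equal. ring.
Qed.

Lemma G_PI (t : C) : G t PI = E t PI.
Proof. unfold G. replace (2 * PI - PI) with PI by ring. field. Qed.

Definition G' (t : C) (y : R) : C := (Ci * (E (t - 1) y - E (t - 1) (2 * PI - y)) / 2)%C.

Lemma derC_E_refl (t : C) (y : R) : 0 < y < 2 * PI ->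
  derC (fun x => E t (2 * PI - x)) y (- (Ci * E (t - 1) (2 * PI - y)%R))%C.
Proof.
  intros Hy. replace (- (Ci * E (t - 1) (2 * PI - y)%R))%C
    with (RtoC (- 1) * (Ci * E (t - 1) (2 * PI - y)%R))%C by (rewrite RtoC_m1; ring).
  apply (derC_comp (E t) (fun x => 2 * PI - x)); [apply derC_E; lra|].
  auto_derive; [trivial|ring].
Qed.

Lemma derC_G (t : C) (y : R) : 0 < y < 2 * PI -> derC (G t) y (G' t y).
Proof.
  intros Hy. unfold G, G'.
  replace (Ci * (E (t - 1) y - E (t - 1) (2 * PI - y)%R) / 2)%C
    with (/ 2 * (Ci * E (t - 1) y + - (Ci * E (t - 1) (2 * PI - y)%R)))%C by field.
  apply derC_ext with (fun x => / 2 * (E t x + E t (2 * PI - x)%R))%C; [intros; field|].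
  apply derC_scal, derC_plus; [apply derC_E, Hy|apply derC_E_refl, Hy].
Qed.

Lemma derC_G' (t : C) (y : R) : 0 < y < 2 * PI -> derC (G' t) y (- G (t - 2) y)%C.
Proof.
  intros Hy. unfold G, G'.
  replace (t - 2)%C with (t - 1 - 1)%C by ring.
  assert (HC : (Ci * Ci)%C = (- (1))%C) by lca.
  replace (- ((E (t - 1 - 1) y + E (t - 1 - 1) (2 * PI - y)%R) / 2))%C
    with (Ci / 2 * (Ci * E (t - 1 - 1) y - - (Ci * E (t - 1 - 1) (2 * PI - y)%R)))%C.
  - apply derC_ext with (fun x => Ci / 2 * (E (t - 1) x - E (t - 1) (2 * PI - x)%R))%C; [intros; field|].
    apply derC_scal, derC_minus; [apply derC_E, Hy|apply derC_E_refl, Hy].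
  - replace (Ci / 2 * (Ci * E (t - 1 - 1) y - - (Ci * E (t - 1 - 1) (2 * PI - y)%R)))%C
      with (Ci * Ci * (E (t - 1 - 1) y + E (t - 1 - 1) (2 * PI - y)%R) / 2)%C by field.
    rewrite HC. field.
Qed.

Lemma sums_multiples (N : nat) (b : nat -> C) (L : C) : (1 <= N)%nat ->
  sums b L -> (forall n, (n mod N <> 0)%nat -> b n = RtoC 0) -> sums (fun m => b (N * m)%nat) L.
Proof.
  intros HN H Hb.
  assert (Hp : forall M, psum b (N * M) = psum (fun m => b (N * m)%nat) M).
  { intros M. induction M as [|M IH]; [rewrite Nat.mul_0_r; reflexivity|].
    simpl psum. rewrite <- IH. replace (N * S M)%nat with (N * M + S (N - 1))%nat by lia.
    rewrite psum_app, psum_S_l, Nat.add_0_r. f_equal.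
    rewrite (psum_ext _ (fun _ => RtoC 0)), psum_const; [ring|].
    intros k Hk. apply Hb. rewrite Nat.mul_comm, Nat.add_comm, Nat.Div0.mod_add.
    rewrite Nat.mod_small; lia. }
  intros eps He. destruct (H eps He) as [M HM]. exists M. intros n Hn.
  rewrite <- Hp. apply HM. nia.
Qed.

Lemma dir_mult (t : C) (N m : nat) : (1 <= N)%nat ->
  dir t 0 (N * m) = (cpow (INR N) (- t) * dir t 0 m)%C.
Proof.
  intros HN. destruct m as [|m]; [rewrite Nat.mul_0_r; simpl; ring|].
  destruct N as [|N]; [lia|].
  change (S N * S m)%nat with (S (m + N * S m)). unfold dir. rewrite !beta_0.
  replace (INR (S (m + N * S m))) with (INR (S N) * INR (S m)).
  - apply cpow_mult; apply lt_0_INR; lia.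
  - rewrite <- mult_INR. f_equal.
Qed.

Lemma psum_geom (q : C) (n : nat) : ((1 - q) * psum (fun k => q ^ k) n = 1 - q ^ n)%C.
Proof. induction n as [|n IH]; [simpl; ring|]. simpl psum. rewrite Cpow_S, Cmult_plus_distr_l, IH. ring. Qed.

Lemma eiy_2PI_nat (k : nat) : eiy (2 * PI * INR k) = RtoC 1.
Proof.
  rewrite eiy_cos_sin. replace (2 * PI * INR k) with (0 + 2 * INR k * PI) by ring.
  rewrite cos_period, sin_period, cos_0, sin_0. reflexivity.
Qed.

Lemma eiy_plus (x y : R) : eiy (x + y) = (eiy x * eiy y)%C.
Proof. unfold eiy. rewrite <- Cexp_plus. f_equal. rewrite RtoC_plus. ring. Qed.

Lemma eiy_root_neq_1 (N n : nat) : (1 <= N)%nat -> (n mod N <> 0)%nat ->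
  (1 - eiy (2 * PI * INR n / INR N))%C <> RtoC 0.
Proof.
  intros HN Hn.
  assert (HN' : 0 < INR N) by (apply lt_0_INR; lia).
  rewrite (Nat.div_mod n N) by lia. rewrite plus_INR, mult_INR.
  replace (2 * PI * (INR N * INR (n / N) + INR (n mod N)) / INR N)
    with (2 * PI * INR (n / N) + 2 * PI * INR (n mod N) / INR N) by (field; lra).
  rewrite eiy_plus, eiy_2PI_nat, Cmult_1_l.
  apply eiy_neq_1. assert (HP := PI_RGT_0).
  assert (Hm1 : 0 < INR (n mod N)) by (apply lt_0_INR; lia).
  assert (Hm2 : INR (n mod N) < INR N) by (apply lt_INR, Nat.mod_upper_bound; lia).
  split.
  - apply Rdiv_lt_0_compat; [nra|exact HN'].
  - apply (Rlt_div_l _ _ (INR N)); nra.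
Qed.

Definition grid (N j : nat) (y : R) : R := (y + 2 * PI * INR j) / INR N.

Lemma grid_range (N j : nat) (y : R) : (j < N)%nat -> 0 < y < 2 * PI -> 0 < grid N j y < 2 * PI.
Proof.
  intros Hj Hy. unfold grid. assert (HN : 0 < INR N) by (apply lt_0_INR; lia).
  assert (HP := PI_RGT_0). assert (H0 := pos_INR j).
  assert (Hj' : INR j + 1 <= INR N) by (rewrite <- S_INR; apply le_INR; lia).
  split; [apply Rdiv_lt_0_compat; nra|]. apply (Rlt_div_l _ _ (INR N)); nra.
Qed.

Lemma sum_cos_grid (N n : nat) (y : R) : (1 <= N)%nat ->
  psum (fun j => RtoC (cos (INR n * grid N j y))) N =
  if (n mod N =? 0)%nat then RtoC (INR N * cos (INR n * y / INR N)) else RtoC 0.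
Proof.
  intros HN. assert (HN' : 0 < INR N) by (apply lt_0_INR; lia).
  assert (E1 : forall j, RtoC (cos (INR n * grid N j y)) =
    RtoC (Re (eiy (INR n * y / INR N) * eiy (2 * PI * INR n / INR N) ^ j))).
  { intros j. rewrite eiy_pow, <- eiy_plus, eiy_cos_sin. unfold Re, fst. do 2 f_equal.
    unfold grid. field. lra. }
  rewrite (psum_ext _ _ N (fun j _ => E1 j)).
  assert (E2 : forall a m, psum (fun j => RtoC (Re (a j))) m = RtoC (Re (psum a m))).
  { intros a m. induction m as [|m IH]; [reflexivity|]. simpl psum.
    rewrite IH, re_plus, RtoC_plus. reflexivity. }
  rewrite E2, psum_scal.
  destruct (Nat.eqb_spec (n mod N) 0) as [h|h].
  - assert (Eq : eiy (2 * PI * INR n / INR N) = RtoC 1).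
    { rewrite (Nat.div_mod n N) by lia. rewrite h, Nat.add_0_r, mult_INR.
      replace (2 * PI * (INR N * INR (n / N)) / INR N) with (2 * PI * INR (n / N)) by (field; lra).
      apply eiy_2PI_nat. }
    rewrite Eq. rewrite (psum_ext _ (fun _ => RtoC 1)) by (intros; apply Cpow_1_l).
    rewrite psum_const, eiy_cos_sin. f_equal. simpl. ring.
  - assert (Hq := eiy_root_neq_1 N n HN h). set (q := eiy (2 * PI * INR n / INR N)) in *.
    assert (Hg := psum_geom q N).
    assert (Eq : (q ^ N)%C = RtoC 1).
    { unfold q. rewrite eiy_pow.
      replace (INR N * (2 * PI * INR n / INR N)) with (2 * PI * INR n) by (field; lra). apply eiy_2PI_nat. }
    rewrite Eq in Hg.
    assert (Ep : psum (fun k => q ^ k)%C N = RtoC 0).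
    { replace (psum (fun k => q ^ k)%C N) with (/ (1 - q) * ((1 - q) * psum (fun k => q ^ k) N))%C by (field; exact Hq).
      rewrite Hg. field. exact Hq. }
    match goal with |- context [psum ?f N] => change (psum f N) with (psum (fun k => q ^ k)%C N) end.
    rewrite Ep, Cmult_0_r. reflexivity.
Qed.

Lemma psum_sums (u : nat -> nat -> C) (l : nat -> C) (N : nat) :
  (forall j, (j < N)%nat -> sums (u j) (l j)) -> sums (fun n => psum (fun j => u j n) N) (psum l N).
Proof.
  intros H. induction N as [|N IH]; simpl.
  - apply (sums_finite (fun _ => RtoC 0) 0). reflexivity.
  - apply sums_plus; [apply IH; intros; apply H|apply H]; lia.
Qed.

Definition kubert (t : C) : Prop := forall N y, (1 <= N)%nat -> 0 < y < 2 * PI ->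
  psum (fun j => G t (grid N j y)) N = (cpow (INR N) (1 - t) * G t y)%C.

Lemma kubert_right (t : C) : 1 < Re t -> kubert t.
Proof.
  intros Ht N y HN Hy. assert (HN' : 0 < INR N) by (apply lt_0_INR; lia).
  set (b := fun n => (dir t 0 n * (if (n mod N =? 0)%nat then RtoC (INR N * cos (INR n * y / INR N)) else RtoC 0))%C).
  assert (H1 : sums b (psum (fun j => G t (grid N j y)) N)).
  { eapply sums_ext; [|apply (psum_sums (fun j n => dir t 0 n * RtoC (cos (INR n * grid N j y)))%C)].
    - intros n. cbv beta. rewrite psum_scal, sum_cos_grid by exact HN. reflexivity.
    - intros j Hj. apply G_sums; [exact Ht|]. apply grid_range; assumption. }
  apply (sums_multiples N) in H1; [|exact HN|].
  2:{ intros n Hn. unfold b. destruct (Nat.eqb_spec (n mod N) 0) as [h|h]; [contradiction|ring]. }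
  apply (sums_unique _ _ _ H1).
  eapply sums_ext; [|apply sums_scal, G_sums; [exact Ht|exact Hy]].
  intros m. cbv beta. unfold b. rewrite dir_mult by exact HN.
  rewrite Nat.mul_comm, Nat.Div0.mod_mul. simpl Nat.eqb.
  unfold Cminus. rewrite cpow_plus, cpow_1 by exact HN'. rewrite RtoC_mult, mult_INR.
  replace (INR m * INR N * y / INR N) with (INR m * y) by (field; lra). ring.
Qed.

Lemma derC_psum (f f' : nat -> R -> C) (x : R) (N : nat) :
  (forall j, (j < N)%nat -> derC (f j) x (f' j x)) ->
  derC (fun y => psum (fun j => f j y) N) x (psum (fun j => f' j x) N).
Proof.
  intros H. induction N as [|N IH]; simpl; [apply derC_const|].
  apply derC_plus; [apply IH; intros; apply H|apply H]; lia.
Qed.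

Lemma grid_derive (N j : nat) (y : R) : is_derive (grid N j) y (/ INR N).
Proof. unfold grid, Rdiv. auto_derive; [trivial|ring]. Qed.

Lemma scaling_derive (f f' : R -> C) (c : C) (N : nat) : (1 <= N)%nat ->
  (forall y, 0 < y < 2 * PI -> derC f y (f' y)) ->
  (forall y, 0 < y < 2 * PI -> psum (fun j => f (grid N j y)) N = (c * f y)%C) ->
  forall y, 0 < y < 2 * PI -> psum (fun j => f' (grid N j y)) N = (RtoC (INR N) * c * f' y)%C.
Proof.
  intros HN Hd Hf y Hy. assert (HN' : 0 < INR N) by (apply lt_0_INR; lia).
  assert (HNC : RtoC (INR N) <> RtoC 0) by (intros h; apply RtoC_inj in h; lra).
  assert (D1 : derC (fun x => psum (fun j => f (grid N j x)) N) y
    (psum (fun j => RtoC (/ INR N) * f' (grid N j y))%C N)).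
  { apply (derC_psum (fun j x => f (grid N j x)) (fun j x => RtoC (/ INR N) * f' (grid N j x))%C).
    intros j Hj. apply (derC_comp f (grid N j)); [apply Hd, grid_range; assumption|apply grid_derive]. }
  assert (D2 : derC (fun x => psum (fun j => f (grid N j x)) N) y (c * f' y)%C).
  { eapply derC_ext_loc; [|exact (derC_scal c f y (f' y) (Hd y Hy))].
    apply locally_open_Ioo with 0 (2 * PI); [exact Hy|]. intros x Hx. symmetry. apply Hf, Hx. }
  assert (Eq := derC_unique _ _ _ _ D1 D2). rewrite psum_scal, RtoC_inv in Eq by lra.
  rewrite <- Cmult_assoc, <- Eq. field. exact HNC.
Qed.

Lemma kubert_down (t : C) : kubert t -> kubert (t - 2).
Proof.
  intros H N y HN Hy. assert (HN' : 0 < INR N) by (apply lt_0_INR; lia).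
  assert (H1 := scaling_derive (G t) (G' t) (cpow (INR N) (1 - t)) N HN (derC_G t) (fun x => H N x HN)).
  assert (H2 := scaling_derive (G' t) (fun x => - G (t - 2) x)%C _ N HN (derC_G' t) H1 y Hy).
  cbv beta in H2.
  rewrite (psum_ext _ (fun j => (- (1)) * G (t - 2) (grid N j y))%C), psum_scal in H2 by (intros; ring).
  replace (psum (fun j => G (t - 2) (grid N j y)) N) with
    ((- (1)) * ((- (1)) * psum (fun j => G (t - 2) (grid N j y)) N))%C by ring.
  rewrite H2. replace (1 - (t - 2))%C with (1 + (1 + (1 - t)))%C by ring.
  rewrite !(cpow_plus _ (RtoC 1)), cpow_1 by exact HN'. ring.
Qed.

Lemma kubert_all (t : C) : kubert t.
Proof.
  assert (H : forall n s, 1 < Re s + 2 * INR n -> kubert s).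
  { intros n. induction n as [|n IH]; intros s Hs.
    - apply kubert_right. simpl in Hs. lra.
    - replace s with (s + 2 - 2)%C by ring. apply kubert_down, IH.
      rewrite re_plus, re_RtoC. rewrite S_INR in Hs. lra. }
  apply (H (Nof t)). pose proof (Nof_spec t). pose proof (pos_INR (Nof t)). lra.
Qed.

Lemma cana_const (c : C) (z0 : C) : cana (fun _ => c) z0.
Proof.
  exists (fun n => match n with O => c | S _ => RtoC 0 end), 1. split; [lra|]. split.
  - exists (Cmod c). intros n. rewrite pow1. destruct n; [lra|]. rewrite Cmod_0. pose proof (Cmod_ge_0 c). lra.
  - intros h _.
    assert (H := sums_finite (fun n => match n with O => c | S _ => RtoC 0 end * h ^ n)%C 1).
    simpl psum in H. replace (0 + c * 1)%C with c in H by ring. apply H.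
    intros n Hn. destruct n; [lia|ring].
Qed.

Lemma cana_cpow (x : R) (z0 : C) : cana (fun z => cpow x (- z)) z0.
Proof.
  exists (fun n => cpow x (- z0) * (RtoC (- ln x) ^ n / RtoC (INR (fact n))))%C, 1. split; [lra|]. split.
  - destruct (rad_exp (RtoC (- ln x)) 1) as [M HM]; [lra|].
    exists (Cmod (cpow x (- z0)) * M). intros n. rewrite Cmod_mult, Rmult_assoc.
    apply Rmult_le_compat_l; [apply Cmod_ge_0|apply HM].
  - intros h _.
    assert (Es : (cpow x (- (z0 + h)) = cpow x (- z0) * Cexp (h * RtoC (- ln x)))%C).
    { unfold cpow. rewrite <- Cexp_plus. f_equal. rewrite RtoC_opp. ring. }
    rewrite Es. eapply sums_ext; [|apply sums_scal, sums_Cexp].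
    intros j. cbv beta. rewrite Cpow_mult_l. unfold Cdiv. ring.
Qed.

Lemma identity_right_half_plane (f g : C -> C) :
  (forall z, z <> RtoC 1 -> cana f z) -> (forall z, z <> RtoC 1 -> cana g z) ->
  (forall z, 1 < Re z -> f z = g z) -> forall z, z <> RtoC 1 -> f z = g z.
Proof.
  intros Hf Hg Hfg q Hq. apply Ceq_minus.
  set (sg := if Rle_dec 0 (Im q) then 1 else - 1).
  set (p := (2, sg) : C).
  assert (Hp : 0 < 1 + Cmod (q - p)) by (pose proof (Cmod_ge_0 (q - p)); lra).
  apply (identity_segment (fun z => f z - g z)%C p q (/ (1 + Cmod (q - p)))).
  - intros tau Ht.
    assert (Hne : (p + RtoC tau * (q - p))%C <> RtoC 1).
    { intros E1.
      assert (Ei := f_equal Im E1). unfold Cminus in Ei.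
      rewrite im_plus, im_scal_l, im_plus, im_opp, im_RtoC in Ei. change (Im p) with sg in Ei.
      assert (Htau : tau = 1).
      { unfold sg in *. destruct (Rle_dec 0 (Im q)); nra. }
      apply Hq. rewrite <- E1, Htau. ring. }
    apply cana_minus; [apply Hf|apply Hg]; exact Hne.
  - apply Rinv_0_lt_compat, Hp.
  - intros tau Ht. apply (proj1 (Ceq_minus _ _)). apply Hfg.
    unfold Cminus. rewrite re_plus, re_scal_l. change (Re p) with 2. fold (Cminus q p).
    pose proof (re_le_Cmod (q - p)). pose proof (Cmod_ge_0 (q - p)).
    assert (H1 : tau * Cmod (q - p) < 1).
    { apply Rle_lt_trans with (/ (1 + Cmod (q - p)) * Cmod (q - p)).
      - apply Rmult_le_compat_r; lra.
      - apply (Rmult_lt_reg_l (1 + Cmod (q - p))); [exact Hp|].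
        rewrite <- Rmult_assoc, Rinv_r; lra. }
    assert (H2 : - Cmod (q - p) <= Re (q - p)).
    { pose proof (Rle_abs (- Re (q - p))). rewrite Rabs_Ropp in *. lra. }
    nra.
Qed.

Lemma zeta_sums (zeta : C -> C) (t : C) : is_riemann_zeta zeta -> 1 < Re t ->
  sums (dir t 0) (zeta t).
Proof.
  intros [Hz _] Ht. specialize (Hz t Ht). apply sums_is_series in Hz.
  replace (zeta t) with (dir t 0 O + zeta t)%C by (simpl; ring).
  apply sums_cons. eapply sums_ext; [|exact Hz].
  intros n. cbv beta. rewrite nat_Cpow_inv. unfold dir. now rewrite beta_0.
Qed.

Lemma cos_nat_PI (n : nat) : cos (INR n * PI) = (- 1) ^ n.
Proof.
  induction n as [|n IH]; [rewrite Rmult_0_l; apply cos_0|].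
  rewrite S_INR, Rmult_plus_distr_r, Rmult_1_l, neg_cos, IH. simpl. ring.
Qed.

Lemma zeta_G_PI (zeta : C -> C) (t : C) : is_riemann_zeta zeta -> t <> RtoC 1 ->
  G t PI = ((cpow 2 (1 - t) - 1) * zeta t)%C.
Proof.
  intros Hz Ht. rewrite G_PI.
  assert (HP := PI_RGT_0).
  apply (identity_right_half_plane (fun t => E t PI) (fun t => (2 * cpow 2 (- t) - 1) * zeta t)%C) in Ht.
  - rewrite Ht. unfold Cminus. rewrite cpow_plus, cpow_1 by lra. ring.
  - intros z _. apply cana_E. lra.
  - intros z Hne. apply cana_mult; [|apply analytic_cana, Hz, Hne].
    apply cana_minus; [|apply cana_const]. apply cana_mult; [apply cana_const|apply cana_cpow].
  - intros z Hre.
    assert (H1 := zeta_sums zeta z Hz Hre).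
    assert (H2 : sums (fun n => dir z 0 n * RtoC (cos (INR n * PI)))%C (E z PI)).
    { rewrite <- G_PI. apply G_sums; [exact Hre|lra]. }
    assert (H3 := sums_plus _ _ _ _ H1 H2).
    apply (sums_multiples 2) in H3; [|lia|].
    + assert (Ee : (zeta z + E z PI)%C = (2 * cpow 2 (- z) * zeta z)%C).
      { apply (sums_unique _ _ _ H3). eapply sums_ext; [|apply sums_scal, H1].
        intros m. cbv beta. rewrite dir_mult, cos_nat_PI, pow_1_even by lia. simpl INR.
        replace (1 + 1) with 2 by ring. ring. }
      replace (E z PI) with (zeta z + E z PI - zeta z)%C by ring. rewrite Ee. ring.
    + intros n Hn. rewrite cos_nat_PI.
      assert (Hodd : exists k, n = S (2 * k)).
      { exists (n / 2)%nat. assert (H4 := Nat.div_mod n 2 ltac:(lia)).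
        assert (H5 := Nat.mod_upper_bound n 2 ltac:(lia)). lia. }
      destruct Hodd as [k ->]. rewrite pow_1_odd, RtoC_m1. ring.
Qed.


Lemma Rpower_le_base (x y a : R) : 0 < x -> x <= y -> 0 <= a -> Rpower x a <= Rpower y a.
Proof.
  intros Hx Hxy Ha. unfold Rpower.
  assert (ln x <= ln y) by (apply ln_le; assumption).
  apply exp_monotone. nra.
Qed.

Lemma G_bounded (t : C) (a b : R) : 0 < a -> a <= b -> b < 2 * PI ->
  exists M, 0 <= M /\ forall y, a <= y <= b -> Cmod (G t y) <= M.
Proof.
  intros Ha Hab Hb.
  destruct (continuity_ab_maj (fun y => Cmod (G t y)) a b Hab) as [x [Hx _]].
  - intros c Hc eps He. destruct (derC_continuous _ _ _ (derC_G t c ltac:(lra)) eps He) as [d [Hd H]].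
    exists d. split; [exact Hd|]. intros y [_ Hy]. simpl in *. unfold R_dist in *.
    eapply Rle_lt_trans; [|apply (H y Hy)].
    apply Rabs_le. pose proof (Cmod_sub_le (G t y) (G t c)).
    pose proof (Cmod_sub_le (G t c) (G t y)). rewrite (Cmod_minus_sym (G t c)) in *. lra.
  - exists (Cmod (G t x)). split; [apply Cmod_ge_0|exact Hx].
Qed.

Definition psi (t : C) (y : R) : C := (cpow y (1 - t) * G t y)%C.

Lemma Re_1_minus (t : C) : Re (1 - t) = 1 - Re t.
Proof. unfold Cminus. rewrite re_plus, re_opp, re_RtoC. ring. Qed.

Lemma psi_scale (t : C) (N : nat) : Re t < 0 -> (1 <= N)%nat ->
  exists B, 0 <= B /\ forall y, 0 < y <= PI ->
    Cmod (psi t (y / INR N) - psi t y) <= B * Rpower y (1 - Re t).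
Proof.
  intros Ht HN. assert (HN1 : 1 <= INR N) by (apply (le_INR 1 N), HN).
  assert (HP := PI_RGT_0).
  assert (HPN : 0 < PI / INR N <= PI).
  { split; [apply Rdiv_lt_0_compat; lra|]. apply Rle_div_l; [lra|nra]. }
  destruct (G_bounded t (PI / INR N) (2 * PI - PI / INR N)) as [M [HM0 HM]]; [lra|lra|lra|].
  exists (INR N * M). split; [apply Rmult_le_pos; lra|].
  intros y Hy. assert (Hy2 : 0 < y < 2 * PI) by lra.
  assert (HK := kubert_all t N y HN Hy2).
  destruct N as [|n]; [lia|]. rewrite psum_S_l in HK.
  set (S := psum (fun j => G t (grid (Datatypes.S n) (Datatypes.S j) y)) n) in *.
  assert (Eg : grid (Datatypes.S n) 0 y = y / INR (Datatypes.S n)).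
  { unfold grid. simpl (INR 0). rewrite Rmult_0_r, Rplus_0_r. reflexivity. }
  rewrite Eg in HK. set (x := y / INR (Datatypes.S n)) in *.
  assert (Hx : 0 < x) by (apply Rdiv_lt_0_compat; lra).
  assert (Hxy : x <= y) by (apply Rle_div_l; [lra|nra]).
  assert (Ey : y = INR (Datatypes.S n) * x) by (unfold x; field; lra).
  assert (Ep : (psi t x - psi t y = - (cpow x (1 - t) * S))%C).
  { unfold psi. rewrite Ey at 1. rewrite cpow_mult by lra.
    replace (cpow (INR (Datatypes.S n)) (1 - t) * cpow x (1 - t) * G t y)%C
      with (cpow x (1 - t) * (cpow (INR (Datatypes.S n)) (1 - t) * G t y))%C by ring.
    rewrite <- HK. ring. }
  rewrite Ep, Cmod_opp, Cmod_mult, Cmod_cpow, Re_1_minus, Rmult_comm.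
  apply Rmult_le_compat; [apply Cmod_ge_0|apply Rlt_le, exp_pos| |apply Rpower_le_base; lra].
  apply Rle_trans with (rsum (fun _ => M) n).
  - apply Cmod_psum_le. intros k Hk. apply HM.
    assert (Hk1 : INR k + 1 <= INR n) by (rewrite <- S_INR; apply le_INR; lia).
    unfold grid. rewrite !S_INR. assert (Hk0 := pos_INR k). assert (Hn0 := pos_INR n).
    assert (HDi : / (INR n + 1) * (INR n + 1) = 1) by (apply Rinv_l; lra).
    split.
    + unfold Rdiv. apply Rmult_le_compat_r; [apply Rlt_le, Rinv_0_lt_compat; lra|]. nra.
    + apply Rle_div_l; [lra|].
      replace ((2 * PI - PI / (INR n + 1)) * (INR n + 1)) with (2 * PI * (INR n + 1) - PI) by (field; lra).
      nra.
  - assert (Er : forall k, rsum (fun _ => M) k = INR k * M).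
    { intros k. induction k as [|k IH]; [simpl; ring|]. change (rsum ?f (Datatypes.S k)) with (rsum f k + f k).
      rewrite IH, S_INR. ring. }
    rewrite Er, S_INR. nra.
Qed.

Lemma Rpower_half_pow (y s : R) (k : nat) : 0 < y -> 1 <= s ->
  Rpower (y / 2 ^ k) s <= Rpower y s * (/ 2) ^ k.
Proof.
  intros Hy Hs. assert (H2 : 0 < / 2 ^ k) by (apply Rinv_0_lt_compat, pow_lt; lra).
  unfold Rdiv.
  rewrite <- Rpower_mult_distr by assumption.
  apply Rmult_le_compat_l; [apply Rlt_le, exp_pos|].
  rewrite pow_inv. rewrite <- (Rpower_1 (/ 2 ^ k)) at 2 by exact H2.
  unfold Rpower.
  assert (Hl : ln (/ 2 ^ k) <= 0).
  { rewrite ln_Rinv by (apply pow_lt; lra). assert (0 <= ln (2 ^ k)); [|lra].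
    rewrite <- ln_1. apply ln_le; [lra|]. apply pow_R1_Rle; lra. }
  apply exp_monotone. nra.
Qed.

Lemma psi_limit (t : C) : Re t < 0 ->
  exists (L : R -> C) (K : R), 0 <= K /\
    (forall y, 0 < y <= PI -> Cmod (psi t y - L y) <= K * Rpower y (1 - Re t)) /\
    (forall y, 0 < y <= PI -> L (y / 2) = L y).
Proof.
  intros Ht. destruct (psi_scale t 2 Ht) as [B [HB0 HB]]; [lia|].
  set (d := fun y k => (psi t (y / 2 ^ S k) - psi t (y / 2 ^ k))%C).
  assert (Hd : forall y k, 0 < y <= PI -> Cmod (d y k) <= B * Rpower y (1 - Re t) * (/ 2) ^ k).
  { intros y k Hy. assert (H2 : 1 <= 2 ^ k) by (apply pow_R1_Rle; lra).
    assert (Hyk : 0 < y / 2 ^ k <= PI).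
    { split; [apply Rdiv_lt_0_compat; lra|]. apply Rle_div_l; [lra|nra]. }
    unfold d. replace (y / 2 ^ S k) with (y / 2 ^ k / INR 2) by (simpl; field; lra).
    eapply Rle_trans; [apply HB, Hyk|]. rewrite Rmult_assoc. apply Rmult_le_compat_l; [exact HB0|].
    apply Rpower_half_pow; lra. }
  assert (Has : forall y, 0 < y <= PI -> asum (d y)).
  { intros y Hy. eapply asum_le; [intros k; apply (Hd y k Hy)|]. apply ex_series_geom_scal. lra. }
  exists (fun y => psi t y + tsum (d y))%C, (2 * B). split; [lra|]. split.
  - intros y Hy. replace (psi t y - (psi t y + tsum (d y)))%C with (- tsum (d y))%C by ring.
    rewrite Cmod_opp.
    eapply Rle_trans; [apply (sums_Cmod_le _ _ _ (asum_tsum _ (Has y Hy)) (fun k => Hd y k Hy))|].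
    + apply ex_series_geom_scal; lra.
    + rewrite Series_geom_scal by lra. right. field.
  - intros y Hy.
    assert (Hs := sums_tail _ _ (asum_tsum _ (Has y Hy))).
    assert (E1 : tsum (d (y / 2)) = (tsum (d y) - d y O)%C).
    { apply tsum_eq; [apply Has; lra|]. eapply sums_ext; [|exact Hs].
      intros k. unfold d. assert (2 ^ k <> 0) by (apply pow_nonzero; lra).
      replace (y / 2 ^ S (S k)) with (y / 2 / 2 ^ S k) by (simpl; field; assumption).
      replace (y / 2 ^ S k) with (y / 2 / 2 ^ k) by (simpl; field; assumption). reflexivity. }
    rewrite E1. unfold d. replace (y / 2 ^ 1) with (y / 2) by (simpl; field).
    replace (y / 2 ^ 0) with y by (simpl; field). ring.
Qed.

(** The limit of [y^(1-t) G(t,y)] along [y, y/2, y/4, ...] is invariant under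
    [y -> y/N] for every [N], hence is the same for all rational multiples of [PI]. *)
Lemma G_singular (t : C) : Re t < 0 ->
  exists (c : C) (K : R), forall y, 0 < y <= PI -> Cmod (G t y - c * cpow y (t - 1)) <= K.
Proof.
  intros Ht. destruct (psi_limit t Ht) as [L [K [HK0 [HL HL2]]]].
  assert (HP := PI_RGT_0).
  set (s := 1 - Re t) in *. assert (Hs : 1 <= s) by (unfold s; lra).
  assert (Hhalf : forall y m, 0 < y <= PI -> 0 < y / 2 ^ m <= PI).
  { intros y m Hy. assert (1 <= 2 ^ m) by (apply pow_R1_Rle; lra).
    split; [apply Rdiv_lt_0_compat; lra|]. apply Rle_div_l; [lra|nra]. }
  assert (HLm : forall m y, 0 < y <= PI -> L (y / 2 ^ m) = L y).
  { intros m. induction m as [|m IH]; intros y Hy.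
    - f_equal. simpl. field.
    - replace (y / 2 ^ S m) with (y / 2 ^ m / 2) by (simpl; field; apply pow_nonzero; lra).
      rewrite HL2 by (apply Hhalf, Hy). apply IH, Hy. }
  assert (HN : forall N y, (1 <= N)%nat -> 0 < y <= PI -> L (y / INR N) = L y).
  { intros N y HN Hy. destruct (psi_scale t N Ht HN) as [B [HB0 HB]]. fold s in HB.
    assert (HN1 : 1 <= INR N) by (apply (le_INR 1 N), HN).
    assert (HyN : 0 < y / INR N <= y).
    { split; [apply Rdiv_lt_0_compat; lra|]. apply Rle_div_l; [lra|nra]. }
    apply (Cmod_eps_eq _ _ ((2 * K + B) * Rpower y s)). intros eps He.
    destruct (pow_lt_1_zero (/ 2) ltac:(rewrite Rabs_pos_eq; lra) eps He) as [m Hm].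
    specialize (Hm m (le_n _)). rewrite Rabs_pos_eq in Hm by (apply pow_le; lra).
    assert (Hy' := Hhalf y m Hy). assert (HyN' := Hhalf (y / INR N) m ltac:(lra)).
    rewrite <- (HLm m y Hy), <- (HLm m (y / INR N)) by lra.
    assert (H1 := HL _ Hy'). assert (H2 := HL _ HyN'). assert (H3 := HB _ Hy').
    assert (Ec : y / 2 ^ m / INR N = y / INR N / 2 ^ m).
    { assert (2 ^ m <> 0) by (apply pow_nonzero; lra). field. split; [lra|exact H]. }
    rewrite Ec in H3. set (a := y / INR N / 2 ^ m) in *. set (b := y / 2 ^ m) in *.
    assert (Hb : Rpower b s <= Rpower y s * eps).
    { eapply Rle_trans; [apply (Rpower_half_pow y s m); lra|].
      apply Rmult_le_compat_l; [apply Rlt_le, exp_pos|lra]. }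
    assert (Hab : Rpower a s <= Rpower b s).
    { apply Rpower_le_base; [lra| |lra]. unfold a, b. unfold Rdiv at 1 3.
      apply Rmult_le_compat_r; [|lra]. apply Rlt_le, Rinv_0_lt_compat, pow_lt; lra. }
    replace (L a - L b)%C with (- (psi t a - L a) + (psi t a - psi t b) + (psi t b - L b))%C by ring.
    eapply Rle_trans; [apply Cmod_triangle|].
    eapply Rle_trans; [apply Rplus_le_compat_r, Cmod_triangle|]. rewrite Cmod_opp.
    assert (K * Rpower a s <= K * (Rpower y s * eps)) by (apply Rmult_le_compat_l; lra).
    assert (K * Rpower b s <= K * (Rpower y s * eps)) by (apply Rmult_le_compat_l; lra).
    assert (B * Rpower b s <= B * (Rpower y s * eps)) by (apply Rmult_le_compat_l; lra).
    lra. }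
  assert (HQ : forall a b, (1 <= a)%nat -> (a <= b)%nat -> L (PI * INR a / INR b) = L PI).
  { intros a b Ha Hab.
    assert (Ha1 : 1 <= INR a) by (apply (le_INR 1 a), Ha).
    assert (Hab1 : INR a <= INR b) by (apply le_INR, Hab).
    rewrite <- (HN a (PI * INR a / INR b) Ha).
    - replace (PI * INR a / INR b / INR a) with (PI / INR b) by (field; lra). apply HN; [lia|lra].
    - split; [apply Rdiv_lt_0_compat; nra|]. apply Rle_div_l; [lra|nra]. }
  exists (L PI), K. intros y Hy.
  assert (Hpsi : Cmod (psi t y - L PI) <= K * Rpower y s).
  { apply le_epsilon. intros eps He.
    assert (Hdp : derC (psi t) y ((1 - t) * cpow y (1 - t - 1) * G t y + cpow y (1 - t) * G' t y)%C)
      by (apply derC_mult; [apply derC_cpow|apply derC_G]; lra).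
    destruct (derC_continuous _ _ _ Hdp eps He) as [d [Hd Hc]].
    set (r := y / PI). assert (Hr : 0 < r <= 1).
    { split; [apply Rdiv_lt_0_compat; lra|]. apply Rle_div_l; lra. }
    destruct (archimed_cor1 (Rmin r (d / PI))) as [b [Hb1 Hb0]].
    { apply Rmin_pos; [lra|apply Rdiv_lt_0_compat; lra]. }
    assert (Hb : 0 < INR b) by (apply lt_0_INR; lia).
    assert (Hbr : / INR b < r) by (eapply Rlt_le_trans; [exact Hb1|apply Rmin_l]).
    assert (Hbd : / INR b < d / PI) by (eapply Rlt_le_trans; [exact Hb1|apply Rmin_r]).
    destruct (nfloor_ex (r * INR b)) as [a [Ha1 Ha2]]; [nra|].
    assert (Hrb : 1 < r * INR b).
    { apply (Rmult_lt_compat_r (INR b)) in Hbr; [|exact Hb]. rewrite Rinv_l in Hbr; lra. }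
    assert (Ha : (1 <= a)%nat) by (apply INR_le; simpl; destruct a; [simpl in Ha2; lra|rewrite S_INR; pose proof (pos_INR a); lra]).
    assert (Hab : (a <= b)%nat) by (apply INR_le; nra).
    set (q := PI * INR a / INR b).
    assert (Hqy : q <= y).
    { unfold q. apply Rle_div_l; [exact Hb|]. replace (y * INR b) with (PI * (r * INR b)) by (unfold r; field; lra).
      apply Rmult_le_compat_l; lra. }
    assert (Hqd : Rabs (q - y) < d).
    { rewrite Rabs_minus_sym, Rabs_pos_eq by lra.
      replace (y - q) with (PI * (r * INR b - INR a) * / INR b) by (unfold q, r; field; lra).
      apply Rle_lt_trans with (PI * / INR b).
      - apply Rmult_le_compat_r; [apply Rlt_le, Rinv_0_lt_compat, Hb|]. nra.
      - apply (Rmult_lt_compat_l PI) in Hbd; [|exact HP].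
        replace (PI * (d / PI)) with d in Hbd by (field; lra). exact Hbd. }
    assert (Hq : 0 < q) by (unfold q; apply Rdiv_lt_0_compat; [|exact Hb]; apply Rmult_lt_0_compat; [exact HP|apply lt_0_INR; lia]).
    specialize (Hc q Hqd). assert (H1 := HL q ltac:(lra)). unfold q in H1 at 2. rewrite (HQ a b Ha Hab) in H1.
    assert (H2 : Rpower q s <= Rpower y s) by (apply Rpower_le_base; lra).
    assert (K * Rpower q s <= K * Rpower y s) by (apply Rmult_le_compat_l; lra).
    replace (psi t y - L PI)%C with (- (psi t q - psi t y) + (psi t q - L PI))%C by ring.
    eapply Rle_trans; [apply Cmod_triangle|]. rewrite Cmod_opp. lra. }
  replace (t - 1)%C with (- (1 - t))%C by ring. rewrite cpow_opp.
  assert (Hcy := cpow_neq_0 y (1 - t)).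
  replace (G t y - L PI * / cpow y (1 - t))%C with ((psi t y - L PI) / cpow y (1 - t))%C
    by (unfold psi; field; exact Hcy).
  rewrite Cmod_div, Cmod_cpow, Re_1_minus by exact Hcy. fold s.
  apply Rle_div_l; [apply exp_pos|exact Hpsi].
Qed.

(** * Hurwitz's formula *)

Definition zterm (t : C) (y : R) (m : nat) : C := cpow (y + 2 * PI * INR m) (t - 1).

Lemma Re_minus_1 (t : C) : Re (t - 1) = Re t - 1.
Proof. unfold Cminus. rewrite re_plus, re_opp, re_RtoC. ring. Qed.

Lemma zterm_bound (t : C) (y : R) (m : nat) : Re t < 0 -> 0 <= y ->
  Cmod (zterm t y (S m)) <= Rpower (INR (S m)) (- (1 - Re t)).
Proof.
  intros Ht Hy. unfold zterm. rewrite Cmod_cpow, Re_minus_1.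
  replace (- (1 - Re t)) with (Re t - 1) by ring.
  assert (Hm : 0 < INR (S m)) by (apply lt_0_INR; lia). pose proof PI2_1.
  apply Rpower_le_base_neg; [exact Hm|nra|lra].
Qed.

Lemma asum_zterm (t : C) (y : R) : Re t < 0 -> 0 <= y -> asum (zterm t y).
Proof.
  intros Ht Hy. apply asum_cons. eapply asum_le; [intros m; apply zterm_bound; assumption|].
  apply ex_series_Rpower. lra.
Qed.

Definition Zt (t : C) (y : R) : C := tsum (zterm t y).
Definition T (t : C) (y : R) : C := (Zt t y + Zt t (2 * PI - y))%C.

Lemma cpow_half (t : C) (x : R) : 0 < x -> cpow (x / 2) (t - 1) = (cpow 2 (1 - t) * cpow x (t - 1))%C.
Proof.
  intros Hx. replace x with (2 * (x / 2)) at 2 by field. rewrite cpow_mult by lra.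
  rewrite Cmult_assoc, <- cpow_plus. replace (1 - t + (t - 1))%C with (RtoC 0) by ring.
  rewrite cpow_0. ring.
Qed.

Lemma Zt_dup (t : C) (y : R) : Re t < 0 -> 0 < y ->
  (Zt t (y / 2) + Zt t (y / 2 + PI))%C = (cpow 2 (1 - t) * Zt t y)%C.
Proof.
  intros Ht Hy. assert (HP := PI_RGT_0).
  assert (H0 := asum_tsum _ (asum_zterm t y Ht (Rlt_le _ _ Hy))).
  assert (H1 := asum_tsum _ (asum_zterm t (y / 2) Ht ltac:(lra))).
  assert (H2 := asum_tsum _ (asum_zterm t (y / 2 + PI) Ht ltac:(lra))).
  assert (E1 : forall m, zterm t (y / 2) m = (cpow 2 (1 - t) * zterm t y (2 * m))%C).
  { intros m. unfold zterm. rewrite <- cpow_half.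
    - f_equal. rewrite mult_INR. simpl (INR 2). field.
    - pose proof (pos_INR (2 * m)). nra. }
  assert (E2 : forall m, zterm t (y / 2 + PI) m = (cpow 2 (1 - t) * zterm t y (S (2 * m)))%C).
  { intros m. unfold zterm. rewrite <- cpow_half.
    - f_equal. rewrite S_INR, mult_INR. simpl (INR 2). field.
    - pose proof (pos_INR (S (2 * m))). nra. }
  assert (Hs := sums_plus _ _ _ _ H1 H2).
  apply (sums_unique _ _ _ Hs).
  assert (H3 := sums_scal (cpow 2 (1 - t)) _ _ H0).
  intros eps He. destruct (H3 eps He) as [N HN]. exists N. intros n Hn.
  replace (psum (fun n => zterm t (y / 2) n + zterm t (y / 2 + PI) n)%C n)
    with (psum (fun n => cpow 2 (1 - t) * zterm t y n)%C (2 * n)); [apply HN; lia|].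
  clear - E1 E2. induction n as [|n IH]; [reflexivity|].
  replace (2 * S n)%nat with (S (S (2 * n))) by lia. simpl psum at 1. simpl psum in IH.
  change (psum ?f (S n)) with (psum f n + f n)%C.
  replace (n + (n + 0))%nat with (2 * n)%nat in * by lia.
  rewrite E1, E2, <- IH. ring.
Qed.

Lemma T_near (t : C) : Re t < 0 -> exists K, forall y, 0 < y <= PI ->
  Cmod (T t y - cpow y (t - 1)) <= K.
Proof.
  intros Ht. set (S0 := Series (fun n => Rpower (INR (S n)) (- (1 - Re t)))).
  assert (HS := ex_series_Rpower (1 - Re t) ltac:(lra)).
  assert (Htail : forall y, 0 <= y -> Cmod (Zt t y - cpow y (t - 1)) <= S0).
  { intros y Hy. assert (H := sums_tail _ _ (asum_tsum _ (asum_zterm t y Ht Hy))).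
    replace (zterm t y 0) with (cpow y (t - 1)) in H.
    - eapply sums_Cmod_le; [exact H| |exact HS]. intros n. apply zterm_bound; assumption.
    - unfold zterm. f_equal. simpl. ring. }
  exists (S0 + (S0 + 1)). intros y Hy.
  replace (T t y - cpow y (t - 1))%C with ((Zt t y - cpow y (t - 1)) +
    ((Zt t (2 * PI - y) - cpow (2 * PI - y) (t - 1)) + cpow (2 * PI - y) (t - 1)))%C by (unfold T; ring).
  eapply Rle_trans; [apply Cmod_triangle|]. apply Rplus_le_compat; [apply Htail; lra|].
  eapply Rle_trans; [apply Cmod_triangle|]. apply Rplus_le_compat; [apply Htail; lra|].
  rewrite Cmod_cpow, Re_minus_1. pose proof PI2_1.
  apply Rle_trans with (Rpower 1 (Re t - 1)).
  - apply Rpower_le_base_neg; lra.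
  - unfold Rpower. rewrite ln_1, Rmult_0_r, exp_0. lra.
Qed.

(** Herglotz trick: the difference is bounded, and [Re t < 0] makes the duplication
    formula a contraction. *)
Lemma Hurwitz (t : C) : Re t < 0 ->
  exists c, forall y, 0 < y < 2 * PI -> G t y = (c * T t y)%C.
Proof.
  intros Ht. destruct (G_singular t Ht) as [c [K1 HG]]. destruct (T_near t Ht) as [K2 HT].
  assert (HP := PI_RGT_0).
  exists c. set (e := fun y => (G t y - c * T t y)%C).
  set (M := K1 + Cmod c * K2).
  assert (Hb1 : forall y, 0 < y <= PI -> Cmod (e y) <= M).
  { intros y Hy. unfold e. replace (G t y - c * T t y)%C
      with ((G t y - c * cpow y (t - 1)) + - (c * (T t y - cpow y (t - 1))))%C by ring.
    eapply Rle_trans; [apply Cmod_triangle|]. rewrite Cmod_opp, Cmod_mult.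
    apply Rplus_le_compat; [apply HG, Hy|]. apply Rmult_le_compat_l; [apply Cmod_ge_0|apply HT, Hy]. }
  assert (Hb : forall y, 0 < y < 2 * PI -> Cmod (e y) <= M).
  { intros y Hy. destruct (Rle_or_lt y PI) as [h|h]; [apply Hb1; lra|].
    replace (e y) with (e (2 * PI - y)); [apply Hb1; lra|].
    unfold e. rewrite G_sym. unfold T. replace (2 * PI - (2 * PI - y)) with y by ring. f_equal. ring. }
  assert (Hdup : forall y, 0 < y < 2 * PI -> (e (y / 2)%R + e (y / 2 + PI)%R)%C = (cpow 2 (1 - t) * e y)%C).
  { intros y Hy. assert (Hk := kubert_all t 2%nat y ltac:(lia) Hy). simpl psum in Hk.
    replace (grid 2 0 y) with (y / 2) in Hk by (unfold grid; simpl; field).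
    replace (grid 2 1 y) with (y / 2 + PI) in Hk by (unfold grid; simpl; field).
    simpl (INR 2) in Hk. replace (1 + 1) with 2 in Hk by ring.
    assert (H1 := Zt_dup t y Ht ltac:(lra)). assert (H2 := Zt_dup t (2 * PI - y) Ht ltac:(lra)).
    unfold e, T.
    replace (2 * PI - y / 2) with ((2 * PI - y) / 2 + PI) by field.
    replace (2 * PI - (y / 2 + PI)) with ((2 * PI - y) / 2) by field.
    transitivity (0 + G t (y / 2) + G t (y / 2 + PI)%R
      - c * ((Zt t (y / 2) + Zt t (y / 2 + PI)%R)
           + (Zt t ((2 * PI - y) / 2)%R + Zt t ((2 * PI - y) / 2 + PI)%R)))%C; [ring|].
    rewrite Hk, H1, H2. ring. }
  set (q := 2 * / Rpower 2 (1 - Re t)).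
  assert (Hr : 2 < Rpower 2 (1 - Re t)).
  { rewrite <- (Rpower_1 2) at 1 by lra. apply Rpower_lt; lra. }
  assert (Hq : 0 <= q < 1).
  { unfold q. assert (0 < / Rpower 2 (1 - Re t)) by (apply Rinv_0_lt_compat; lra). split; [lra|].
    apply (Rmult_lt_reg_r (Rpower 2 (1 - Re t))); [lra|]. rewrite Rmult_assoc, Rinv_l; lra. }
  assert (Hit : forall n y, 0 < y < 2 * PI -> Cmod (e y) <= q ^ n * M).
  { intros n. induction n as [|n IH]; intros y Hy; [simpl; rewrite Rmult_1_l; apply Hb, Hy|].
    assert (H := f_equal Cmod (Hdup y Hy)). rewrite Cmod_mult, Cmod_cpow, Re_1_minus in H.
    assert (H1 := IH (y / 2) ltac:(lra)). assert (H2 := IH (y / 2 + PI) ltac:(lra)).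
    assert (H3 := Cmod_triangle (e (y / 2)%R) (e (y / 2 + PI)%R)). rewrite H in H3.
    replace (q ^ S n * M) with (2 * (q ^ n * M) / Rpower 2 (1 - Re t)) by (unfold q; simpl; field; lra).
    apply Rle_div_r; lra. }
  intros y Hy. apply (Cmod_eps_eq _ _ M). intros eps He.
  destruct (pow_lt_1_zero q ltac:(rewrite Rabs_pos_eq; lra) eps He) as [n Hn].
  specialize (Hn n (le_n _)). rewrite Rabs_pos_eq in Hn by (apply pow_le; lra).
  eapply Rle_trans; [apply (Hit n y Hy)|]. rewrite Rmult_comm. apply Rmult_le_compat_l; [|lra].
  eapply Rle_trans; [apply Cmod_ge_0|apply (Hb PI); lra].
Qed.

Fixpoint rising (w : C) (j : nat) : C :=
  match j with O => RtoC 1 | S i => (rising w i * (w + RtoC (INR i)))%C end.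

Definition bc (w : C) (j : nat) : C := (rising w j / RtoC (INR (fact j)))%C.

Lemma INR_fact_C (n : nat) : RtoC (INR (fact n)) <> RtoC 0.
Proof. intros E. apply RtoC_inj in E. revert E. apply INR_fact_neq_0. Qed.

Lemma INR_S_C (n : nat) : RtoC (INR (S n)) <> RtoC 0.
Proof. intros E. apply RtoC_inj in E. revert E. apply not_0_INR. lia. Qed.

Lemma fact_S_C (n : nat) : RtoC (INR (fact (S n))) = (RtoC (INR (S n)) * RtoC (INR (fact n)))%C.
Proof. rewrite fact_simpl, mult_INR. apply RtoC_mult. Qed.

Lemma bc_S (w : C) (j : nat) : bc w (S j) = (bc w j * (w + RtoC (INR j)) / RtoC (INR (S j)))%C.
Proof.
  unfold bc. simpl rising. rewrite fact_S_C. field. split; [apply INR_fact_C|apply INR_S_C].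
Qed.

Lemma bounded_of_eventually_decr (u : nat -> R) (J : nat) :
  (forall j, (J <= j)%nat -> u (S j) <= u j) -> exists M, forall j, u j <= M.
Proof.
  intros H.
  assert (Hf : exists M, forall n, (n <= J)%nat -> u n <= M).
  { clear H. induction J as [|N [M IH]].
    - exists (u O). intros n Hn. assert (n = O) by lia. subst; lra.
    - exists (Rmax M (u (S N))). intros n Hn. destruct (Nat.eq_dec n (S N)) as [->|].
      + apply Rmax_r.
      + eapply Rle_trans; [apply IH; lia|apply Rmax_l]. }
  destruct Hf as [M HM]. exists M. intros j.
  destruct (Nat.le_gt_cases j J) as [h|h]; [apply HM, h|].
  replace j with (J + (j - J))%nat by lia. generalize (j - J)%nat. intros k.
  induction k as [|k IH]; [rewrite Nat.add_0_r; apply HM; lia|].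
  rewrite Nat.add_succ_r. eapply Rle_trans; [apply H; lia|exact IH].
Qed.

Lemma rad_bc (w : C) (rho : R) : 0 <= rho < 1 -> rad (bc w) rho.
Proof.
  intros Hr. destruct (nfloor_ex (rho * Cmod w / (1 - rho))) as [J [_ HJ]].
  { apply Rdiv_le_0_compat; [|lra]. apply Rmult_le_pos; [lra|apply Cmod_ge_0]. }
  apply bounded_of_eventually_decr with (S J). intros j Hj.
  assert (Hj1 : INR J + 1 <= INR j) by (rewrite <- S_INR; apply le_INR, Hj).
  assert (Hw : rho * Cmod w <= INR j * (1 - rho)).
  { apply (Rle_div_l _ _ (1 - rho)); lra. }
  assert (HS : 0 < INR (S j)) by (apply lt_0_INR; lia).
  rewrite bc_S, Cmod_div, Cmod_mult, Cmod_R, (Rabs_pos_eq (INR (S j))) by (lra || apply INR_S_C).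
  assert (Hwj : Cmod (w + RtoC (INR j)) <= Cmod w + INR j).
  { eapply Rle_trans; [apply Cmod_triangle|]. rewrite Cmod_R, Rabs_pos_eq by apply pos_INR. lra. }
  replace (Cmod (bc w j) * Cmod (w + RtoC (INR j)) / INR (S j) * rho ^ S j)
    with (Cmod (bc w j) * rho ^ j * (rho * Cmod (w + RtoC (INR j)) / INR (S j))) by (rewrite <- tech_pow_Rmult; field; lra).
  rewrite <- Rmult_1_r. apply Rmult_le_compat_l.
  - apply Rmult_le_pos; [apply Cmod_ge_0|apply pow_le; lra].
  - apply Rle_div_l; [exact HS|]. rewrite S_INR. nra.
Qed.

Lemma asum_bc (w : C) (x : R) : Rabs x < 1 -> asum (fun n => bc w n * RtoC x ^ n)%C.
Proof.
  intros Hx. pose proof (Rabs_pos x).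
  apply rad_asum with ((Rabs x + 1) / 2); [apply rad_bc; lra|]. rewrite Cmod_R. lra.
Qed.

Lemma rising_S_l (w : C) (j : nat) : rising w (S j) = (w * rising (w + 1) j)%C.
Proof.
  induction j as [|j IH]; [simpl; ring|].
  change (rising w (S (S j))) with (rising w (S j) * (w + RtoC (INR (S j))))%C. rewrite IH.
  simpl rising. rewrite S_INR, RtoC_plus. ring.
Qed.

Lemma binomial_series (w : C) (x : R) : Rabs x < 1 ->
  sums (fun n => bc w n * RtoC x ^ n)%C (cpow (1 - x) (- w)).
Proof.
  set (phi := fun v y => tsum (fun n => bc v n * RtoC y ^ n)%C).
  assert (Hphi : forall y, Rabs y < 1 -> ((1 - RtoC y) * phi (w + 1)%C y = phi w y)%C).
  { intros y Hy. symmetry. apply tsum_eq; [apply asum_bc, Hy|].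
    assert (H1 := asum_tsum _ (asum_bc (w + 1) y Hy)). fold (phi (w + 1)%C y) in H1.
    assert (H2 := sums_scal (RtoC y) _ _ H1).
    assert (H3 : sums (sh (fun n => RtoC y * (bc (w + 1) n * RtoC y ^ n))%C) (RtoC y * phi (w + 1)%C y)%C).
    { rewrite <- (Cplus_0_l (_ * _)). apply (sums_cons (sh _)). exact H2. }
    replace ((1 - RtoC y) * phi (w + 1)%C y)%C with (phi (w + 1)%C y - RtoC y * phi (w + 1)%C y)%C by ring.
    eapply sums_ext; [|apply sums_minus; [exact H1|exact H3]].
    intros n. cbv beta. destruct n as [|n]; simpl sh; [unfold bc; simpl; ring|].
    unfold bc. rewrite (rising_S_l w). simpl rising. rewrite fact_S_C, Cpow_S.
    rewrite S_INR, RtoC_plus. field. split; [apply INR_fact_C|].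
    rewrite <- RtoC_plus, <- S_INR. apply INR_S_C. }
  assert (Hd : forall y, Rabs y < 1 -> derC (phi w) y (w * phi (w + 1)%C y)%C).
  { intros y Hy. pose proof (Rabs_pos y).
    replace (w * phi (w + 1)%C y)%C with (tsum (fun n => RtoC (INR (S n)) * bc w (S n) * RtoC y ^ n)%C).
    - apply derC_pseries with ((Rabs y + 1) / 2); [apply rad_bc|]; lra.
    - assert (Eq : forall n, (w * (bc (w + 1) n * RtoC y ^ n) = RtoC (INR (S n)) * bc w (S n) * RtoC y ^ n)%C).
      { intros n. unfold bc. rewrite rising_S_l, fact_S_C. field. split; [apply INR_fact_C|apply INR_S_C]. }
      assert (Ha := asum_bc (w + 1) y Hy).
      apply tsum_eq.
      + eapply asum_le; [|apply (asum_scal w _ Ha)]. intros n. rewrite <- Eq. apply Rle_refl.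
      + eapply sums_ext; [exact Eq|]. apply sums_scal, asum_tsum, Ha. }
  assert (Hg : forall y, -1 < y < 1 -> derC (fun z => phi w z * cpow (1 - z) w)%C y (RtoC 0)).
  { intros y Hy. assert (Hy' : Rabs y < 1) by (apply Rabs_def1; lra).
    assert (Hc : derC (fun z => cpow (1 - z) w) y (RtoC (- (1)) * (w * cpow (1 - y) (w - 1)))%C).
    { apply (derC_comp (fun z => cpow z w) (fun z => 1 - z)); [apply derC_cpow; lra|].
      auto_derive; [trivial|ring]. }
    assert (H := derC_mult _ _ _ _ _ (Hd y Hy') Hc).
    match type of H with derC _ _ ?v => replace (RtoC 0) with v; [exact H|] end.
    rewrite <- (Hphi y Hy'). replace (cpow (1 - y) w) with (cpow (1 - y) (w - 1) * (1 - RtoC y))%C.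
    - rewrite RtoC_opp. ring.
    - rewrite <- RtoC_minus, <- (cpow_1 (1 - y)), <- cpow_plus by lra. f_equal. ring. }
  intros Hx. assert (Hx' : -1 < x < 1) by (apply Rabs_def2 in Hx; lra).
  assert (E0 := derC_zero_const_open _ (-1) 1 x 0 Hg Hx' ltac:(lra)). cbv beta in E0.
  replace (phi w 0) with (RtoC 1) in E0 by (unfold phi; rewrite tsum_pow_0; unfold bc; simpl; field).
  rewrite Rminus_0_r, cpow_base_1 in E0.
  replace (cpow (1 - x) (- w)) with (phi w x).
  - apply asum_tsum, asum_bc, Hx.
  - rewrite cpow_opp. assert (Hc := cpow_neq_0 (1 - x) w).
    replace (phi w x) with (phi w x * cpow (1 - x) w / cpow (1 - x) w)%C by (field; exact Hc).
    rewrite E0. field. exact Hc.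
Qed.

Lemma binomial_even (w : C) (x : R) : Rabs x < 1 ->
  sums (fun i => 2 * bc w (2 * i) * RtoC (x ^ (2 * i)))%C (cpow (1 + x) (- w) + cpow (1 - x) (- w))%C.
Proof.
  intros Hx.
  assert (H1 := binomial_series w x Hx).
  assert (H2 := binomial_series w (- x) ltac:(rewrite Rabs_Ropp; exact Hx)).
  replace (1 - - x) with (1 + x) in H2 by ring.
  assert (H3 := sums_plus _ _ _ _ H2 H1).
  apply (sums_multiples 2) in H3; [|lia|].
  - eapply sums_ext; [|exact H3]. intros i. cbv beta.
    rewrite !RtoC_pow_C. replace ((- x) ^ (2 * i)) with (x ^ (2 * i)); [ring|].
    rewrite !pow_mult. f_equal. ring.
  - intros n Hn.
    assert (Hodd : exists k, n = S (2 * k)).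
    { exists (n / 2)%nat. assert (H4 := Nat.div_mod n 2 ltac:(lia)).
      assert (H5 := Nat.mod_upper_bound n 2 ltac:(lia)). lia. }
    destruct Hodd as [k ->]. rewrite !RtoC_pow_C.
    replace ((- x) ^ S (2 * k)) with (- x ^ S (2 * k)); [rewrite RtoC_opp; ring|].
    rewrite <- !tech_pow_Rmult, !pow_mult. replace ((- x) ^ 2) with (x ^ 2) by ring. ring.
Qed.

Definition expn (t c : C) (p : nat -> C) : Prop := forall y, 0 < y < 2 * PI ->
  sums (fun i => p i * RtoC (y ^ (2 * i)))%C (G t y - c * cpow y (t - 1))%C.

Definition hcoef (zeta : C -> C) (t : C) (i : nat) : C :=
  (2 * bc (1 - t) (2 * i) * cpow (2 * PI) (- (1 - t + RtoC (INR (2 * i))))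
   * zeta (1 - t + RtoC (INR (2 * i))))%C.

Lemma T_expansion (zeta : C -> C) (t : C) (y : R) : is_riemann_zeta zeta -> Re t < 0 -> 0 < y < 2 * PI ->
  sums (fun i => hcoef zeta t i * RtoC (y ^ (2 * i)))%C (T t y - cpow y (t - 1))%C.
Proof.
  intros Hz Ht Hy. assert (HP := PI_RGT_0).
  set (w := (1 - t)%C). assert (Hw : Re w = 1 - Re t) by apply Re_1_minus.
  set (q := y / (2 * PI)). assert (Hq : 0 <= q < 1) by (apply quot_lt_1; lra).
  set (k2 := cpow (2 * PI) (- w)).
  set (u := fun m i => (k2 * 2 * bc w (2 * i) * RtoC (q ^ (2 * i)) * dir (w + RtoC (INR (2 * i))) 0 (S m))%C).
  set (rho := (q + 1) / 2). assert (Hrho : q < rho < 1) by (unfold rho; lra).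
  destruct (rad_bc w rho) as [M HM]; [lra|].
  assert (HM0 := rad_bound_pos _ _ _ HM).
  set (A := fun m => Rpower (INR (S m)) (- Re w)).
  set (B := fun i => Cmod k2 * 2 * M * ((q / rho) ^ 2) ^ i).
  assert (Hqr := quot_lt_1 q rho ltac:(lra) ltac:(lra)).
  assert (Hqr2 : 0 <= (q / rho) ^ 2 < 1) by (simpl; nra).
  assert (Hu : forall m i, Cmod (u m i) <= A m * B i).
  { intros m i. unfold u. rewrite !Cmod_mult, Cmod_dir, re_plus, re_RtoC.
    rewrite !Cmod_R, (Rabs_pos_eq 2), (Rabs_pos_eq (q ^ _)) by (try apply pow_le; lra).
    rewrite Rmult_comm. apply Rmult_le_compat.
    - apply Rlt_le, exp_pos.
    - repeat apply Rmult_le_pos; try apply Cmod_ge_0; try lra. apply pow_le; lra.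
    - apply Rpower_le_exponent; [|pose proof (pos_INR (2 * i)); lra]. rewrite S_INR. pose proof (pos_INR m); lra.
    - unfold B. rewrite Rmult_assoc, (Rmult_assoc (Cmod k2 * 2)). apply Rmult_le_compat_l.
      + pose proof (Cmod_ge_0 k2); lra.
      + rewrite <- pow_mult. assert (Hx := rad_term (bc w) rho M (RtoC q) (2 * i) ltac:(lra) (HM _)).
        rewrite Cmod_mult, Cmod_pow, Cmod_R, (Rabs_pos_eq q) in Hx by lra. exact Hx. }
  assert (HeA : ex_series A) by (apply ex_series_Rpower; lra).
  assert (HeB : ex_series B) by (apply ex_series_geom_scal, Hqr2).
  assert (HA0 : forall m, 0 <= A m) by (intros; apply Rlt_le, exp_pos).
  assert (HB0 : forall i, 0 <= B i).
  { intros i. apply Rmult_le_pos; [|apply pow_le; lra].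
    apply Rmult_le_pos; [pose proof (Cmod_ge_0 k2); lra|exact HM0]. }
  destruct (sums_swap u A B Hu HA0 HB0 HeA HeB) as [S1 [S2 S3]].
  assert (E1 : forall m, tsum (u m) = (cpow (y + 2 * PI * INR (S m)) (t - 1)
      + cpow (2 * PI - y + 2 * PI * INR m) (t - 1))%C).
  { intros m. assert (HS : 1 <= INR (S m)) by (rewrite S_INR; pose proof (pos_INR m); lra).
    set (d := 2 * PI * INR (S m)). assert (Hd : 0 < d) by (unfold d; nra).
    assert (Hx : 0 <= y / d < 1) by (apply quot_lt_1; [lra|unfold d; nra]).
    apply tsum_eq.
    { apply asum_le with (fun i => A m * B i); [apply Hu|].
      apply (ex_series_Rscal (A m) _ HeB). }
    replace (t - 1)%C with (- w)%C by (unfold w; ring).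
    replace (y + d) with (d * (1 + y / d)) by (field; lra).
    replace (2 * PI - y + 2 * PI * INR m) with (d * (1 - y / d)).
    2:{ replace (d * (1 - y / d)) with (d - y) by (field; lra). unfold d. rewrite S_INR. ring. }
    rewrite !cpow_mult, <- Cmult_plus_distr_l by lra.
    eapply sums_ext; [|apply sums_scal, (binomial_even w (y / d)); rewrite Rabs_pos_eq; lra].
    intros i. cbv beta. unfold u, dir. rewrite beta_0. unfold d at 1. rewrite cpow_mult by lra. fold k2.
    replace (y / d) with (q * / INR (S m)) by (unfold q, d; field; lra).
    rewrite Rpow_mult_distr, RtoC_mult, Copp_plus_distr, cpow_plus, (cpow_opp _ (RtoC (INR (2 * i)))),
      cpow_INR, pow_inv, RtoC_inv by (try apply pow_nonzero; lra). ring. }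
  assert (HT : sums (fun m => tsum (u m)) (T t y - cpow y (t - 1))%C).
  { assert (H1 := sums_tail _ _ (asum_tsum _ (asum_zterm t y Ht ltac:(lra)))).
    assert (H2 := asum_tsum _ (asum_zterm t (2 * PI - y) Ht ltac:(lra))).
    replace (T t y - cpow y (t - 1))%C with (tsum (zterm t y) - zterm t y 0 + tsum (zterm t (2 * PI - y)))%C.
    - eapply sums_ext; [|apply sums_plus; [exact H1|exact H2]].
      intros m. cbv beta. rewrite E1. reflexivity.
    - unfold T, Zt. replace (zterm t y 0) with (cpow y (t - 1)); [ring|].
      unfold zterm. f_equal. simpl. ring. }
  rewrite <- (tsum_eq _ _ S1 HT), S3.
  eapply sums_ext; [|apply asum_tsum, S2].
  intros i. cbv beta. apply tsum_eq.
  { apply asum_le with (fun m => B i * A m); [intros m; rewrite Rmult_comm; apply Hu|].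
    apply (ex_series_Rscal (B i) _ HeA). }
  unfold hcoef. fold w.
  assert (Hre : 1 < Re (w + RtoC (INR (2 * i)))) by (rewrite re_plus, re_RtoC; pose proof (pos_INR (2 * i)); lra).
  assert (H := sums_tail _ _ (zeta_sums zeta _ Hz Hre)). simpl dir in H at 2.
  match goal with |- sums _ ?v => replace v with
    (k2 * 2 * bc w (2 * i) * RtoC (q ^ (2 * i)) * (zeta (w + RtoC (INR (2 * i))) - 0))%C end.
  - apply sums_scal. exact H.
  - rewrite Copp_plus_distr, cpow_plus, (cpow_opp _ (RtoC (INR (2 * i)))), cpow_INR by lra. fold k2.
    unfold q, Rdiv. rewrite Rpow_mult_distr, pow_inv, RtoC_mult, RtoC_inv by (apply pow_nonzero; lra). ring.
Qed.

Lemma expansion_neg (zeta : C -> C) (t : C) : is_riemann_zeta zeta -> Re t < 0 ->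
  exists c, expn t c (fun i => c * hcoef zeta t i)%C.
Proof.
  intros Hz Ht. destruct (Hurwitz t Ht) as [c Hc]. exists c. intros y Hy. rewrite (Hc y Hy).
  replace (c * T t y - c * cpow y (t - 1))%C with (c * (T t y - cpow y (t - 1)))%C by ring.
  eapply sums_ext; [|apply sums_scal, (T_expansion zeta t y Hz Ht Hy)].
  intros i. cbv beta. ring.
Qed.


(** * Expansion at the origin *)

Lemma derC_one_sided_zero (f : R -> C) (l : C) (d : R) :
  derC f 0 l -> 0 < d -> (forall y, 0 < y < d -> f y = RtoC 0) -> f 0 = RtoC 0 /\ l = RtoC 0.
Proof.
  intros Hf Hd H0.
  assert (F0 : f 0 = RtoC 0).
  { apply (Cmod_eps_eq _ _ 1). intros eps He.
    destruct (derC_continuous _ _ _ Hf eps He) as [d' [Hd' Hc]].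
    set (y := Rmin d d' / 2). assert (0 < Rmin d d') by (apply Rmin_pos; assumption).
    pose proof (Rmin_l d d'). pose proof (Rmin_r d d').
    specialize (Hc y ltac:(rewrite Rminus_0_r, Rabs_pos_eq; unfold y; lra)).
    rewrite (H0 y) in Hc by (unfold y; lra). rewrite Cmod_minus_sym. lra. }
  split; [exact F0|].
  assert (Hp : forall g m, is_derive g 0 m -> g 0 = 0 -> (forall y, 0 < y < d -> g y = 0) -> m = 0).
  { intros g m Hg Hg0 Hgy. apply is_derive_Reals in Hg.
    apply Rabs_eq_0. apply Rle_antisym; [|apply Rabs_pos]. apply le_epsilon. intros eps He.
    destruct (Hg eps He) as [[d' Hd'] Hc]. simpl in Hc.
    set (h := Rmin d d' / 2). assert (0 < Rmin d d') by (apply Rmin_pos; assumption).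
    pose proof (Rmin_l d d'). pose proof (Rmin_r d d').
    specialize (Hc h ltac:(unfold h; lra) ltac:(rewrite Rabs_pos_eq; unfold h; lra)).
    rewrite Rplus_0_l, Hgy, Hg0 in Hc by (unfold h; lra).
    replace ((0 - 0) / h - m) with (- m) in Hc by (field; unfold h; lra).
    rewrite Rabs_Ropp in Hc. lra. }
  destruct Hf as [H1 H2]. apply injective_projections.
  - apply (Hp _ _ H1).
    + rewrite F0. reflexivity.
    + intros y Hy. rewrite (H0 y Hy). reflexivity.
  - apply (Hp _ _ H2).
    + rewrite F0. reflexivity.
    + intros y Hy. rewrite (H0 y Hy). reflexivity.
Qed.

Definition evens (p : nat -> C) (y : R) : C := tsum (fun i => p i * RtoC (y ^ 2) ^ i)%C.
Definition dcoef (p : nat -> C) (i : nat) : C := (RtoC (INR (S i)) * p (S i))%C.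

Lemma derC_evens (p : nat -> C) (rho y : R) : rad p rho -> y ^ 2 < rho ->
  derC (evens p) y (RtoC (2 * y) * evens (dcoef p) y)%C.
Proof.
  intros Hr Hy. unfold evens, dcoef.
  apply (derC_comp (fun v => tsum (fun i => p i * RtoC v ^ i)%C) (fun y => y ^ 2)).
  - apply derC_pseries with rho; [exact Hr|]. rewrite Rabs_pos_eq; [exact Hy|apply pow2_ge_0].
  - auto_derive; [trivial|ring].
Qed.

Lemma evens_sums (p : nat -> C) (rho y : R) : rad p rho -> y ^ 2 < rho ->
  sums (fun i => p i * RtoC (y ^ (2 * i)))%C (evens p y).
Proof.
  intros Hr Hy. apply sums_ext with (fun i => p i * RtoC (y ^ 2) ^ i)%C.
  - intros i. rewrite RtoC_pow_C, <- pow_mult. reflexivity.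
  - apply asum_tsum, rad_asum with rho; [exact Hr|]. rewrite Cmod_R, Rabs_pos_eq; [exact Hy|apply pow2_ge_0].
Qed.

Lemma even_sums_rad (p : nat -> C) (r : R) (l : C) :
  0 < r -> sums (fun i => p i * RtoC (r ^ (2 * i)))%C l -> rad p (r ^ 2).
Proof.
  intros Hr H. apply sums_rad with l; [apply pow2_ge_0|].
  eapply sums_ext; [|exact H]. intros i. cbv beta. rewrite RtoC_pow_C, <- pow_mult. reflexivity.
Qed.

Lemma rad_all_0_2PI (p : nat -> C) (f : R -> C) :
  (forall y, 0 < y < 2 * PI -> sums (fun i => p i * RtoC (y ^ (2 * i)))%C (f y)) ->
  forall y, 0 <= y < 2 * PI -> exists rho, rad p rho /\ y ^ 2 < rho.
Proof.
  intros H y Hy. assert (HP := PI_RGT_0). exists (((y + 2 * PI) / 2) ^ 2). split.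
  - eapply even_sums_rad; [|apply H]; lra.
  - nra.
Qed.

Lemma evens_0 (p : nat -> C) : evens p 0 = p O.
Proof. unfold evens. replace (0 ^ 2) with 0 by ring. apply tsum_pow_0. Qed.

Lemma rad_dom (p q : nat -> C) (rho : R) : 0 <= rho ->
  (forall i, Cmod (q i) <= Cmod (p i)) -> rad p rho -> rad q rho.
Proof.
  intros Hr H [M HM]. exists M. intros n. eapply Rle_trans; [|apply HM].
  apply Rmult_le_compat_r; [now apply pow_le|apply H].
Qed.

Lemma rad_tail (p : nat -> C) (rho : R) : 0 < rho -> rad p rho -> rad (fun i => p (S i)) rho.
Proof.
  intros Hr [M HM]. exists (M / rho). intros n. apply (proj1 (Rle_div_r _ _ rho Hr)).
  eapply Rle_trans; [|apply (HM (S n))]. right. simpl. ring.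
Qed.

Lemma rad_cons (p : nat -> C) (rho : R) : 0 < rho -> rad (fun i => p (S i)) rho -> rad p rho.
Proof.
  intros Hr [M HM]. exists (Rmax (Cmod (p O)) (M * rho)). intros [|n].
  - simpl. rewrite Rmult_1_r. apply Rmax_l.
  - eapply Rle_trans; [|apply Rmax_r]. specialize (HM n). simpl.
    replace (Cmod (p (S n)) * (rho * rho ^ n)) with (Cmod (p (S n)) * rho ^ n * rho) by ring.
    apply Rmult_le_compat_r; lra.
Qed.

Definition primitive2 (p : nat -> C) (i : nat) : C :=
  match i with O => RtoC 0 | S k => (p k / (RtoC (INR (2 * k + 1)) * RtoC (INR (2 * k + 2))))%C end.

Lemma INR_pos_C (n : nat) : (0 < n)%nat -> RtoC (INR n) <> RtoC 0.
Proof. intros H E. apply RtoC_inj in E. revert E. apply not_0_INR. lia. Qed.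

Lemma dcoef_primitive2 (p : nat -> C) (i : nat) :
  dcoef (primitive2 p) i = (p i / (2 * RtoC (INR (2 * i + 1))))%C.
Proof.
  unfold dcoef, primitive2. replace (2 * i + 2)%nat with (2 * S i)%nat by lia.
  rewrite (mult_INR 2 (S i)), RtoC_mult. simpl (INR 2).
  replace (RtoC (1 + 1)) with (RtoC 2) by (f_equal; ring).
  field. split; [apply INR_pos_C; lia|apply INR_S_C].
Qed.

Lemma Cmod_div_le (a b : C) : 1 <= Cmod b -> Cmod (a / b) <= Cmod a.
Proof.
  intros Hb. assert (b <> RtoC 0) by (apply Cmod_gt_0; lra).
  rewrite Cmod_div by assumption. apply Rle_div_l; [lra|]. pose proof (Cmod_ge_0 a). nra.
Qed.

Lemma Cmod_INR (n : nat) : Cmod (RtoC (INR n)) = INR n.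
Proof. rewrite Cmod_R. apply Rabs_pos_eq, pos_INR. Qed.

Lemma primitive2_spec (p : nat -> C) (rho y : R) : 0 < rho -> rad p rho -> y ^ 2 < rho ->
  rad (primitive2 p) rho /\
  derC (evens (primitive2 p)) y (RtoC (2 * y) * evens (dcoef (primitive2 p)) y)%C /\
  derC (fun x => RtoC (2 * x) * evens (dcoef (primitive2 p)) x)%C y (evens p y).
Proof.
  intros Hr Hp Hy. set (r := primitive2 p). set (r1 := dcoef r).
  assert (Hodd : forall i, 1 <= INR (2 * i + 1)).
  { intros i. rewrite plus_INR. simpl (INR 1). pose proof (pos_INR (2 * i)); lra. }
  assert (R0 : rad r rho).
  { apply rad_cons; [exact Hr|]. apply rad_dom with p; [lra| |exact Hp].
    intros i. apply Cmod_div_le. rewrite Cmod_mult, !Cmod_INR. pose proof (Hodd i).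
    assert (1 <= INR (2 * i + 2)) by (rewrite plus_INR; simpl (INR 2); pose proof (pos_INR (2 * i)); lra). nra. }
  assert (R1 : rad r1 rho).
  { apply rad_dom with p; [lra| |exact Hp]. intros i. unfold r1, r. rewrite dcoef_primitive2.
    apply Cmod_div_le. rewrite Cmod_mult, Cmod_INR, Cmod_R, Rabs_pos_eq by lra. pose proof (Hodd i). lra. }
  assert (R2 : rad (dcoef r1) rho).
  { apply rad_dom with (fun i => p (S i)); [lra| |apply rad_tail; assumption].
    intros i. unfold dcoef at 1. unfold r1, r. rewrite dcoef_primitive2.
    replace (RtoC (INR (S i)) * (p (S i) / (2 * RtoC (INR (2 * S i + 1)))))%C
      with (p (S i) / (2 * RtoC (INR (2 * S i + 1)) / RtoC (INR (S i))))%C.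
    2:{ field. repeat split; try apply INR_S_C; apply INR_pos_C; lia. }
    apply Cmod_div_le. rewrite Cmod_div, Cmod_mult, !Cmod_INR, Cmod_R, Rabs_pos_eq by (lra || apply INR_S_C).
    assert (0 < INR (S i)) by (apply lt_0_INR; lia).
    apply Rle_div_r; [lra|]. rewrite plus_INR, mult_INR. simpl (INR 2). simpl (INR 1). lra. }
  split; [exact R0|]. split; [apply derC_evens with rho; assumption|].
  assert (H1 : derC (fun x => RtoC (2 * x)) y (RtoC 2)).
  { apply derC_RtoC. auto_derive; [trivial|ring]. }
  assert (H := derC_mult _ _ _ _ _ H1 (derC_evens r1 rho y R1 Hy)).
  match type of H with derC _ _ ?v => replace (evens p y) with v; [exact H|] end.
  assert (Hy' : Cmod (RtoC (y ^ 2)) < rho) by (rewrite Cmod_R, Rabs_pos_eq; [exact Hy|apply pow2_ge_0]).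
  symmetry. apply tsum_eq; [apply rad_asum with rho; assumption|].
  assert (S1 := asum_tsum _ (rad_asum _ _ _ R1 Hy')). fold (evens r1 y) in S1.
  assert (S2 := asum_tsum _ (rad_asum _ _ _ R2 Hy')). fold (evens (dcoef r1) y) in S2.
  assert (S3 : sums (fun i => 4 * RtoC (INR i) * r1 i * RtoC (y ^ 2) ^ i)%C
                 (4 * RtoC (y ^ 2) * evens (dcoef r1) y)%C).
  { replace (4 * RtoC (y ^ 2) * evens (dcoef r1) y)%C
      with (4 * RtoC (INR 0) * r1 O * RtoC (y ^ 2) ^ 0 + 4 * RtoC (y ^ 2) * evens (dcoef r1) y)%C
      by (simpl; ring).
    apply (sums_cons (fun i => 4 * RtoC (INR i) * r1 i * RtoC (y ^ 2) ^ i)%C).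
    eapply sums_ext; [|apply sums_scal, S2]. intros i. cbv beta. unfold dcoef at 1. rewrite Cpow_S. ring. }
  replace (RtoC 2 * evens r1 y + RtoC (2 * y) * (RtoC (2 * y) * evens (dcoef r1) y))%C
    with (2 * evens r1 y + 4 * RtoC (y ^ 2) * evens (dcoef r1) y)%C.
  2:{ simpl pow. rewrite !RtoC_mult. ring. }
  eapply sums_ext; [|apply sums_plus; [apply sums_scal, S1|exact S3]].
  intros i. cbv beta. unfold r1, r. rewrite dcoef_primitive2.
  rewrite plus_INR, mult_INR, RtoC_plus, RtoC_mult. simpl (INR 2). simpl (INR 1).
  replace (RtoC (1 + 1)) with (RtoC 2) by (f_equal; ring).
  field. cbv beta. rewrite <- RtoC_mult, <- RtoC_plus. intros E1. apply RtoC_inj in E1. pose proof (pos_INR i). lra.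
Qed.

Lemma G'_PI (t : C) : G' t PI = RtoC 0.
Proof. unfold G'. replace (2 * PI - PI) with PI by ring. field. Qed.

(** Compare both sides of the duplication formula as [y -> 0+]. *)
Lemma constant_term (zeta : C -> C) (t c b : C) (p : nat -> C) :
  is_riemann_zeta zeta -> Re t <> 1 -> Re t <> 2 ->
  (forall y, 0 < y < 2 * PI ->
     sums (fun i => p i * RtoC (y ^ (2 * i)))%C (G t y - c * cpow y (t - 1) - b * RtoC y)%C) ->
  p O = zeta t /\ b = RtoC 0.
Proof.
  intros Hz Ht1 Ht2 H. assert (HP := PI_RGT_0).
  assert (Hrad := rad_all_0_2PI p _ H).
  assert (Hev : forall y, 0 < y < 2 * PI -> evens p y = (G t y - c * cpow y (t - 1) - b * RtoC y)%C).
  { intros y Hy. destruct (Hrad y ltac:(lra)) as [rho [R1 R2]].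
    exact (sums_unique _ _ _ (evens_sums p rho y R1 R2) (H y Hy)). }
  set (k := cpow 2 (1 - t)).
  set (f := fun y => (b / 2 * RtoC y + evens p (y * / 2) + G t (y * / 2 + PI)%R
                      - k * (b * RtoC y + evens p y))%C).
  assert (Hf : forall y, 0 < y < 2 * PI -> f y = RtoC 0).
  { intros y Hy. unfold f. rewrite (Hev (y * / 2)), (Hev y) by lra.
    assert (Hk := kubert_all t 2%nat y ltac:(lia) Hy). simpl psum in Hk.
    replace (grid 2 0 y) with (y * / 2) in Hk by (unfold grid; simpl; field).
    replace (grid 2 1 y) with (y * / 2 + PI) in Hk by (unfold grid; simpl; field).
    simpl (INR 2) in Hk. replace (1 + 1) with 2 in Hk by ring. fold k in Hk.
    assert (Hc := cpow_half t y ltac:(lra)). fold k in Hc. unfold Rdiv in Hc. rewrite Hc.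
    transitivity (0 + G t (y * / 2)%R + G t (y * / 2 + PI)%R - k * G t y
      + b * (RtoC y / 2 - RtoC (y * / 2)%R))%C; [field|].
    rewrite Hk, RtoC_mult, RtoC_inv by lra. field. }
  destruct (Hrad 0 ltac:(lra)) as [rho [R1 R2]].
  assert (De : derC (evens p) 0 (RtoC 0)).
  { assert (D := derC_evens p rho 0 R1 R2). rewrite Rmult_0_r, Cmult_0_l in D. exact D. }
  assert (Dh : is_derive (fun y : R => y * / 2) 0 (/ 2)) by (auto_derive; [trivial|ring]).
  assert (Did : derC (fun y : R => RtoC y) 0 (RtoC 1)).
  { apply (derC_RtoC (fun y => y)), (is_derive_id (K := R_AbsRing)). }
  assert (D1 : derC (fun y => evens p (y * / 2)) 0 (RtoC (/ 2) * RtoC 0)%C).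
  { apply (derC_comp (evens p) (fun y => y * / 2)); [|exact Dh]. rewrite Rmult_0_l. exact De. }
  assert (D2 : derC (fun y => G t (y * / 2 + PI)) 0 (RtoC (/ 2) * RtoC 0)%C).
  { apply (derC_comp (G t) (fun y => y * / 2 + PI)).
    - rewrite Rmult_0_l, Rplus_0_l, <- (G'_PI t). apply derC_G. lra.
    - auto_derive; [trivial|ring]. }
  assert (Df := derC_minus _ _ _ _ _
    (derC_plus _ _ _ _ _ (derC_plus _ _ _ _ _ (derC_scal (b / 2) _ _ _ Did) D1) D2)
    (derC_scal k _ _ _ (derC_plus _ _ _ _ _ (derC_scal b _ _ _ Did) De))).
  destruct (derC_one_sided_zero f _ (2 * PI) Df ltac:(lra) Hf) as [F0 F1].
  assert (Hk1 : forall e : R, Re t <> e -> (1 <= e)%R -> k <> RtoC (Rpower 2 (1 - e))).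
  { intros e He _ E1. apply (f_equal Cmod) in E1. unfold k in E1.
    rewrite Cmod_cpow, Re_1_minus, Cmod_R, Rabs_pos_eq in E1 by (apply Rlt_le, exp_pos).
    unfold Rpower in E1. apply exp_inv in E1. apply Rmult_eq_reg_r in E1; [lra|].
    assert (0 < ln 2); [|lra]. rewrite <- ln_1. apply ln_increasing; lra. }
  split.
  - unfold f in F0. rewrite Rmult_0_l, Rplus_0_l, evens_0 in F0.
    rewrite (zeta_G_PI zeta t Hz) in F0 by (intros E1; apply Ht1; rewrite E1; reflexivity). fold k in F0.
    assert (Hk : (1 - k)%C <> RtoC 0).
    { intros E1. apply Ceq_minus in E1. apply (Hk1 1 Ht1 (Rle_refl _)). rewrite <- E1.
      rewrite Rminus_diag, Rpower_O by lra. reflexivity. }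
    assert (E1 : ((1 - k) * (p O - zeta t))%C = RtoC 0) by (rewrite <- F0; ring).
    apply Ceq_minus. replace (p O - zeta t)%C with (/ (1 - k) * ((1 - k) * (p O - zeta t)))%C by (field; exact Hk).
    rewrite E1. ring.
  - assert (Hk : (1 / 2 - k)%C <> RtoC 0).
    { intros E1. apply Ceq_minus in E1. apply (Hk1 2 Ht2 ltac:(lra)). rewrite <- E1.
      replace (1 - 2) with (- (1)) by ring. rewrite Rpower_Ropp, Rpower_1, RtoC_inv by lra. field. }
    assert (E1 : ((1 / 2 - k) * b)%C = RtoC 0) by (rewrite <- F1; field).
    replace b with (/ (1 / 2 - k) * ((1 / 2 - k) * b))%C by (rewrite Cmult_assoc, Cinv_l by exact Hk; ring).
    rewrite E1. ring.
Qed.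

Lemma expansion_up (zeta : C -> C) (t c : C) (p : nat -> C) :
  is_riemann_zeta zeta -> Re t <> 1 -> Re t <> 2 -> expn (t - 2) c p ->
  expn t (- (c / ((t - 1) * (t - 2))))
    (fun i => match i with O => zeta t | S _ => (- primitive2 p i)%C end).
Proof.
  intros Hz Ht1 Ht2 H. assert (HP := PI_RGT_0).
  assert (Hrad := rad_all_0_2PI p _ H).
  set (c' := (- (c / ((t - 1) * (t - 2))))%C).
  assert (N1 : (t - 1)%C <> RtoC 0).
  { intros E1. apply Ht1. apply Ceq_minus in E1. rewrite E1. reflexivity. }
  assert (N2 : (t - 2)%C <> RtoC 0).
  { intros E1. apply Ht2. apply Ceq_minus in E1. rewrite E1. reflexivity. }
  assert (Hspec : forall y, 0 <= y < 2 * PI ->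
    derC (evens (primitive2 p)) y (RtoC (2 * y) * evens (dcoef (primitive2 p)) y)%C /\
    derC (fun x => RtoC (2 * x) * evens (dcoef (primitive2 p)) x)%C y (evens p y)).
  { intros y Hy. destruct (Hrad y Hy) as [rho [R1 R2]].
    apply (primitive2_spec p rho y); [pose proof (pow2_ge_0 y); lra|exact R1|exact R2]. }
  set (W1 := fun y => (RtoC (2 * y) * evens (dcoef (primitive2 p)) y)%C).
  set (D1 := fun y => (G' t y - c' * ((t - 1) * cpow y (t - 1 - 1)) + W1 y)%C).
  assert (HD1 : forall y, 0 < y < 2 * PI -> derC D1 y (RtoC 0)).
  { intros y Hy. destruct (Hrad y ltac:(lra)) as [rho [R1 R2]].
    assert (Hv := sums_unique _ _ _ (evens_sums p rho y R1 R2) (H y Hy)).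
    assert (Hd := derC_plus _ _ _ _ _ (derC_minus _ _ _ _ _ (derC_G' t y Hy)
      (derC_scal c' _ _ _ (derC_scal (t - 1) _ _ _ (derC_cpow (t - 1 - 1) y ltac:(lra)))))
      (proj2 (Hspec y ltac:(lra)))).
    match type of Hd with derC _ _ ?v => replace (RtoC 0) with v; [exact Hd|] end.
    rewrite Hv. replace (t - 1 - 1 - 1)%C with (t - 2 - 1)%C by ring.
    replace (t - 1 - 1)%C with (t - 2)%C by ring. unfold c'. field. split; assumption. }
  set (b := D1 PI).
  set (D0 := fun y => (G t y - c' * cpow y (t - 1) + evens (primitive2 p) y - b * RtoC y)%C).
  assert (HD0 : forall y, 0 < y < 2 * PI -> derC D0 y (RtoC 0)).
  { intros y Hy.
    assert (Hb : D1 y = b) by (apply (derC_zero_const_open D1 0 (2 * PI) y PI HD1); lra).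
    assert (Did : derC (fun x : R => RtoC x) y (RtoC 1)).
    { apply (derC_RtoC (fun x => x)), (is_derive_id (K := R_AbsRing)). }
    assert (Hd := derC_minus _ _ _ _ _ (derC_plus _ _ _ _ _ (derC_minus _ _ _ _ _ (derC_G t y Hy)
      (derC_scal c' _ _ _ (derC_cpow (t - 1) y ltac:(lra)))) (proj1 (Hspec y ltac:(lra))))
      (derC_scal b _ _ _ Did)).
    match type of Hd with derC _ _ ?v => replace (RtoC 0) with v; [exact Hd|] end.
    rewrite <- Hb. unfold D1, W1. ring. }
  set (a := D0 PI).
  set (p' := fun i => match i with O => a | S _ => (- primitive2 p i)%C end).
  assert (H' : forall y, 0 < y < 2 * PI ->
     sums (fun i => p' i * RtoC (y ^ (2 * i)))%C (G t y - c' * cpow y (t - 1) - b * RtoC y)%C).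
  { intros y Hy.
    assert (Ha : D0 y = a) by (apply (derC_zero_const_open D0 0 (2 * PI) y PI HD0); lra).
    destruct (Hrad y ltac:(lra)) as [rho [R1 R2]].
    destruct (primitive2_spec p rho y) as [R3 _]; [pose proof (pow2_ge_0 y); lra|exact R1|exact R2|].
    assert (Hs := sums_tail _ _ (sums_scal (- (1)) _ _ (evens_sums _ rho y R3 R2))).
    replace (G t y - c' * cpow y (t - 1) - b * RtoC y)%C
      with (p' O * RtoC (y ^ (2 * 0)) + (- (1) * evens (primitive2 p) y
        - - (1) * (primitive2 p O * RtoC (y ^ (2 * 0)))))%C.
    - apply (sums_cons (fun i => p' i * RtoC (y ^ (2 * i)))%C).
      eapply sums_ext; [|exact Hs]. intros i. cbv beta. unfold p'. ring.
    - unfold p'. rewrite <- Ha. unfold D0. simpl. ring. }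
  destruct (constant_term zeta t c' b p' Hz Ht1 Ht2 H') as [Ea Eb].
  intros y Hy. specialize (H' y Hy). rewrite Eb in H'.
  replace (G t y - c' * cpow y (t - 1) - 0 * RtoC y)%C with (G t y - c' * cpow y (t - 1))%C in H' by ring.
  eapply sums_ext; [|exact H']. intros i. cbv beta. destruct i; [|reflexivity].
  simpl in Ea. unfold p'. rewrite Ea. reflexivity.
Qed.

Lemma expn_unique (t c c' : C) (p p' : nat -> C) : Re t < 0 ->
  expn t c p -> expn t c' p' -> forall i, p i = p' i.
Proof.
  intros Ht H H'. assert (HP := PI_RGT_0).
  set (d := fun i => (p i - p' i)%C).
  assert (Hd : forall y, 0 < y < 2 * PI ->
    sums (fun i => d i * RtoC (y ^ (2 * i)))%C ((c' - c) * cpow y (t - 1))%C).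
  { intros y Hy. replace ((c' - c) * cpow y (t - 1))%C
      with ((G t y - c * cpow y (t - 1)) - (G t y - c' * cpow y (t - 1)))%C by ring.
    eapply sums_ext; [|apply sums_minus; [apply H, Hy|apply H', Hy]].
    intros i. cbv beta. unfold d. ring. }
  assert (Hrad := rad_all_0_2PI d _ Hd).
  destruct (Hrad 1 ltac:(pose proof PI2_1; lra)) as [rho [R1 R2]].
  assert (R1' := R1). destruct R1 as [M HM].
  assert (HM0 := rad_bound_pos _ _ _ HM).
  assert (Hrho : 1 < rho) by (simpl in R2; lra).
  assert (Hq : 0 <= / rho < 1).
  { pose proof (quot_lt_1 1 rho ltac:(lra) Hrho). unfold Rdiv in *. lra. }
  assert (Hcc : c' = c).
  { apply (Cmod_eps_eq _ _ (M * / (1 - / rho))). intros eps He.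
    set (y := Rmin eps 1). assert (Hy : 0 < y <= 1) by (split; [apply Rmin_pos; lra|apply Rmin_r]).
    assert (Hs := Hd y ltac:(pose proof PI2_1; lra)).
    assert (Hb : Cmod ((c' - c) * cpow y (t - 1)) <= M * / (1 - / rho)).
    { rewrite <- Series_geom_scal by exact Hq.
      eapply sums_Cmod_le; [exact Hs| |apply ex_series_geom_scal, Hq].
      intros i. cbv beta. rewrite pow_mult, RtoC_pow.
      eapply Rle_trans; [apply (rad_term d rho M); [lra|apply HM]|].
      apply Rmult_le_compat_l; [exact HM0|]. apply pow_incr.
      rewrite Cmod_R, Rabs_pos_eq by apply pow2_ge_0. unfold Rdiv.
      split; [apply Rmult_le_pos; [apply pow2_ge_0|lra]|].
      rewrite <- (Rmult_1_l (/ rho)) at 2. apply Rmult_le_compat_r; [lra|]. simpl; nra. }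
    rewrite Cmod_mult, Cmod_cpow, Re_minus_1 in Hb.
    assert (Hp : / y <= Rpower y (Re t - 1)).
    { rewrite <- (Rpower_1 y) at 1 by lra. rewrite <- Rpower_Ropp. unfold Rpower.
      assert (ln y <= 0) by (rewrite <- ln_1; apply ln_le; lra).
      apply exp_monotone. nra. }
    assert (Hm := Cmod_ge_0 (c' - c)).
    assert (Hcy : Cmod (c' - c) * / y <= M * / (1 - / rho)).
    { eapply Rle_trans; [apply Rmult_le_compat_l; [exact Hm|exact Hp]|exact Hb]. }
    assert (Hx : Cmod (c' - c) <= M * / (1 - / rho) * y).
    { apply (Rle_div_l _ _ y); [lra|]. exact Hcy. }
    eapply Rle_trans; [exact Hx|]. apply Rmult_le_compat_l; [|apply Rmin_l].
    apply Rmult_le_pos; [exact HM0|]. apply Rlt_le, Rinv_0_lt_compat; lra. }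
  assert (Hd0 : forall i, d i = RtoC 0).
  { apply pseries_coef_0 with rho; [lra|exact R1'|]. intros eps He.
    set (y := Rmin (eps / 2) 1).
    assert (Hy : 0 < y <= 1) by (split; [apply Rmin_pos; lra|apply Rmin_r]).
    assert (Hye : y <= eps / 2) by apply Rmin_l.
    exists (RtoC (y ^ 2)). split; [|split].
    - intros E1. apply RtoC_inj in E1. nra.
    - rewrite Cmod_R, Rabs_pos_eq by apply pow2_ge_0. nra.
    - assert (Hs := Hd y ltac:(pose proof PI2_1; lra)). rewrite Hcc in Hs.
      replace ((c - c) * cpow y (t - 1))%C with (RtoC 0) in Hs by ring.
      eapply sums_ext; [|exact Hs]. intros i. cbv beta. rewrite RtoC_pow_C, <- pow_mult. reflexivity. }
  intros i. apply Ceq_minus, Hd0.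
Qed.

Definition zc (zeta : C -> C) (t : C) (i : nat) : C :=
  ((- (1)) ^ i * zeta (t - RtoC (INR (2 * i))) / RtoC (INR (fact (2 * i))))%C.

Lemma zc_0 (zeta : C -> C) (t : C) : zc zeta t 0 = zeta t.
Proof. unfold zc. simpl. replace (t - 0)%C with t by ring. field. Qed.

Lemma zc_S (zeta : C -> C) (t : C) (i : nat) :
  zc zeta t (S i) = (- primitive2 (zc zeta (t - 2)) (S i))%C.
Proof.
  unfold zc, primitive2. replace (2 * S i)%nat with (S (S (2 * i))) by lia.
  rewrite !fact_S_C, Cpow_S.
  replace (2 * i + 1)%nat with (S (2 * i)) by lia. replace (2 * i + 2)%nat with (S (S (2 * i))) by lia.
  replace (t - RtoC (INR (S (S (2 * i)))))%C with (t - 2 - RtoC (INR (2 * i)))%C.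
  - field. repeat split; try apply INR_fact_C; apply INR_S_C.
  - rewrite !S_INR, !RtoC_plus. ring.
Qed.

(** Integrating the expansion at [t - 2] twice and comparing with the one at [t]
    identifies the coefficients coming from Hurwitz's formula. *)
Lemma expn_neg_coef (zeta : C -> C) : is_riemann_zeta zeta ->
  forall i t c p, Re t < 0 -> expn t c p -> p i = zc zeta t i.
Proof.
  intros Hz i. induction i as [|i IH]; intros t c p Ht Hp.
  - rewrite zc_0. apply (constant_term zeta t c (RtoC 0) p Hz); [lra|lra|].
    intros y Hy. replace (G t y - c * cpow y (t - 1) - 0 * RtoC y)%C with (G t y - c * cpow y (t - 1))%C by ring.
    apply Hp, Hy.
  - assert (Ht2 : Re (t - 2) < 0) by (unfold Cminus; rewrite re_plus, re_opp, re_RtoC; lra).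
    destruct (expansion_neg zeta (t - 2) Hz Ht2) as [c0 H0].
    assert (Hu := expansion_up zeta t _ _ Hz ltac:(lra) ltac:(lra) H0).
    rewrite (expn_unique t _ _ _ _ Ht Hp Hu (S i)). rewrite zc_S.
    simpl. rewrite <- (IH (t - 2)%C _ _ Ht2 H0). reflexivity.
Qed.

Lemma Re_minus_2 (t : C) : Re (t - 2) = Re t - 2.
Proof. unfold Cminus. rewrite re_plus, re_opp, re_RtoC. ring. Qed.

Lemma expn_ext (t c : C) (p q : nat -> C) : (forall i, p i = q i) -> expn t c p -> expn t c q.
Proof. intros E1 H y Hy. eapply sums_ext; [|apply H, Hy]. intros i. cbv beta. now rewrite E1. Qed.

Lemma expansion_up_zc (zeta : C -> C) (t c : C) : is_riemann_zeta zeta -> Re t <> 1 -> Re t <> 2 ->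
  expn (t - 2) c (zc zeta (t - 2)) -> expn t (- (c / ((t - 1) * (t - 2)))) (zc zeta t).
Proof.
  intros Hz H1 H2 H. eapply expn_ext; [|apply (expansion_up zeta t c _ Hz H1 H2 H)].
  intros [|i]; cbv beta; [symmetry; apply zc_0|symmetry; apply zc_S].
Qed.

Definition noninteger (x : R) : Prop := forall n : Z, x <> IZR n.

Lemma expansion_generic (zeta : C -> C) (t : C) : is_riemann_zeta zeta -> noninteger (Re t) ->
  exists c, expn t c (zc zeta t).
Proof.
  intros Hz.
  assert (H : forall n t, noninteger (Re t) -> Re t < 2 * INR n -> exists c, expn t c (zc zeta t)).
  { intros n. induction n as [|n IH]; intros u Hu Hlt.
    - simpl in Hlt. destruct (expansion_neg zeta u Hz ltac:(lra)) as [c Hc].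
      exists c. eapply expn_ext; [|exact Hc]. intros i. apply (expn_neg_coef zeta Hz i u c _ ltac:(lra) Hc).
    - destruct (IH (u - 2)%C) as [c Hc].
      + rewrite Re_minus_2. intros m E1. apply (Hu (m + 2)%Z). rewrite plus_IZR. lra.
      + rewrite Re_minus_2. rewrite S_INR in Hlt. lra.
      + eexists. apply (expansion_up_zc zeta u c Hz); [apply (Hu 1%Z)|apply (Hu 2%Z)|exact Hc]. }
  intros Ht. destruct (nfloor_ex (Rabs (Re t)) (Rabs_pos _)) as [n [_ Hn]].
  apply (H (S n) t Ht). pose proof (Rle_abs (Re t)). rewrite S_INR. pose proof (pos_INR n). lra.
Qed.

Lemma generic_identity (zeta : C -> C) (s : C) (y : R) : is_riemann_zeta zeta ->
  noninteger (Re s) -> 0 < y < 2 * PI ->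
  sums (zeta_cos_term zeta s y) (s * (s - 1) * G (s + 1) y + RtoC (y ^ 2) * G (s - 1) y)%C.
Proof.
  intros Hz Hs Hy.
  destruct (expansion_generic zeta (s - 1) Hz) as [c Hc].
  { rewrite Re_minus_1. intros m E1. apply (Hs (m + 1)%Z). rewrite plus_IZR. lra. }
  assert (Hre : Re (s + 1) = Re s + 1) by (rewrite re_plus, re_RtoC; ring).
  assert (Es : (s + 1 - 2)%C = (s - 1)%C) by ring.
  assert (Hu := expansion_up_zc zeta (s + 1) c Hz).
  rewrite Es, Hre in Hu.
  specialize (Hu ltac:(intros E1; apply (Hs 0%Z); lra) ltac:(intros E1; apply (Hs 1%Z); lra) Hc).
  replace (s + 1 - 1)%C with s in Hu by ring.
  assert (N0 : s <> RtoC 0) by (intros E1; apply (Hs 0%Z); rewrite E1; reflexivity).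
  assert (N1 : (s - 1)%C <> RtoC 0).
  { intros E1. apply Ceq_minus in E1. apply (Hs 1%Z). rewrite E1. reflexivity. }
  assert (H1 := sums_scal (s * (s - 1)) _ _ (Hu y Hy)).
  assert (H2 := sums_scal (RtoC (y ^ 2)) _ _ (Hc y Hy)).
  assert (H3 : sums (sh (fun i => RtoC (y ^ 2) * (zc zeta (s - 1) i * RtoC (y ^ (2 * i))))%C)
     (RtoC (y ^ 2) * (G (s - 1) y - c * cpow y (s - 1 - 1)))%C).
  { rewrite <- (Cplus_0_l (_ * _)). apply (sums_cons (sh _)). exact H2. }
  assert (H4 := sums_plus _ _ _ _ H1 H3).
  match type of H4 with sums _ ?v =>
    replace (s * (s - 1) * G (s + 1) y + RtoC (y ^ 2) * G (s - 1) y)%C with v end.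
  - eapply sums_ext; [|exact H4]. intros k. cbv beta.
    assert (Hsub : sub1_mul_zeta zeta (s + 1 - RtoC (INR (2 * k))) =
      ((s - RtoC (INR (2 * k))) * zeta (s + 1 - RtoC (INR (2 * k))))%C).
    { unfold sub1_mul_zeta. destruct (Ceq_dec _ _) as [E1|E1].
      - exfalso. apply (f_equal Re) in E1. unfold Cminus in E1.
        rewrite !re_plus, re_opp, !re_RtoC in E1. apply (Hs (Z.of_nat (2 * k))).
        rewrite <- INR_IZR_INZ. lra.
      - f_equal. ring. }
    unfold zeta_cos_term. rewrite Hsub.
    destruct k as [|k]; [simpl sh|change (sh ?f (S k)) with (f k); cbv beta].
    + rewrite zc_0. simpl. replace (s + 1 - 0)%C with (s + 1)%C by ring. field.
    + rewrite zc_S, Es. unfold primitive2, zc.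
      replace (s + 1 - RtoC (INR (2 * S k)))%C with (s - 1 - RtoC (INR (2 * k)))%C.
      2:{ replace (2 * S k)%nat with (S (S (2 * k))) by lia. rewrite !S_INR, !RtoC_plus. ring. }
      replace (2 * k + 1)%nat with (S (2 * k)) by lia. replace (2 * k + 2)%nat with (S (S (2 * k))) by lia.
      replace (2 * S k)%nat with (S (S (2 * k))) by lia.
      rewrite !fact_S_C, Cpow_S.
      replace (y ^ S (S (2 * k))) with (y ^ 2 * y ^ (2 * k)) by (simpl; ring). rewrite RtoC_mult.
      assert (NA := INR_S_C (S (2 * k))). assert (NB := INR_S_C (2 * k)). assert (NF := INR_fact_C (2 * k)).
      rewrite !S_INR, !RtoC_plus in *. field. repeat split; assumption.
  - replace (s + 1 - 1)%C with s by ring.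
    assert (Ey : (RtoC (y ^ 2) * cpow y (s - 1 - 1) = cpow y s)%C).
    { rewrite <- cpow_INR, <- cpow_plus by lra. f_equal. simpl (INR 2). rewrite RtoC_plus. ring. }
    transitivity (s * (s - 1) * G (s + 1) y + RtoC (y ^ 2) * G (s - 1) y
      + c * (cpow y s - RtoC (y ^ 2) * cpow y (s - 1 - 1)))%C; [field; split; assumption|].
    rewrite Ey. ring.
Qed.


(** Quotient of the functional equations at [t - 2i] and at [t]: the gamma factors
    leave a rising factorial. *)
Lemma functional_equation (zeta : C -> C) (t : C) (i : nat) : is_riemann_zeta zeta -> Re t < 0 ->
  (zeta (1 - t) * ((- (1)) ^ i * zeta (t - RtoC (INR (2 * i)))) * RtoC ((2 * PI) ^ (2 * i)))%C
  = (zeta t * rising (1 - t) (2 * i) * zeta (1 - t + RtoC (INR (2 * i))))%C.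
Proof.
  intros Hz Ht. assert (HP := PI_RGT_0).
  destruct (expansion_neg zeta t Hz Ht) as [c Hc].
  assert (Hcoef := fun j => expn_neg_coef zeta Hz j t c _ Ht Hc). cbv beta in Hcoef.
  assert (H0 := Hcoef O). rewrite zc_0 in H0.
  assert (Hi := Hcoef i). unfold hcoef in *. unfold zc in Hi.
  replace (1 - t + RtoC (INR (2 * 0)))%C with (1 - t)%C in H0 by (simpl; ring).
  replace (bc (1 - t) (2 * 0)) with (RtoC 1) in H0 by (unfold bc; simpl; field).
  rewrite (Copp_plus_distr (1 - t)), cpow_plus, (cpow_opp _ (RtoC (INR (2 * i)))), cpow_INR in Hi by lra.
  unfold bc in Hi. rewrite <- H0.
  assert (Hf := INR_fact_C (2 * i)).
  assert (Hp : RtoC ((2 * PI) ^ (2 * i)) <> RtoC 0).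
  { intros E1. apply RtoC_inj in E1. revert E1. apply pow_nonzero. lra. }
  set (A := ((- (1)) ^ i * zeta (t - RtoC (INR (2 * i))))%C) in *.
  replace A with (A / RtoC (INR (fact (2 * i))) * RtoC (INR (fact (2 * i))))%C by (field; exact Hf).
  rewrite <- Hi. field. split; assumption.
Qed.

Lemma zeta_near_1 (zeta : C -> C) (w : C) : is_riemann_zeta zeta -> 3 <= Re w ->
  Cmod (zeta w - 1) <= 1 / 2.
Proof.
  intros Hz Hw.
  assert (H := sums_tail _ _ (sums_tail _ _ (zeta_sums zeta w Hz ltac:(lra)))).
  cbv beta in H. replace (zeta w - dir w 0 0 - dir w 0 1)%C with (zeta w - 1)%C in H.
  2:{ unfold dir. rewrite beta_0. simpl (INR 1). rewrite cpow_base_1. ring. }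
  apply le_epsilon. intros eps He. destruct (H eps He) as [N HN]. specialize (HN N (le_n _)).
  set (p := psum _ N) in HN.
  assert (Hp : Cmod p <= 1 / 2).
  { unfold p. eapply Rle_trans.
    - apply (Cmod_psum_le _ (fun n => Rpower (INR (S (S n))) (- (3)))). intros k _.
      rewrite Cmod_dir. apply Rpower_le_exponent; [|lra]. rewrite !S_INR. pose proof (pos_INR k); lra.
    - destruct (rsum_Rpower 2 (S N) ltac:(lra)) as [_ H3].
      replace (- 1 - 2) with (- (3)) in H3 by ring.
      assert (Hs : forall f n, rsum f (S n) = f O + rsum (fun k => f (S k)) n).
      { intros f n. induction n as [|n IH]; [simpl; ring|].
        change (rsum f (S (S n))) with (rsum f (S n) + f (S n)). rewrite IH. simpl; ring. }
      rewrite Hs in H3. cbv beta in H3. replace (Rpower (INR 1) (- (3))) with 1 in H3.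
      + lra.
      + simpl. unfold Rpower. rewrite ln_1, Rmult_0_r, exp_0. reflexivity. }
  replace (zeta w - 1)%C with (- (p - (zeta w - 1)) + p)%C by ring.
  eapply Rle_trans; [apply Cmod_triangle|]. rewrite Cmod_opp. lra.
Qed.

Fixpoint ratio (D : nat) (a : R) (n : nat) : R :=
  match n with O => 1 | S k => ratio D a k * ((INR (D + k) - a) / INR (D + k)) end.

Lemma ratio_base (D : nat) (a : R) (n : nat) : a <= INR D -> a <= INR (D + n).
Proof. intros HaD. rewrite plus_INR. pose proof (pos_INR n). lra. Qed.

Lemma ratio_pos (D : nat) (a : R) (n : nat) : 0 < a -> a <= INR D -> 0 <= ratio D a n.
Proof.
  intros Ha HaD. induction n as [|n IH]; simpl; [lra|]. pose proof (ratio_base D a n HaD).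
  apply Rmult_le_pos; [exact IH|]. apply Rdiv_le_0_compat; lra.
Qed.

Lemma rising_bound (D : nat) (a : R) (w : C) (n : nat) : 0 < a -> a <= INR D ->
  (forall j, Cmod (w + RtoC (INR j)) <= INR (D + j) - a) ->
  Cmod (rising w (S n)) <= ratio D a (S n) * INR (fact (D + n)).
Proof.
  intros Ha HaD H. induction n as [|n IH].
  - simpl ratio. change (rising w 1) with (1 * (w + RtoC (INR 0)))%C. specialize (H O). rewrite Nat.add_0_r in *.
    replace (1 * (w + RtoC (INR 0)))%C with (w + RtoC (INR 0))%C by ring.
    eapply Rle_trans; [exact H|]. rewrite Rmult_1_l.
    destruct D as [|D']; [simpl in HaD; lra|]. rewrite fact_simpl, mult_INR.
    assert (0 < INR (S D')) by (apply lt_0_INR; lia).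
    replace ((INR (S D') - a) / INR (S D') * (INR (S D') * INR (fact D')))
      with ((INR (S D') - a) * INR (fact D')) by (field; lra).
    assert (1 <= INR (fact D')) by (apply (le_INR 1), lt_O_fact).
    nra.
  - change (rising w (S (S n))) with (rising w (S n) * (w + RtoC (INR (S n))))%C.
    change (ratio D a (S (S n))) with (ratio D a (S n) * ((INR (D + S n) - a) / INR (D + S n))).
    rewrite Cmod_mult.
    replace (D + S n)%nat with (S (D + n)) at 3 by lia. rewrite fact_simpl.
    replace (S (D + n)) with (D + S n)%nat by lia. rewrite mult_INR.
    pose proof (ratio_base D a (S n) HaD).
    replace (ratio D a (S n) * ((INR (D + S n) - a) / INR (D + S n)) * (INR (D + S n) * INR (fact (D + n))))
      with (ratio D a (S n) * INR (fact (D + n)) * (INR (D + S n) - a)) by (field; lra).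
    apply Rmult_le_compat; [apply Cmod_ge_0|apply Cmod_ge_0|exact IH|apply H].
Qed.

(** Raabe's test, by telescoping [(D+n)(D+n-1) ratio n]. *)
Lemma ratio_telescope (D : nat) (a : R) (n : nat) : 0 < a -> a <= INR D ->
  (a - 2) * (INR (D + n) * ratio D a n) <=
  INR (D + n) * (INR (D + n) - 1) * ratio D a n
  - INR (D + S n) * (INR (D + S n) - 1) * ratio D a (S n).
Proof.
  intros Ha HaD. pose proof (ratio_base D a n HaD). pose proof (ratio_pos D a n Ha HaD).
  replace (INR (D + S n)) with (INR (D + n) + 1) by (rewrite Nat.add_succ_r, S_INR; reflexivity).
  simpl ratio. set (x := INR (D + n)) in *. set (r := ratio D a n) in *.
  replace (x * (x - 1) * r - (x + 1) * (x + 1 - 1) * (r * ((x - a) / x)))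
    with (r * (x * (x - 1) - (x + 1) * (x - a))) by (field; lra).
  nra.
Qed.

Lemma ex_series_ratio (D : nat) (a : R) : 2 < a -> a <= INR D ->
  ex_series (fun i => INR (D + S (2 * i)) * ratio D a (S (2 * i))).
Proof.
  intros Ha HaD. assert (Ha0 : 0 < a) by lra.
  set (f := fun n => INR (D + n) * ratio D a n).
  set (V := fun n => INR (D + n) * (INR (D + n) - 1) * ratio D a n).
  assert (Hf : forall n, 0 <= f n) by (intros; apply Rmult_le_pos; [apply pos_INR|now apply ratio_pos]).
  assert (HV : forall n, 0 <= V n).
  { intros n. pose proof (ratio_base D a n HaD). pose proof (ratio_pos D a n Ha0 HaD). unfold V.
    apply Rmult_le_pos; [nra|assumption]. }
  assert (Hs : forall n, (a - 2) * rsum (fun i => f (S (2 * i))) n <= V O - V (2 * n)%nat).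
  { intros n. induction n as [|n IH]; [simpl; lra|].
    change (rsum ?g (S n)) with (rsum g n + g n). cbv beta.
    pose proof (ratio_telescope D a (2 * n) Ha0 HaD). pose proof (ratio_telescope D a (S (2 * n)) Ha0 HaD).
    fold (V (2 * n)%nat) in *. fold (V (S (2 * n))) in *.
    replace (2 * S n)%nat with (S (S (2 * n))) by lia. fold (V (S (S (2 * n)))) in *.
    fold (f (2 * n)%nat) in *. fold (f (S (2 * n))) in *.
    pose proof (Hf (2 * n)%nat). nra. }
  assert (Hfin : ex_finite_lim_seq (sum_n (fun i => f (S (2 * i))))).
  { apply ex_finite_lim_seq_incr with (V O / (a - 2)).
    - intros n. rewrite !sum_n_rsum. change (rsum ?g (S (S n))) with (rsum g (S n) + g (S n)).
      cbv beta. pose proof (Hf (S (2 * S n))). lra.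
    - intros n. rewrite sum_n_rsum. apply Rle_div_r; [lra|]. pose proof (Hs (S n)). pose proof (HV (2 * S n)%nat). lra. }
  destruct Hfin as [l Hl]. exists l. exact Hl.
Qed.

Lemma term_bound (zeta : C -> C) (s0 : C) : is_riemann_zeta zeta -> 2 < Re s0 ->
  exists (K0 : nat) (d : R) (B : nat -> R), 0 < d /\ (forall i, 0 <= B i) /\ ex_series B /\
    forall e y i, 0 < e < d -> 0 < y < 2 * PI ->
      Cmod (zeta_cos_term zeta (s0 + RtoC e) y (K0 + i)) <= B i.
Proof.
  intros Hz Hs0. assert (HP := PI_RGT_0).
  set (s0r := Re s0) in *. set (tau := Im s0). set (eta := (s0r - 2) / 2). set (a := 2 + eta).
  assert (Heta : 0 < eta) by (unfold eta; lra).
  assert (Htau : 0 <= tau ^ 2 / eta) by (apply Rdiv_le_0_compat; [apply pow2_ge_0|exact Heta]).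
  destruct (nfloor_ex (s0r + 4 + tau ^ 2 / eta)) as [n0 [_ Hn0]]; [lra|].
  set (K0 := S n0). set (D := (2 * K0)%nat).
  assert (HK0 : s0r + 4 + tau ^ 2 / eta < INR K0) by (unfold K0; rewrite S_INR; exact Hn0).
  assert (HD : INR K0 <= INR D) by (apply le_INR; unfold D; lia).
  set (t0 := (s0 + 1 - RtoC (INR D))%C).
  assert (Ht0 : Re t0 = s0r + 1 - INR D).
  { unfold t0, Cminus. rewrite !re_plus, re_opp, !re_RtoC. reflexivity. }
  assert (Ht01 : t0 <> RtoC 1) by (intros E1; rewrite E1, re_RtoC in Ht0; lra).
  destruct (cana_cont zeta t0 (analytic_cana _ _ (proj2 Hz t0 Ht01)) 1 Rlt_0_1) as [d0 [Hd0 Hcont]].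
  set (Mt := Cmod (zeta t0) + 1).
  set (M := (2 * PI) ^ D * (3 * Mt) * (Cmod s0 + 3)).
  assert (HMt : 0 <= Mt) by (unfold Mt; pose proof (Cmod_ge_0 (zeta t0)); lra).
  assert (HaD : a <= INR D) by (unfold a, eta; lra).
  assert (Ha : 2 < a) by (unfold a; lra).
  assert (HM : 0 <= M).
  { unfold M. pose proof (Cmod_ge_0 s0). apply Rmult_le_pos; [apply Rmult_le_pos; [apply pow_le|]|]; lra. }
  exists K0, (Rmin (1 / 2) d0), (fun i => M * (INR (D + S (2 * i)) * ratio D a (S (2 * i)))).
  split; [apply Rmin_pos; lra|]. split.
  { intros i. apply Rmult_le_pos; [exact HM|]. apply Rmult_le_pos; [apply pos_INR|apply ratio_pos; lra]. }
  split.
  { apply (ex_series_Rscal M), ex_series_ratio; assumption. }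
  intros e y i He Hy.
  assert (He1 : e < 1 / 2) by (eapply Rlt_le_trans; [apply He|apply Rmin_l]).
  assert (He2 : e < d0) by (eapply Rlt_le_trans; [apply He|apply Rmin_r]).
  set (s := (s0 + RtoC e)%C).
  assert (Hsr : Re s = s0r + e) by (unfold s; rewrite re_plus, re_RtoC; reflexivity).
  assert (Hsi : Im s = tau) by (unfold s; rewrite im_plus, im_RtoC; unfold tau; ring).
  set (t := (s + 1 - RtoC (INR D))%C).
  assert (Htr : Re t = s0r + e + 1 - INR D).
  { unfold t, Cminus. rewrite !re_plus, re_opp, !re_RtoC, Hsr. reflexivity. }
  set (w := (1 - t)%C).
  assert (Ew : w = (RtoC (INR D) - s)%C) by (unfold w, t; ring).
  assert (Hwr : Re w = INR D - (s0r + e)) by (unfold w; rewrite Re_1_minus, Htr; ring).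
  assert (Hzt : Cmod (zeta t) <= Mt).
  { specialize (Hcont t). replace (t - t0)%C with (RtoC e) in Hcont by (unfold t, t0, s; ring).
    rewrite Cmod_R, Rabs_pos_eq in Hcont by lra. specialize (Hcont He2).
    pose proof (Cmod_sub_le (zeta t) (zeta t0)). unfold Mt. lra. }
  assert (Hzw : 1 / 2 <= Cmod (zeta w)).
  { pose proof (zeta_near_1 zeta w Hz ltac:(lra)). pose proof (Cmod_sub_le 1 (zeta w)).
    rewrite Cmod_minus_sym, Cmod_1 in *. rewrite Cmod_minus_sym in H. lra. }
  assert (Hzwi : Cmod (zeta (w + RtoC (INR (2 * i)))%C) <= 3 / 2).
  { pose proof (zeta_near_1 zeta (w + RtoC (INR (2 * i))) Hz
      ltac:(rewrite re_plus, re_RtoC; pose proof (pos_INR (2 * i)); lra)) as H.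
    pose proof (Cmod_sub_le (zeta (w + RtoC (INR (2 * i)))%C) 1). rewrite Cmod_1 in *. lra. }
  assert (Hwj : forall j, Cmod (w + RtoC (INR j)) <= INR (D + j) - a).
  { intros j. pose proof (ratio_base D a j HaD).
    apply Rsqr_incr_0_var; [|lra]. unfold Rsqr.
    replace (Cmod (w + RtoC (INR j)) * Cmod (w + RtoC (INR j))) with (Cmod (w + RtoC (INR j)) ^ 2) by ring.
    rewrite Cmod2_alt. rewrite Ew. unfold Cminus.
    rewrite !re_plus, !im_plus, re_opp, im_opp, !re_RtoC, !im_RtoC, Hsr, Hsi, plus_INR.
    pose proof (pos_INR j). set (x := INR D + INR j).
    replace (INR D + - (s0r + e) + INR j) with (x - (s0r + e)) by (unfold x; ring).
    assert (Ht2 : tau ^ 2 <= eta * (2 * x - (s0r + e) - a)).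
    { replace (tau ^ 2) with (eta * (tau ^ 2 / eta)) by (field; lra).
      apply Rmult_le_compat_l; [lra|]. unfold x, a, eta in *. lra. }
    assert (eta <= s0r + e - a) by (unfold a, eta; lra).
    assert (0 <= 2 * x - (s0r + e) - a) by (unfold x, a, eta in *; lra).
    replace ((0 + - tau + 0) ^ 2) with (tau ^ 2) by ring. nra. }
  set (k := (K0 + i)%nat). assert (Ek : (2 * k = D + 2 * i)%nat) by (unfold k, D; lia).
  assert (Hw1 : (s + 1 - RtoC (INR (2 * k)))%C = (t - RtoC (INR (2 * i)))%C).
  { rewrite Ek, plus_INR, RtoC_plus. unfold t. ring. }
  assert (Hsub : Cmod (sub1_mul_zeta zeta (s + 1 - RtoC (INR (2 * k)))) =
     Cmod (w + RtoC (INR (2 * i))) * Cmod (zeta (t - RtoC (INR (2 * i)))%C)).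
  { unfold sub1_mul_zeta. destruct (Ceq_dec _ _) as [E1|E1].
    - exfalso. rewrite Hw1 in E1. apply (f_equal Re) in E1. unfold Cminus in E1.
      rewrite re_plus, re_opp, !re_RtoC, Htr in E1. pose proof (pos_INR (2 * i)). lra.
    - rewrite Cmod_mult, Hw1. f_equal. rewrite <- Cmod_opp. f_equal. unfold w. ring. }
  unfold zeta_cos_term. fold s. rewrite !Cmod_mult, Hsub, Cmod_pow, Cmod_opp, Cmod_1, pow1, Rmult_1_l.
  rewrite Cmod_div, Cmod_INR, (Cmod_R (y ^ _)), Rabs_pos_eq by (apply INR_fact_C || (apply pow_le; lra)).
  assert (HFE := f_equal Cmod (functional_equation zeta t i Hz ltac:(lra))). fold w in HFE.
  rewrite !Cmod_mult, Cmod_pow, Cmod_opp, Cmod_1, pow1, Rmult_1_l, Cmod_R, Rabs_pos_eq in HFE by (apply pow_le; lra).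
  set (Z := Cmod (zeta (t - RtoC (INR (2 * i)))%C)) in *.
  assert (HZ : Z * (2 * PI) ^ (2 * i) <= 3 * Mt * Cmod (rising w (2 * i))).
  { assert (HZ0 : 0 <= Z * (2 * PI) ^ (2 * i)) by (apply Rmult_le_pos; [apply Cmod_ge_0|apply pow_le; lra]).
    assert (H1 : 1 / 2 * (Z * (2 * PI) ^ (2 * i)) <= Cmod (zeta w) * (Z * (2 * PI) ^ (2 * i)))
      by (apply Rmult_le_compat_r; lra).
    assert (H2 : Cmod (zeta t) * Cmod (rising w (2 * i)) * Cmod (zeta (w + RtoC (INR (2 * i)))%C)
      <= Mt * Cmod (rising w (2 * i)) * (3 / 2)).
    { apply Rmult_le_compat; [apply Rmult_le_pos; apply Cmod_ge_0|apply Cmod_ge_0| |exact Hzwi].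
      apply Rmult_le_compat_r; [apply Cmod_ge_0|exact Hzt]. }
    rewrite <- HFE in H2. lra. }
  assert (Hy2 : y ^ (2 * k) <= (2 * PI) ^ D * (2 * PI) ^ (2 * i)).
  { rewrite Ek, <- pow_add. apply pow_incr; lra. }
  assert (Hrise := rising_bound D a w (2 * i) ltac:(lra) HaD Hwj).
  change (rising w (S (2 * i))) with (rising w (2 * i) * (w + RtoC (INR (2 * i))))%C in Hrise.
  rewrite Cmod_mult, <- Ek in Hrise.
  assert (Hs2 : Cmod (s + RtoC (INR (2 * k)) - 1) <= (Cmod s0 + 3) * INR (D + S (2 * i))).
  { unfold s. replace (s0 + RtoC e + RtoC (INR (2 * k)) - 1)%C with (s0 + RtoC (e + INR (2 * k) - 1))%C
      by (rewrite RtoC_minus, RtoC_plus; ring).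
    eapply Rle_trans; [apply Cmod_triangle|]. rewrite Cmod_R.
    assert (Hk1 : 1 <= INR (2 * k)) by (apply (le_INR 1); lia).
    rewrite Rabs_pos_eq by lra. replace (D + S (2 * i))%nat with (S (2 * k)) by lia. rewrite S_INR.
    pose proof (Cmod_ge_0 s0). nra. }
  set (P := INR (fact (2 * k))) in *. assert (HPp : 0 < P) by apply INR_fact_lt_0.
  set (X := Cmod (s + RtoC (INR (2 * k)) - 1)) in *. assert (HX : 0 <= X) by apply Cmod_ge_0.
  set (W := Cmod (w + RtoC (INR (2 * i)))) in *. assert (HW : 0 <= W) by apply Cmod_ge_0.
  assert (HZ0 : 0 <= Z) by apply Cmod_ge_0.
  apply Rle_trans with (X / P * ((2 * PI) ^ D * (2 * PI) ^ (2 * i)) * (W * Z)).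
  { apply Rmult_le_compat_r; [apply Rmult_le_pos; assumption|].
    apply Rmult_le_compat_l; [apply Rdiv_le_0_compat; lra|exact Hy2]. }
  replace (X / P * ((2 * PI) ^ D * (2 * PI) ^ (2 * i)) * (W * Z))
    with (X * ((2 * PI) ^ D * ((Z * (2 * PI) ^ (2 * i)) * W / P))) by (field; lra).
  replace (M * (INR (D + S (2 * i)) * ratio D a (S (2 * i))))
    with (((Cmod s0 + 3) * INR (D + S (2 * i))) * ((2 * PI) ^ D * (3 * Mt * ratio D a (S (2 * i)))))
    by (unfold M; ring).
  assert (HpD : 0 <= (2 * PI) ^ D) by (apply pow_le; lra).
  assert (HZP : 0 <= Z * (2 * PI) ^ (2 * i)) by (apply Rmult_le_pos; [exact HZ0|apply pow_le; lra]).
  apply Rmult_le_compat; [exact HX| |exact Hs2|].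
  { apply Rmult_le_pos; [exact HpD|]. apply Rdiv_le_0_compat; [apply Rmult_le_pos; assumption|exact HPp]. }
  apply Rmult_le_compat_l; [exact HpD|].
  apply (proj2 (Rle_div_l _ _ P HPp)).
  apply Rle_trans with (3 * Mt * Cmod (rising w (2 * i)) * W).
  { apply Rmult_le_compat_r; assumption. }
  rewrite !Rmult_assoc. apply Rmult_le_compat_l; [lra|]. apply Rmult_le_compat_l; [exact HMt|].
  exact Hrise.
Qed.

(** * Passage to the limit *)

Definition Clim (u : nat -> C) (l : C) : Prop :=
  forall eps, 0 < eps -> exists N, forall n, (N <= n)%nat -> Cmod (u n - l) < eps.

Lemma Clim_const (c : C) : Clim (fun _ => c) c.
Proof.
  intros eps He. exists O. intros n _. replace (c - c)%C with (RtoC 0) by ring. rewrite Cmod_0. exact He.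
Qed.

Lemma Clim_ext (u v : nat -> C) (l : C) : (forall n, u n = v n) -> Clim u l -> Clim v l.
Proof. intros E1 H eps He. destruct (H eps He) as [N HN]. exists N. intros n Hn. rewrite <- E1. auto. Qed.

Lemma Clim_plus (u v : nat -> C) (l m : C) : Clim u l -> Clim v m -> Clim (fun n => u n + v n)%C (l + m)%C.
Proof.
  intros H H' eps He.
  destruct (H (eps / 2)) as [N HN]; [lra|]. destruct (H' (eps / 2)) as [N' HN']; [lra|].
  exists (N + N')%nat. intros n Hn.
  replace (u n + v n - (l + m))%C with ((u n - l) + (v n - m))%C by ring.
  eapply Rle_lt_trans; [apply Cmod_triangle|].
  specialize (HN n ltac:(lia)). specialize (HN' n ltac:(lia)). lra.
Qed.

Lemma Clim_mult (u v : nat -> C) (l m : C) : Clim u l -> Clim v m -> Clim (fun n => u n * v n)%C (l * m)%C.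
Proof.
  intros H H' eps He.
  pose proof (Cmod_ge_0 l) as Hl. pose proof (Cmod_ge_0 m) as Hm.
  set (e := Rmin 1 (eps / (Cmod l + Cmod m + 2))).
  assert (Hdiv : 0 < eps / (Cmod l + Cmod m + 2)) by (apply Rdiv_lt_0_compat; lra).
  assert (He0 : 0 < e) by (apply Rmin_pos; lra).
  assert (He1 : e <= 1) by apply Rmin_l.
  assert (He2 : e * (Cmod l + Cmod m + 2) <= eps).
  { apply (Rle_div_r _ _ (Cmod l + Cmod m + 2)); [lra|apply Rmin_r]. }
  destruct (H e He0) as [N HN]. destruct (H' e He0) as [N' HN'].
  exists (N + N')%nat. intros n Hn. specialize (HN n ltac:(lia)). specialize (HN' n ltac:(lia)).
  replace (u n * v n - l * m)%C with ((u n - l) * (v n - m) + ((u n - l) * m + l * (v n - m)))%C by ring.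
  eapply Rle_lt_trans; [apply Cmod_triangle|].
  eapply Rle_lt_trans; [apply Rplus_le_compat_l, Cmod_triangle|]. rewrite !Cmod_mult.
  pose proof (Cmod_ge_0 (u n - l)). pose proof (Cmod_ge_0 (v n - m)). nra.
Qed.

Lemma Clim_shift (c : C) (u : nat -> C) : Clim u (RtoC 0) -> Clim (fun n => c + u n)%C c.
Proof.
  intros H. assert (H' := Clim_plus _ _ _ _ (Clim_const c) H). rewrite Cplus_0_r in H'. exact H'.
Qed.

Lemma Clim_le (u : nat -> C) (l : C) (B : R) : Clim u l -> (forall n, Cmod (u n) <= B) -> Cmod l <= B.
Proof.
  intros H HB. apply le_epsilon. intros eps He. destruct (H eps He) as [N HN].
  specialize (HN N (le_n _)). specialize (HB N). pose proof (Cmod_sub_le l (u N)).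
  rewrite Cmod_minus_sym in HN. lra.
Qed.

Lemma Clim_psum (u : nat -> nat -> C) (v : nat -> C) (n : nat) :
  (forall k, Clim (fun m => u m k) (v k)) -> Clim (fun m => psum (u m) n) (psum v n).
Proof.
  intros H. induction n as [|n IH]; simpl; [apply Clim_const|]. apply Clim_plus; [exact IH|apply H].
Qed.

Lemma Clim_cont (f : C -> C) (u : nat -> C) (l : C) :
  (forall eps, 0 < eps -> exists d, 0 < d /\ forall z, Cmod (z - l) < d -> Cmod (f z - f l) < eps) ->
  Clim u l -> Clim (fun n => f (u n)) (f l).
Proof.
  intros Hf H eps He. destruct (Hf eps He) as [d [Hd Hc]]. destruct (H d Hd) as [N HN].
  exists N. intros n Hn. apply Hc, HN, Hn.
Qed.

Lemma Clim_derC (f : R -> C) (u : nat -> R) (x : R) (l : C) :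
  derC f x l -> Clim (fun n => RtoC (u n)) (RtoC x) -> Clim (fun n => f (u n)) (f x).
Proof.
  intros Hf H eps He. destruct (derC_continuous _ _ _ Hf eps He) as [d [Hd Hc]].
  destruct (H d Hd) as [N HN]. exists N. intros n Hn. apply Hc.
  specialize (HN n Hn). rewrite <- RtoC_minus, Cmod_R in HN. exact HN.
Qed.

Lemma tannery (u : nat -> nat -> C) (S : nat -> C) (v : nat -> C) (L : C) (K : nat) (B : nat -> R) :
  (forall m, sums (u m) (S m)) -> (forall k, Clim (fun m => u m k) (v k)) ->
  (forall m k, Cmod (u m (K + k)%nat) <= B k) -> (forall k, 0 <= B k) -> ex_series B ->
  Clim S L -> sums v L.
Proof.
  intros Hs Hp HB HB0 HeB HS eps He.
  destruct (rsum_cv B HeB (eps / 2)) as [N HN]; [lra|].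
  exists (K + N)%nat. intros n Hn.
  assert (Hlim : Clim (fun m => psum (u m) n + (- (1)) * S m)%C (psum v n + (- (1)) * L)%C).
  { apply Clim_plus; [apply Clim_psum, Hp|]. apply Clim_mult; [apply Clim_const|exact HS]. }
  replace (psum v n - L)%C with (psum v n + (- (1)) * L)%C by ring.
  apply Rle_lt_trans with (eps / 2); [|lra].
  apply (Clim_le _ _ _ Hlim). intros m.
  replace (psum (u m) n + (- (1)) * S m)%C with (- (S m - psum (u m) n))%C by ring. rewrite Cmod_opp.
  assert (Hd := sums_drop _ _ K (Hs m)).
  replace n with (K + (n - K))%nat by lia. rewrite psum_app.
  replace (S m - (psum (u m) K + psum (fun k => u m (K + k)%nat) (n - K)))%C
    with (S m - psum (u m) K - psum (fun k => u m (K + k)%nat) (n - K))%C by ring.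
  eapply Rle_trans; [apply (sums_tail_bound _ B); [exact Hd|intros; apply HB|exact HB0|exact HeB]|].
  eapply Rle_trans; [apply Rle_abs|]. apply Rlt_le, HN. lia.
Qed.

Lemma tannery_lim (u : nat -> nat -> C) (S : nat -> C) (v : nat -> C) (B : nat -> R) :
  (forall m, sums (u m) (S m)) -> (forall k, Clim (fun m => u m k) (v k)) ->
  (forall m k, Cmod (u m k) <= B k) -> ex_series B -> sums v (tsum v) /\ Clim S (tsum v).
Proof.
  intros Hs Hp HB HeB.
  assert (HB0 : forall k, 0 <= B k) by (intros k; eapply Rle_trans; [apply Cmod_ge_0|apply (HB O)]).
  assert (Hv : forall k, Cmod (v k) <= B k) by (intros k; apply (Clim_le _ _ _ (Hp k)); intros; apply HB).
  assert (Hsv := asum_tsum v (asum_le _ _ Hv HeB)). split; [exact Hsv|].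
  intros eps He. destruct (rsum_cv B HeB (eps / 3)) as [N HN]; [lra|]. specialize (HN N (le_n _)).
  pose proof (Rle_abs (Series B - rsum B N)).
  destruct (Clim_psum u v N Hp (eps / 3)) as [M HM]; [lra|].
  exists M. intros m Hm. specialize (HM m Hm).
  pose proof (sums_tail_bound _ B _ N (Hs m) (fun k _ => HB m k) HB0 HeB).
  pose proof (sums_tail_bound _ B _ N Hsv (fun k _ => Hv k) HB0 HeB).
  replace (S m - tsum v)%C with ((S m - psum (u m) N) + ((psum (u m) N - psum v N) + - (tsum v - psum v N)))%C by ring.
  eapply Rle_lt_trans; [apply Cmod_triangle|].
  eapply Rle_lt_trans; [apply Rplus_le_compat_l, Cmod_triangle|]. rewrite Cmod_opp. lra.
Qed.

Lemma zeta_residue_bound (zeta : C -> C) (a : R) : is_riemann_zeta zeta -> 0 < a ->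
  Cmod (RtoC a * zeta (1 + RtoC a)%C - 1) <= a.
Proof.
  intros Hz Ha.
  assert (Hre : Re (1 + RtoC a) = 1 + a) by (rewrite re_plus, !re_RtoC; reflexivity).
  assert (Hs := zeta_sums zeta (1 + RtoC a) Hz ltac:(lra)).
  apply sums_tail in Hs. simpl dir in Hs at 2.
  assert (Hp : forall n, psum (fun k => dir (1 + RtoC a) 0 (S k)) n
     = RtoC (rsum (fun k => Rpower (INR (S k)) (- 1 - a)) n)).
  { intros n. induction n as [|n IH]; [reflexivity|].
    change (rsum ?f (S n)) with (rsum f n + f n). rewrite RtoC_plus, <- IH.
    change (psum ?f (S n)) with (psum f n + f n)%C. f_equal.
    unfold dir. rewrite beta_0. unfold cpow, Rpower. rewrite <- Cexp_RtoC. f_equal.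
    rewrite RtoC_mult. f_equal. unfold Rminus. rewrite RtoC_plus, RtoC_opp, RtoC_m1. ring. }
  apply le_epsilon. intros eps He.
  destruct (Hs (eps / (2 * a))) as [N HN]; [apply Rdiv_lt_0_compat; lra|].
  set (x := exp (- ln (eps / 2) / a)).
  destruct (nfloor_ex x) as [n1 [_ Hn1]]; [apply Rlt_le, exp_pos|].
  set (n := (N + n1)%nat). specialize (HN n ltac:(unfold n; lia)). rewrite Hp in HN.
  destruct (rsum_Rpower a n Ha) as [B1 B2].
  set (r := rsum _ n) in *.
  assert (Hn : Rpower (INR n + 1) (- a) <= eps / 2).
  { assert (Hxn : x <= INR n + 1) by (unfold n; rewrite plus_INR; pose proof (pos_INR N); lra).
    eapply Rle_trans; [apply (Rpower_le_base_neg x); [apply exp_pos|exact Hxn|lra]|].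
    unfold Rpower, x. rewrite ln_exp. replace (- a * (- ln (eps / 2) / a)) with (ln (eps / 2)) by (field; lra).
    rewrite exp_ln; lra. }
  replace (RtoC a * zeta (1 + RtoC a)%C - 1)%C
    with (- (RtoC a * (RtoC r - (zeta (1 + RtoC a)%C - 0))) + RtoC (a * r - 1))%C
    by (rewrite RtoC_minus, RtoC_mult; ring).
  eapply Rle_trans; [apply Cmod_triangle|]. rewrite Cmod_opp, Cmod_mult, !Cmod_R, (Rabs_pos_eq a) by lra.
  assert (a * Cmod (RtoC r - (zeta (1 + RtoC a)%C - 0)) <= eps / 2).
  { replace (eps / 2) with (a * (eps / (2 * a))) by (field; lra). apply Rmult_le_compat_l; lra. }
  assert (Rabs (a * r - 1) <= a + eps / 2) by (apply Rabs_le; lra).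
  lra.
Qed.

Lemma Clim_inv_nat (d : R) : Clim (fun m => RtoC (d / (INR m + 2))) (RtoC 0).
Proof.
  intros eps He. assert (Hd : 0 < Rabs d + 1) by (pose proof (Rabs_pos d); lra).
  destruct (archimed_cor1 (eps / (Rabs d + 1))) as [N [HN HN0]]; [apply Rdiv_lt_0_compat; lra|].
  exists N. intros n Hn. rewrite <- RtoC_minus, Rminus_0_r, Cmod_R.
  assert (HN1 : 0 < INR N) by (apply lt_0_INR; exact HN0).
  assert (Hn1 : INR N <= INR n) by (apply le_INR, Hn).
  unfold Rdiv. rewrite Rabs_mult, Rabs_inv, (Rabs_pos_eq (INR n + 2)) by lra.
  apply Rle_lt_trans with ((Rabs d + 1) * / INR N).
  - apply Rmult_le_compat; [apply Rabs_pos|apply Rlt_le, Rinv_0_lt_compat; lra|lra|].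
    apply Rinv_le_contravar; lra.
  - apply (Rmult_lt_compat_l (Rabs d + 1)) in HN; [|exact Hd].
    replace ((Rabs d + 1) * (eps / (Rabs d + 1))) with eps in HN by (field; lra). exact HN.
Qed.

Lemma dirichlet_cos_limit (t0 : C) (e y : nat -> R) (y0 : R) : 1 < Re t0 ->
  (forall m, 0 < e m) -> (forall m, 0 < y m < 2 * PI) ->
  Clim (fun m => RtoC (e m)) (RtoC 0) -> Clim (fun m => RtoC (y m)) (RtoC y0) ->
  exists L, sums (fun n => dir t0 0 n * RtoC (cos (INR n * y0)))%C L /\
    Clim (fun m => G (t0 + RtoC (e m)) (y m)) L.
Proof.
  intros Ht0 He Hy Le Ly. eexists.
  apply (tannery_lim (fun m n => dir (t0 + RtoC (e m)) 0 n * RtoC (cos (INR n * y m)))%C _ _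
    (fun n => match n with O => 0 | S _ => Rpower (INR n) (- Re t0) end)).
  - intros m. apply G_sums; [|apply Hy]. rewrite re_plus, re_RtoC. specialize (He m). lra.
  - intros n. apply Clim_mult.
    + destruct n as [|n]; [exact (Clim_const (RtoC 0))|].
      apply Clim_ext with (fun m => cpow (INR (S n)) (- (t0 + RtoC (e m)))).
      { intros m. unfold dir. now rewrite beta_0. }
      unfold dir. rewrite beta_0.
      apply (Clim_cont (fun z => cpow (INR (S n)) (- z)) _ t0 (cana_cont _ _ (cana_cpow (INR (S n)) t0))).
      apply Clim_shift, Le.
    + apply (Clim_derC (fun x => RtoC (cos (INR n * x))) y y0 (RtoC (INR n * - sin (INR n * y0)))); [|exact Ly].
      apply derC_RtoC. auto_derive; [trivial|ring].
  - intros m [|n]; [simpl; rewrite Cmult_0_l, Cmod_0; lra|].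
    rewrite Cmod_mult, Cmod_dir, Cmod_R, re_plus, re_RtoC.
    rewrite <- (Rmult_1_r (Rpower (INR (S n)) (- Re t0))).
    apply Rmult_le_compat; [apply Rlt_le, exp_pos|apply Rabs_pos| |].
    + apply Rpower_le_exponent; [|specialize (He m); lra]. rewrite S_INR. pose proof (pos_INR n); lra.
    + apply Rabs_le, COS_bound.
  - apply (ex_series_incr_1 (fun n => match n with O => 0 | S _ => Rpower (INR n) (- Re t0) end)).
    apply ex_series_Rpower, Ht0.
Qed.

Lemma zeta_cos_term_limit (zeta : C -> C) (s0 : C) (e y : nat -> R) (y0 : R) (k : nat) :
  is_riemann_zeta zeta -> (forall m, 0 < e m) -> (forall m, noninteger (Re (s0 + RtoC (e m)))) ->
  Clim (fun m => RtoC (e m)) (RtoC 0) -> Clim (fun m => RtoC (y m)) (RtoC y0) ->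
  Clim (fun m => zeta_cos_term zeta (s0 + RtoC (e m)) (y m) k) (zeta_cos_term zeta s0 y0 k).
Proof.
  intros Hz He Hni Le Ly. unfold zeta_cos_term.
  assert (Ls : forall c : C, Clim (fun m => s0 + RtoC (e m) + c)%C (s0 + c)%C).
  { intros c. apply Clim_plus; [apply Clim_shift, Le|apply Clim_const]. }
  apply Clim_mult; [apply Clim_mult; [apply Clim_mult; [apply Clim_const|]|]|].
  - apply Clim_mult; [|apply Clim_const].
    apply Clim_ext with (fun m => s0 + RtoC (e m) + (RtoC (INR (2 * k)) - 1))%C; [intros; ring|].
    replace (s0 + RtoC (INR (2 * k)) - 1)%C with (s0 + (RtoC (INR (2 * k)) - 1))%C by ring. apply Ls.
  - apply Clim_ext with (fun m => RtoC (y m) ^ (2 * k))%C; [intros; apply RtoC_pow_C|].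
    rewrite <- RtoC_pow_C. induction (2 * k)%nat as [|j IH]; simpl; [apply Clim_const|].
    apply Clim_mult; assumption.
  - set (w0 := (s0 + 1 - RtoC (INR (2 * k)))%C).
    apply Clim_ext with (fun m => ((w0 + RtoC (e m) - 1) * zeta (w0 + RtoC (e m)))%C).
    { intros m. unfold sub1_mul_zeta.
      replace (s0 + RtoC (e m) + 1 - RtoC (INR (2 * k)))%C with (w0 + RtoC (e m))%C by (unfold w0; ring).
      destruct (Ceq_dec _ _) as [E1|E1]; [|reflexivity]. exfalso.
      apply (f_equal Re) in E1. unfold w0, Cminus in E1. rewrite !re_plus, re_opp, !re_RtoC in E1.
      apply (Hni m (Z.of_nat (2 * k))). rewrite <- INR_IZR_INZ, re_plus, re_RtoC. lra. }
    unfold sub1_mul_zeta. destruct (Ceq_dec w0 1) as [E1|E1].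
    + rewrite E1. intros eps Heps. destruct (Le eps Heps) as [N HN]. exists N. intros n Hn.
      replace (1 + RtoC (e n) - 1)%C with (RtoC (e n)) by ring.
      eapply Rle_lt_trans; [apply zeta_residue_bound; [exact Hz|apply He]|].
      specialize (HN n Hn). rewrite <- RtoC_minus, Cmod_R, Rminus_0_r in HN.
      pose proof (Rle_abs (e n)). lra.
    + assert (Lw : Clim (fun m => w0 + RtoC (e m))%C w0) by apply Clim_shift, Le.
      apply Clim_mult.
      * apply (Clim_plus _ (fun _ => - (1))%C _ (- (1))%C Lw). apply Clim_const.
      * apply (Clim_cont zeta); [|exact Lw]. apply cana_cont, analytic_cana, Hz, E1.
Qed.

Lemma noninteger_right (x : R) : exists d, 0 < d /\ forall e, 0 < e < d -> noninteger (x + e).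
Proof.
  destruct (archimed x) as [H1 H2]. exists (IZR (up x) - x). split; [lra|].
  intros e He n E1.
  assert (Hn1 : IZR n < IZR (up x)) by lra. apply lt_IZR in Hn1.
  assert (Hn2 : IZR (up x - 1) < IZR n) by (rewrite minus_IZR; lra). apply lt_IZR in Hn2. lia.
Qed.

Lemma identity_limit (zeta : C -> C) (s : C) (y0 : R) : is_riemann_zeta zeta ->
  2 < Re s -> 0 <= y0 <= 2 * PI ->
  exists A B,
    sums (fun n => dir (s + 1) 0 n * RtoC (cos (INR n * y0)))%C A /\
    sums (fun n => dir (s - 1) 0 n * RtoC (cos (INR n * y0)))%C B /\
    sums (zeta_cos_term zeta s y0) (s * (s - 1) * A + RtoC (y0 ^ 2) * B)%C.
Proof.
  intros Hz Hs Hy0. pose proof PI2_1 as HP.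
  destruct (term_bound zeta s Hz Hs) as [K [d1 [Bd [Hd1 [HB0 [HeB HB]]]]]].
  destruct (noninteger_right (Re s)) as [d2 [Hd2 Hni]].
  set (d := Rmin d1 d2). assert (Hd : 0 < d) by (apply Rmin_pos; assumption).
  set (e := fun m => d / (INR m + 2)).
  assert (He : forall m, 0 < e m < d).
  { intros m. pose proof (pos_INR m). unfold e. split; [apply Rdiv_lt_0_compat; lra|].
    apply (proj2 (Rlt_div_l _ _ (INR m + 2) ltac:(lra))). nra. }
  assert (Hed1 : forall m, 0 < e m < d1) by (intros m; pose proof (He m); pose proof (Rmin_l d1 d2); subst d; lra).
  assert (Hed2 : forall m, 0 < e m < d2) by (intros m; pose proof (He m); pose proof (Rmin_r d1 d2); subst d; lra).
  assert (Le : Clim (fun m => RtoC (e m)) (RtoC 0)) by apply Clim_inv_nat.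
  set (y := fun m => y0 + (1 - y0) / (INR m + 2)).
  assert (Hy : forall m, 0 < y m < 2 * PI).
  { intros m. pose proof (pos_INR m). unfold y.
    assert (Hi : 0 < / (INR m + 2) <= / 2).
    { split; [apply Rinv_0_lt_compat; lra|]. apply Rinv_le_contravar; lra. }
    unfold Rdiv. set (h := / (INR m + 2)) in *. split; nra. }
  assert (Ly : Clim (fun m => RtoC (y m)) (RtoC y0)).
  { apply Clim_ext with (fun m => RtoC y0 + RtoC ((1 - y0) / (INR m + 2)))%C;
      [intros m; unfold y; now rewrite RtoC_plus|].
    apply Clim_shift, Clim_inv_nat. }
  assert (Hsni : forall m, noninteger (Re (s + RtoC (e m)))).
  { intros m. rewrite re_plus, re_RtoC. apply Hni, Hed2. }
  destruct (dirichlet_cos_limit (s + 1) e y y0) as [A [HA LA]]; try assumption.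
  { rewrite re_plus, re_RtoC. lra. }
  { intros m. apply He. }
  destruct (dirichlet_cos_limit (s - 1) e y y0) as [B [HBs LB]]; try assumption.
  { rewrite Re_minus_1. lra. }
  { intros m. apply He. }
  exists A, B. split; [exact HA|]. split; [exact HBs|].
  apply (tannery (fun m => zeta_cos_term zeta (s + RtoC (e m)) (y m))
    (fun m => (s + RtoC (e m)) * (s + RtoC (e m) - 1) * G (s + RtoC (e m) + 1) (y m)
              + RtoC (y m ^ 2) * G (s + RtoC (e m) - 1) (y m))%C _ _ K Bd).
  - intros m. apply generic_identity; [exact Hz|apply Hsni|apply Hy].
  - intros k. apply zeta_cos_term_limit; try assumption. intros m. apply He.
  - intros m k. apply HB; [apply Hed1|apply Hy].
  - exact HB0.
  - exact HeB.
  - assert (Ls : Clim (fun m => s + RtoC (e m))%C s) by apply Clim_shift, Le.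
    apply Clim_plus; apply Clim_mult.
    + apply Clim_mult; [exact Ls|]. apply (Clim_plus _ (fun _ => - (1))%C _ (- (1))%C Ls), Clim_const.
    + eapply Clim_ext; [|exact LA]. intros m. cbv beta. f_equal. ring.
    + apply Clim_ext with (fun m => RtoC (y m) * (RtoC (y m) * 1))%C; [intros m; simpl; now rewrite !RtoC_mult|].
      simpl pow. rewrite !RtoC_mult. apply Clim_mult; [exact Ly|]. apply Clim_mult; [exact Ly|apply Clim_const].
    + eapply Clim_ext; [|exact LB]. intros m. cbv beta. f_equal. ring.
Qed.

Lemma cos_dirichlet_sum_dir (t : C) (y l : R) (A : C) : Rabs y = l ->
  sums (fun n => dir t 0 n * RtoC (cos (INR n * l)))%C A -> cos_dirichlet_sum t y A.
Proof.
  intros Hl H. apply sums_is_series. apply sums_tail in H.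
  replace (A - dir t 0 0 * RtoC (cos (INR 0 * l)))%C with A in H by (simpl; ring).
  eapply sums_ext; [|exact H]. intros n. cbv beta. rewrite nat_Cpow_inv. unfold dir. rewrite beta_0.
  do 2 f_equal. rewrite <- Hl. unfold Rabs. destruct (Rcase_abs y); [|reflexivity].
  rewrite <- cos_neg. f_equal. ring.
Qed.

Theorem theorem4p8 :
  forall (zeta : C -> C), is_riemann_zeta zeta ->
  forall (c : R) (s : C) (x : R),
    (0 < c)%R -> (2 < Re s)%R -> (Rabs x <= 2 * c)%R ->
    exists A B : C,
      cos_dirichlet_sum (s + 1)%C (PI * x / c)%R A /\
      cos_dirichlet_sum (s - 1)%C (PI * x / c)%R B /\
      is_series (K := C_AbsRing) (V := C_NormedModule)
        (zeta_cos_term zeta s (PI * x / c)%R)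
        (s * (s - 1) * A + RtoC ((PI * x / c) ^ 2)%R * B)%C.
Proof.
  intros zeta Hz c s x Hc Hs Hx. assert (HP := PI_RGT_0).
  set (y := PI * x / c).
  assert (Hy : 0 <= Rabs y <= 2 * PI).
  { split; [apply Rabs_pos|]. unfold y, Rdiv.
    rewrite !Rabs_mult, Rabs_inv, (Rabs_pos_eq PI), (Rabs_pos_eq c) by lra.
    apply (Rle_div_l _ _ c); nra. }
  destruct (identity_limit zeta s (Rabs y) Hz Hs Hy) as [A [B [HA [HB HS]]]].
  exists A, B.
  split; [exact (cos_dirichlet_sum_dir _ _ _ _ eq_refl HA)|].
  split; [exact (cos_dirichlet_sum_dir _ _ _ _ eq_refl HB)|].
  apply sums_is_series. rewrite <- (pow2_abs y).
  eapply sums_ext; [|exact HS]. intros k. unfold zeta_cos_term.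
  rewrite !pow_mult, pow2_abs. reflexivity.
Qed.
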